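(* For every $9$-vertex combinatorial $3$-manifold $M$ there exist a neighbourly $9$-vertex combinatorial $3$-manifold $N$, an integer $0 \le l \le 10$, and a sequence of simplicial complexes $N = N_0, N_1, \dots, N_l = M$ such that for each $1 \le j \le l$ the complex $N_j$ is obtained from $N_{j-1}$ by a bistellar $2$-move.
   Context: A simplicial complex is a finite collection of non-empty finite sets (faces) closed under taking non-empty subsets; a face with $i+1$ elements is an $i$-face. The vertex set of $K$ is $V(K)$. Isomorphic simplicial complexes are identified. The standard $d$-sphere $S^{d}_{d+2}(V)$ on a set $V$ with $d+2$ elements is the complex of all non-empty proper subsets of $V$. Two simplicial complexes are combinatorially equivalent if they have isomorphic subdivisions (equivalently, their geometric carriers are pl homeomorphic). A combinatorial $d$-sphere is a complex combinatorially equivalent to $S^{d}_{d+2}$. The link ${\rm lk}_K(\sigma)$ of a face $\sigma$ is the complex of faces $\tau$ disjoint from $\sigma$ with $\sigma\cup\tau \in K$. A combinatorial $d$-manifold is a simplicial complex in which the link of every vertex is a combinatorial $(d-1)$-sphere. A $3$-dimensional simplicial complex is neighbourly if any two of its vertices form an edge. Bistellar moves: let $M$ be a $d$-dimensional simplicial complex and $0<i\le d$. If $\alpha$ is a $(d-i)$-face of $M$ with ${\rm lk}_M(\alpha) = S^{i-1}_{i+1}(\beta)$ for some $(i+1)$-set $\beta$ which is not a face of $M$, then $\kappa_\alpha(M)$ is the complex whose maximal faces are the maximal faces $\sigma$ of $M$ with $\alpha\not\subseteq\sigma$, together with the sets $\beta\cup(\alpha\setminus\{v\})$, $v\in\alpha$.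 The operation $M\mapsto\kappa_\alpha(M)$ is a bistellar $i$-move. (So in dimension $3$ a bistellar $2$-move removes an edge $\alpha$ whose link is the $3$-cycle on a $3$-set $\beta$ that is not a face.) *)

(* Defs.v *)
From mathcomp Require Import all_boot all_order all_algebra.
From mathcomp Require Import reals.

Set Implicit Arguments.
Unset Strict Implicit.
Unset Printing Implicit Defensive.

Import Order.TTheory GRing.Theory Num.Theory.

Section Complexes.
Variable T : finType.
Implicit Types (K M : {set {set T}}) (a b s t : {set T}).

(** [T] is only an ambient set: its elements need not all be vertices. *)
Definition simplicial_complex K : Prop :=
  set0 \notin K /\
  (forall s t, s \in K -> t \subset s -> t != set0 -> t \in K).

Definition vertices K : {set T} := [set v | [set v] \in K].

Definition has_dimension (d : nat) K : Prop := \max_(s in K) #|s| = d.+1.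

Definition facets K : {set {set T}} :=
  [set s in K | [forall t in K, (s \subset t) ==> (s == t)]].

Definition link K s : {set {set T}} :=
  [set t in K | [disjoint s & t] && (s :|: t \in K)].

(** [S^{n-2}_n(V)] for [n = #|V|]; it is empty if [n <= 1]. *)
Definition standard_sphere (V : {set T}) : {set {set T}} :=
  [set s | (s != set0) && (s \proper V)].

Definition neighbourly K : Prop :=
  forall u v, u \in vertices K -> v \in vertices K -> u != v ->
    [set u; v] \in K.

(** [M' = kappa_a(M)] for some [a]: a complex is determined by its facets. *)
Definition bistellar_move (d i : nat) M M' : Prop :=
  [/\ simplicial_complex M, has_dimension d M, 0 < i <= d,
      simplicial_complex M' &
      exists a b : {set T},
        [/\ a \in M /\ #|a| = (d - i).+1,
            #|b| = i.+1 /\ b \notin M,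
            link M a = standard_sphere b &
            facets M' = [set s in facets M | ~~ (a \subset s)]
                        :|: [set b :|: (a :\ v) | v in a]]].

End Complexes.

Definition isomorphic (T U : finType)
    (K : {set {set T}}) (L : {set {set U}}) : Prop :=
  exists2 f : T -> U, {in vertices K &, injective f} &
    L = [set f @: s | s : {set T} in K].

Section Geometry.
Local Open Scope ring_scope.
Variable R : realType.

Section Simplices.
Variables (n : nat) (T : finType) (p : T -> 'rV[R]_n).

(** The convex hull of [p v], [v \in s]; it is empty if [s] is. *)
Definition in_hull (s : {set T}) (x : 'rV[R]_n) : Prop :=
  exists c : T -> R,
    [/\ forall v, v \in s -> 0 <= c v,
        \sum_(v in s) c v = 1 &
        x = \sum_(v in s) c v *: p v].

Definition affinely_independent (s : {set T}) : Prop :=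
  forall c : T -> R,
    \sum_(v in s) c v = 0 -> \sum_(v in s) c v *: p v = 0 ->
    forall v, v \in s -> c v = 0.

(** [p] places the vertices of [K] in [R^n] so that the simplices spanned by
    the faces form a geometric simplicial complex; the values of [p] outside
    [vertices K] are irrelevant. *)
Definition geometric_realization (K : {set {set T}}) : Prop :=
  (forall s, s \in K -> affinely_independent s) /\
  (forall s t, s \in K -> t \in K ->
     forall x, in_hull s x /\ in_hull t x <-> in_hull (s :&: t) x).

Definition carrier (K : {set {set T}}) (x : 'rV[R]_n) : Prop :=
  exists2 s, s \in K & in_hull s x.

End Simplices.

(** [K'] has a geometric realization with the same carrier as one of [K], and
    with every simplex contained in a simplex of [K]. *)
Definition subdivision (U T : finType)
    (K' : {set {set U}}) (K : {set {set T}}) : Prop :=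
  simplicial_complex K' /\
  exists n (q : U -> 'rV[R]_n) (p : T -> 'rV[R]_n),
    [/\ geometric_realization q K', geometric_realization p K,
        forall x, carrier q K' x <-> carrier p K x &
        forall s, s \in K' ->
          exists2 t, t \in K & forall x, in_hull q s x -> in_hull p t x].

Definition combinatorially_equivalent (T U : finType)
    (K : {set {set T}}) (L : {set {set U}}) : Prop :=
  exists (T' U' : finType) (K' : {set {set T'}}) (L' : {set {set U'}}),
    [/\ subdivision K' K, subdivision L' L & isomorphic K' L'].

Definition combinatorial_sphere (d : nat) (T : finType)
    (K : {set {set T}}) : Prop :=
  combinatorially_equivalent K (standard_sphere [set: 'I_d.+2]).

(** The combinatorial (-1)-sphere is the empty complex. *)
Definition combinatorial_manifold (d : nat) (T : finType)
    (K : {set {set T}}) : Prop :=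
  simplicial_complex K /\
  forall v, v \in vertices K ->
    if d is e.+1 then combinatorial_sphere e (link K [set v])
    else link K [set v] = set0.

End Geometry.

(* Main.v *)
(** Let X be the set of tetrahedra of M.  Each triangle of X lies in two tetrahedra, and the link of
    every vertex is strongly connected with Euler characteristic 2.  Exhaustive searches over families
    of 4-subsets of 9 points show that such an X
    - has at least 17 members, hence by Euler's formula M has at least 26 edges out of 36;
    - has, unless every two vertices are adjacent, a triangle s whose two apexes x, y are not adjacent.
    Replacing the two tetrahedra x * s, y * s by the three that contain xy and an edge of s gives a
    manifold with one more edge, from which M is recovered by a bistellar 2-move at xy.  So at most 10
    steps lead to a neighbourly manifold.

    Two facts on combinatorial spheres are needed.  The links of vertices have the properties above:
    the local and global sums of (-1)^#|s| are Euler characteristics, with compact support, of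
    relatively open polyhedral sets, and hence do not depend on the subdivision; and a proper union of
    triangles closed under adjacency is excluded by a path avoiding the vertices.  Secondly, bistellar
    moves preserve combinatorial spheres: the obvious piecewise linear homeomorphism between the
    carriers becomes simplicial after cutting the simplices along finitely many hyperplanes. *)
Require Import Defs.
From HB Require Import structures.
From mathcomp Require Import all_boot all_order all_algebra.
From mathcomp Require Import reals boolp zify ring lra.

Set Implicit Arguments.
Unset Strict Implicit.
Unset Printing Implicit Defensive.
Import Order.TTheory GRing.Theory Num.Theory.

(** * Exhaustive search for sets of tetrahedra *)

(** A combinatorial sphere is given only through subdivisions of unknown size, so nothing can be
    read off a link directly. Every geometric statement therefore passes through one complex that
    subdivides both the given complex and the standard sphere, with its points written in
    barycentric coordinates. The searches see none of this: they use only the incidence properties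
    collected in [manifold_tets].

    Origin of the constants: among nine vertices a vertex has at most 8 neighbours, hence by Euler's
    formula lies in at most 2 * 8 - 4 = 12 tetrahedra, and in at most 2 * 7 - 4 = 10 if it has a
    non-neighbour. So there are at most 9 * 12 / 4 = 27 tetrahedra, which is the size limit of the
    search in which the apexes of every triangle are adjacent; that search starts at a vertex with a
    non-neighbour. The other search has the limit 16 and starts at a vertex that lies in the largest
    number of tetrahedra.

    Soundness does not require an enumeration of all families: a given [X] selects one branch of the
    search tree, and an answer [true] is refuted along this branch alone. *)

(* [vm_compute] evaluates both arguments of [||] and [&&]; nested [if]s keep the search lazy. *)
Definition lazy_has (A : Type) (p : A -> bool) :=
  fix lazy_has (l : seq A) : bool := if l is x :: l' then if p x then true else lazy_has l' else false.
Definition lazy_all (A : Type) (p : A -> bool) :=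
  fix lazy_all (l : seq A) : bool := if l is x :: l' then if p x then lazy_all l' else false else true.
Definition mem_label (v : nat) (t : seq nat) : bool := lazy_has (eqn v) t.
Fixpoint insert (v : nat) (t : seq nat) : seq nat :=
  if t is x :: t' then if leq v x then v :: t else x :: insert v t' else [:: v].
Fixpoint lex_le (s t : seq nat) : bool :=
  match s, t with
  | x :: s', y :: t' => if eqn x y then lex_le s' t' else leq x y
  | _, _ => true
  end.
Fixpoint remove (w : nat) (t : seq nat) : seq nat :=
  if t is x :: t' then if eqn w x then t' else x :: remove w t' else [::].
Fixpoint lex_insert (s : seq nat) (l : seq (seq nat)) :=
  if l is s' :: l' then if lex_le s s' then s :: l else s' :: lex_insert s l' else [:: s].

(* A 3-set of labels lies in no, one ([Open], with its apex) or two ([Closed]) chosen 4-sets; a chosen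
   4-set has status [Tet]. *)
Inductive status := Unknown | Open of nat | Closed of nat & nat | Tet.
Inductive trie := Node of status & seq trie.
Definition empty_trie := Node Unknown [::].
Definition trie_status (t : trie) := let: Node s _ := t in s.
Definition trie_children (t : trie) := let: Node _ l := t in l.
Fixpoint lookup (t : trie) (s : seq nat) : status :=
  if s is x :: s' then lookup (nth empty_trie (trie_children t) x) s' else trie_status t.
Fixpoint store (t : trie) (s : seq nat) (v : status) : trie :=
  if s is x :: s' then Node (trie_status t)
    (set_nth empty_trie (trie_children t) x (store (nth empty_trie (trie_children t) x) s' v))
  else Node v (trie_children t).

Definition mem_both v w (t : seq nat) := if mem_label v t then mem_label w t else false.
Definition num_tets (I : seq (seq nat)) v := count (mem_label v) I.
Definition num_tets2 (I : seq (seq nat)) v w := count (mem_both v w) I.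
Definition label_degree (I : seq (seq nat)) v :=
  count (fun w => if eqn v w then false else lazy_has (mem_both v w) I) (iota 0 9).

(* The search returns [true] if it proves that no suitable set of at most [max_tets] tetrahedra
   exists.  Vertices are labelled 0, 1, ... in order of appearance, and [op] lists the open triangles,
   the least of which is closed in all possible ways.  While [k0 = 0] the star of 0 is completed;
   then its [k0] labels are fixed.  [cap0] and [cap] bound the numbers of tetrahedra at 0 and at the
   other vertices.  If [star], the two apexes of a triangle have to be adjacent; otherwise 0 lies in
   the largest number of tetrahedra. *)
Section Search.
Variable star : bool.
Variable max_tets : nat.

(** If the triangle opposite to [w] already has two apexes, [w] has to be one of them. If it has the
    apex 0 and the star of 0 is complete, adjacency of the apexes in mode [star] confines [w] to the
    [k0] labels of that star. *)
Definition face_allows (k0 : nat) (T : seq nat) (tr : trie) w :=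
  match lookup tr (remove w T) with
  | Closed y z => if eqn w y then true else eqn w z
  | Open y => if star then if eqn y 0 then if eqn k0 0 then true else leq w.+1 k0 else true else true
  | _ => true
  end.

(** A result [None] makes the search return [false]; hence soundness does not depend on showing that
    this case never occurs. *)
Fixpoint add_faces (ws : seq nat) (T : seq nat) (tr : trie) (op : seq (seq nat)) :=
  if ws is w :: ws' then
    let s := remove w T in
    match lookup tr s with
    | Unknown => add_faces ws' T (store tr s (Open w)) (lex_insert s op)
    | Open y => if eqn y w then None else add_faces ws' T (store tr s (Closed y w)) op
    | _ => None
    end
  else Some (tr, op).

Definition lexlt (a b c a' b' c' : nat) :=
  if leq a'.+1 a then false else if leq a.+1 a' then true else
  if leq b'.+1 b then false else if leq b.+1 b' then true else leq c.+1 c'.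

(* Symmetry breaking: the degrees of the edges 01, 02, 03 are lexicographically maximal. *)
Definition flag_beaten (I : seq (seq nat)) :=
  let ds := map (num_tets2 I 0) (iota 0 9) in
  let d i := nth 0 ds i in
  let lt a b c := lexlt (d 1) (d 2) (d 3) (d a) (d b) (d c) in
  lazy_has (fun T => if T is [:: 0; a; b; c] then
     if lt a b c then true else if lt a c b then true else if lt b a c then true
     else if lt b c a then true else if lt c a b then true else lt c b a else false) I.

(** At a leaf no triangle is open, so the chosen tetrahedra are all of [X]. What remains to be
    tested are the conditions that partial families cannot decide: adjacency of apexes, the presence
    of all nine vertices, and Euler's formula at each of them. *)
Definition leaf_refuted (I : seq (seq nat)) (tr : trie) k :=
  if star && lazy_has (fun T => lazy_has (fun w =>
      if lookup tr (remove w T) is Closed y z then ~~ lazy_has (mem_both y z) I else false) T) I then true else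
  if k < 9 then true else lazy_has (fun v => ~~ eqn (num_tets I v + 4) (label_degree I v).*2) (iota 0 9).

(** A triangle that gets closed stays in [op]; only the head of the list has to be up to date. *)
Fixpoint drop_closed (tr : trie) (op : seq (seq nat)) :=
  if op is s :: op' then if lookup tr s is Closed _ _ then drop_closed tr op' else op else [::].

(** Up to relabelling, a vertex not met before has the label [k], which explains the range
    [iota 0 (minn k.+1 9)] of apexes. Exhausted fuel and unexpected states give [false], so that
    only the answer [true] needs a justification. *)
Fixpoint search (fuel : nat) (k0 cap0 cap k size : nat) (I : seq (seq nat)) (cs : seq nat) tr op : bool :=
  if fuel is fuel'.+1 then
    let op := drop_closed tr op in
      if (if eqn k0 0 then
            lazy_all (fun s => if mem_label 0 s then
              if lookup tr s is Closed _ _ then true else false else true) op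
          else false) then
        if ~~ eqn (num_tets I 0 + 4) (label_degree I 0).*2 then true else
        if flag_beaten I then true else
        search fuel' k cap0 (if star then 12 else num_tets I 0) k size I cs tr op
      else
      if op is t :: _ then
       if lookup tr t is Open x then
        lazy_all (fun v => if mem_label v t then true else if eqn v x then true else
           let T := insert v t in
           if lazy_all (face_allows k0 T tr) T then
             if lookup tr T is Unknown then
               if (if eqn k0 0 then false else eqn 0 v) then true else
               if lazy_all (fun w => leq (nth 0 cs w).+1 (if eqn w 0 then cap0 else cap)) T then
                 if leq size max_tets then
                   if add_faces T T (store tr T Tet) op is Some (tr', op') then
                     search fuel' k0 cap0 cap (if eqn v k then k.+1 else k) size.+1 (T :: I)
                       (foldr (fun w c => incr_nth c w) cs T) tr' op'
                   else false
                 else true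
               else true
             else false
           else true) (iota 0 (minn k.+1 9))
       else false
      else leaf_refuted I tr k
  else false.

(** The argument [size] is the number of tetrahedra after the next insertion, hence 2 at the start.
    A branch consists of at most 26 insertions, one completion of the star of 0 and a leaf, so the
    fuel 60 is ample. *)
Definition search_refutes :=
  if add_faces [:: 0; 1; 2; 3] [:: 0; 1; 2; 3] (store empty_trie [:: 0; 1; 2; 3] Tet) [::] is Some (tr, op) then
  search 60 0 (if star then 10 else 12) 12 4 2 [:: [:: 0; 1; 2; 3]] [:: 1; 1; 1; 1] tr op else false.
End Search.

Lemma lazy_hasE A (p : A -> bool) l : lazy_has p l = has p l.
Proof. by elim: l => //= x l ->; case: (p x). Qed.
Lemma lazy_allE A (p : A -> bool) l : lazy_all p l = all p l.
Proof. by elim: l => //= x l ->; case: (p x). Qed.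
Lemma mem_labelE v t : mem_label v t = (v \in t).
Proof. by rewrite /mem_label lazy_hasE; elim: t => //= x t ->; rewrite inE. Qed.
Lemma mem_bothE v w t : mem_both v w t = (v \in t) && (w \in t).
Proof. by rewrite /mem_both !mem_labelE; case: (v \in t). Qed.
Lemma mem_insert v t : insert v t =i v :: t.
Proof.
elim: t => //= x t IH y; case: leq => //; rewrite !inE IH !inE.
by rewrite orbCA.
Qed.
Lemma size_insert v t : size (insert v t) = (size t).+1.
Proof. by elim: t => //= x t IH; case: leq => //=; rewrite IH. Qed.
Lemma sorted_insert v t : v \notin t -> sorted ltn t -> sorted ltn (insert v t).
Proof.
have pth a b s : b \notin s -> a < b -> path ltn a s -> path ltn a (insert b s).
  elim: s a => //= [|x s IH] a; first by move=> _ ->.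
  rewrite inE negb_or => /andP[bx bs] ab /andP[ax ps].
  case: leqP => h /=; first by rewrite ab ps andbT; move: h; rewrite leq_eqVlt (negbTE bx).
  by rewrite ax IH.
case: t => //= x t; rewrite inE negb_or => /andP[vx vt] pt.
case: leqP => h /=; first by rewrite pt andbT; move: h; rewrite leq_eqVlt (negbTE vx).
exact: pth.
Qed.
Lemma removeE w t : remove w t = rem w t.
Proof. by elim: t => //= x t ->; rewrite eq_sym. Qed.
Lemma sorted_ltn_uniq t : sorted ltn t -> uniq t.
Proof. by move=> h; apply: (sorted_uniq ltn_trans ltnn). Qed.
Lemma sorted_remove w t : sorted ltn t -> sorted ltn (remove w t).
Proof. by rewrite removeE => h; apply: (subseq_sorted ltn_trans (rem_subseq w t)). Qed.
Lemma mem_remove w t y : sorted ltn t -> (y \in remove w t) = (y != w) && (y \in t).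
Proof. by move=> /sorted_ltn_uniq h; rewrite removeE mem_rem_uniq // !inE. Qed.
Lemma size_remove w t : w \in t -> size (remove w t) = (size t).-1.
Proof. by rewrite removeE; apply: size_rem. Qed.
Lemma sorted_eq_mem s t : sorted ltn s -> sorted ltn t -> s =i t -> s = t.
Proof. exact: (irr_sorted_eq ltn_trans ltnn). Qed.
Lemma insert_remove w t : sorted ltn t -> w \in t -> insert w (remove w t) = t.
Proof.
move=> st wt; have sd := sorted_remove w st.
apply: sorted_eq_mem => //; first by apply: sorted_insert => //; rewrite mem_remove // eqxx.
move=> y; rewrite mem_insert inE mem_remove //.
by case: eqVneq => //= ->.
Qed.
Lemma mem_lex_insert s l : lex_insert s l =i s :: l.
Proof.
by elim: l => //= x t IH y; case: lex_le => //; rewrite !inE IH !inE orbCA.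
Qed.
Lemma lookup_store t s s' v : lookup (store t s v) s' = if s == s' then v else lookup t s'.
Proof.
elim: s s' t => [|x s IH] [|y s'] t //=.
rewrite nth_set_nth /= eqseq_cons eq_sym.
by case: eqVneq => //= ->; rewrite IH.
Qed.
Lemma drop_closed_sub tr op : {subset drop_closed tr op <= op}.
Proof.
elim: op => //= s op IH y.
by case: (lookup tr s) => [|?|? ?|] //; rewrite inE => /IH ->; rewrite orbT.
Qed.
Definition is_closed st := if st is Closed _ _ then true else false.
Lemma drop_closed_sup tr op s : s \in op -> ~~ is_closed (lookup tr s) -> s \in drop_closed tr op.
Proof.
elim: op => //= s' op IH; rewrite inE => /orP[/eqP <- ns|sop ns].
  by case: (lookup tr s) ns => [|?|? ?|] //= _; rewrite inE eqxx.
by case: (lookup tr s') => [|?|? ?|]; rewrite ?inE ?sop ?orbT //; apply: IH.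
Qed.

(** * Families of 4-sets that behave like the tetrahedra of a 3-manifold *)

Section Tets.
Variables (T : finType) (V : {set T}) (X : {set {set T}}).

Definition nbrs v := [set y | (y != v) && [exists t in X, (v \in t) && (y \in t)]].
Definition tets_at v := [set t in X | v \in t].
Definition tets_at2 v w := [set t in X | (v \in t) && (w \in t)].

(* [Z] contains the neighbours of its tetrahedra across the triangles opposite to vertices not in
   [u]; for [u = pred1 v] these are the triangles through [v]. *)
Definition closed_at (u : {pred T}) (Z : {set {set T}}) :=
  forall (t : {set T}) x, t \in Z -> x \in t -> x \notin u -> exists2 t', t' \in Z & (t' != t) && (t :\ x \subset t').

(* [okSC] is strong connectedness, and [okE] Euler's formula, in the link of [u]. *)
Record manifold_tets : Prop := OkTets {
  ok4 : forall t, t \in X -> #|t| = 4;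
  okV : forall t, t \in X -> t \subset V;
  okcov : forall v, v \in V -> exists2 t, t \in X & v \in t;
  okface : forall (s : {set T}) x, x \notin s -> x |: s \in X -> exists y, [/\ y \notin s, y != x & y |: s \in X];
  okface3 : forall (s : {set T}) x y z, x \notin s -> y \notin s -> z \notin s ->
     x |: s \in X -> y |: s \in X -> z |: s \in X -> x != y -> x != z -> y = z;
  okSC : forall u (Z : {set {set T}}), u \in V -> Z \subset tets_at u -> Z != set0 ->
     closed_at (pred1 u) Z -> Z = tets_at u;
  okE : forall u, u \in V -> #|tets_at u| + 4 = #|nbrs u|.*2 }.

Hypothesis ok : manifold_tets.
Hypothesis V9 : #|V| = 9.

Definition vtx (Z : {set {set T}}) := \bigcup_(t in Z) t.

(** Two different tetrahedra with a common triangle already have five vertices. *)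
Lemma closed_ge5 (Z : {set {set T}}) : Z \subset X -> Z != set0 -> closed_at pred0 Z -> 5 <= #|vtx Z|.
Proof.
move=> ZX /set0Pn[t tZ] cZ.
have t4 := ok4 ok (subsetP ZX _ tZ).
have /set0Pn[x xt] : t != set0 by rewrite -card_gt0 t4.
have [t' t'Z /andP[t't tt']] := cZ t x tZ xt isT.
have t'4 := ok4 ok (subsetP ZX _ t'Z).
have : t \proper t :|: t'.
  rewrite properE subsetUl subUset subxx /=; apply: contra t't => h.
  by rewrite eqEcard h t4 t'4.
move/proper_card; rewrite t4 => h; apply: leq_trans h _; apply: subset_leq_card.
by rewrite subUset; apply/andP; split; apply: bigcup_sup.
Qed.

(** The members of [Z] at [v] are closed across the triangles through [v]; by strong connectedness
    of the link they form the whole star of [v]. *)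
Lemma closed_vtx (Z : {set {set T}}) v (t : {set T}) : Z \subset X -> closed_at pred0 Z ->
  v \in vtx Z -> t \in X -> v \in t -> t \in Z.
Proof.
move=> ZX cZ /bigcupP[t0 t0Z vt0] tX vt.
have vV : v \in V by apply: (subsetP (okV ok (subsetP ZX _ t0Z))).
have := @okSC ok v (Z :&: tets_at v) vV (subsetIr _ _).
have -> : Z :&: tets_at v != set0.
  by apply/set0Pn; exists t0; rewrite !inE t0Z vt0 (subsetP ZX).
move=> /(_ isT) h.
have : t \in tets_at v by rewrite inE tX vt.
rewrite -h; first by rewrite inE => /andP[].
move=> s x; rewrite !inE => /andP[sZ /andP[sX vs]] xs xv.
have [t' t'Z /andP[n1 n2]] := cZ s x sZ xs isT.
exists t'; last by rewrite n1.
rewrite !inE t'Z (subsetP ZX) //=; apply: (subsetP n2); rewrite !inE vs andbT.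
by rewrite eq_sym.
Qed.

(** Otherwise [Z] and its complement in [X] would both be closed and have disjoint vertex sets of at
    least five elements each, too many for nine vertices. This is where connectedness of the
    manifold comes from. *)
Lemma closed_all (Z : {set {set T}}) : Z \subset X -> Z != set0 -> closed_at pred0 Z -> Z = X.
Proof.
move=> ZX Z0 cZ; apply/eqP; rewrite eqEsubset ZX /=; apply/negPn/negP => nZ.
have W0 : X :\: Z != set0 by rewrite setD_eq0.
have cW : closed_at pred0 (X :\: Z).
  move=> t x; rewrite inE => /andP[tZ tX] xt _.
  have xs : x \notin t :\ x by rewrite !inE eqxx.
  have tE : x |: (t :\ x) = t by rewrite setD1K.
  have [y [yt yx yX]] := @okface ok (t :\ x) x xs (etrans (congr1 (fun z => z \in X) tE) tX).
  exists (y |: t :\ x); last first.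
    rewrite subsetU1 andbT; apply: contra yt => /eqP h.
    by rewrite !inE yx -h !inE eqxx.
  rewrite inE yX andbT; apply: contra tZ => yZ.
  have /set0Pn[v] : t :\ x != set0.
    by rewrite -card_gt0 -(ltn_add2l (x \in t)) -cardsD1 (ok4 ok tX) xt.
  rewrite !inE => /andP[vx vt]; apply: (@closed_vtx Z v) => //.
  by apply/bigcupP; exists (y |: t :\ x) => //; rewrite !inE vx vt orbT.
have d : [disjoint vtx Z & vtx (X :\: Z)].
  rewrite -setI_eq0 -subset0; apply/subsetP => v; rewrite inE => /andP[v1] /bigcupP[t].
  rewrite inE => /andP[tZ tX] vt; case/negP: tZ; exact: (closed_vtx ZX cZ v1 tX vt).
have : #|vtx Z :|: vtx (X :\: Z)| <= #|V|.
  apply: subset_leq_card; rewrite subUset; apply/andP; split; apply/bigcupsP => t;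
  rewrite ?inE => h; apply: (okV ok); first exact: (subsetP ZX).
  by case/andP: h.
have W5 := closed_ge5 (subsetDl X Z) W0 cW.
have Z5 := closed_ge5 ZX Z0 cZ.
rewrite cardsU (_ : vtx Z :&: _ = set0) ?cards0 ?subn0; last by apply/eqP; rewrite setI_eq0.
by rewrite V9; apply/negP; rewrite -ltnNge; apply: leq_trans (leq_add Z5 W5).
Qed.
End Tets.

(** * Translation between labels and vertices *)

Section Labels.
Variables (T : finType) (x0 : T).
Implicit Types (fs : seq T) (s : seq nat).
Definition img fs s : {set T} := [set y in [seq nth x0 fs i | i <- s]].

Lemma mem_img fs s i : uniq fs -> i < size fs -> all (ltn^~ (size fs)) s ->
  (nth x0 fs i \in img fs s) = (i \in s).
Proof.
move=> uf ik /allP sk; rewrite inE; apply/mapP/idP => [[j js]|h]; last by exists i.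
by move/eqP; rewrite nth_uniq ?sk // => [/eqP->|]; last exact: sk.
Qed.
Lemma img_eq_mem fs s t : s =i t -> img fs s = img fs t.
Proof. by move=> h; apply/setP => y; rewrite !inE; apply: (eq_mem_map _ h). Qed.
Lemma img_insert fs v s : img fs (insert v s) = nth x0 fs v |: img fs s.
Proof.
by rewrite (img_eq_mem fs (mem_insert v s)); apply/setP => y; rewrite !inE.
Qed.
Lemma img_remove fs w s : uniq fs -> all (ltn^~ (size fs)) s -> sorted ltn s -> w \in s ->
  img fs (remove w s) = img fs s :\ nth x0 fs w.
Proof.
move=> uf sk ss ws; rewrite -[in RHS](insert_remove ss ws) img_insert setU1K //.
rewrite mem_img ?mem_remove ?eqxx //; first exact: (allP sk).
by apply/allP => i; rewrite mem_remove // => /andP[_ /(allP sk)].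
Qed.
Lemma img_inj fs s t : uniq fs -> all (ltn^~ (size fs)) s -> all (ltn^~ (size fs)) t ->
  sorted ltn s -> sorted ltn t -> img fs s = img fs t -> s = t.
Proof.
move=> uf sk tk ss st e; apply: sorted_eq_mem => // i.
case: (ltnP i (size fs)) => ik; first by rewrite -(mem_img uf ik sk) e mem_img.
by apply/idP/idP => h; [move: (allP sk _ h)|move: (allP tk _ h)]; rewrite /= ltnNge ik.
Qed.
Lemma img_rcons fs y s : all (ltn^~ (size fs)) s -> img (rcons fs y) s = img fs s.
Proof.
move=> /allP sk; apply/setP => z; rewrite !inE; congr (_ \in _).
by apply/eq_in_map => i /sk /= h; rewrite nth_rcons h.
Qed.
Lemma imgP fs s y : reflect (exists2 i, i \in s & y = nth x0 fs i) (y \in img fs s).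
Proof. by rewrite inE; apply: mapP. Qed.
End Labels.

(** * Soundness of the search *)

Section Sound.
Variables (T : finType) (V : {set T}) (X : {set {set T}}).
Hypothesis ok : manifold_tets V X.
Hypothesis V9 : #|V| = 9.
Variables (star : bool) (max_tets : nat) (u a b c : T) (cap0 : nat).
Hypothesis star_adj : star -> forall (s : {set T}) x y, x \notin s -> y \notin s -> x != y ->
  x |: s \in X -> y |: s \in X -> y \in nbrs X x.
Hypothesis le_total : #|X| <= max_tets.
Hypothesis le_cap0 : #|tets_at X u| <= cap0.
Hypothesis le_cap : forall v, v \in V -> #|tets_at X v| <= (if star then 12 else #|tets_at X u|).
Hypothesis le12 : forall v, v \in V -> #|tets_at X v| <= 12.
Hypothesis flagmax : forall x y z, [set u; x; y; z] \in X ->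
  lexlt #|tets_at2 X u a| #|tets_at2 X u b| #|tets_at2 X u c|
        #|tets_at2 X u x| #|tets_at2 X u y| #|tets_at2 X u z| = false.

Notation lab fs := (nth u fs).
Notation img := (img u).
Notation below k := (all (ltn^~ k)).

Record good_tet fs (t : seq nat) : Prop := GoodTet {
  gt_sorted : sorted ltn t; gt_size : size t = 4;
  gt_below : below (size fs) t; gt_X : img fs t \in X }.

Definition good_status (I : seq (seq nat)) tr := forall s,
  match lookup tr s with
  | Open x => [/\ sorted ltn s, size s = 3, x \notin s & insert x s \in I]
  | Closed x y => [/\ sorted ltn s, size s = 3, x != y &
       [/\ x \notin s, y \notin s, insert x s \in I & insert y s \in I]]
  | _ => True
  end.

Definition covered tr (op : seq (seq nat)) s := (s \in op) || is_closed (lookup tr s).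

Definition complete fs (I : seq (seq nat)) k0 w := forall t, t \in X -> lab fs w \in t ->
  exists2 s, s \in I & t = img fs s /\ below k0 s.

(** The list [fs] names the vertices in the order of their labels, and the invariant says that the
    state describes a part of the given [X]. By [i_cov] a triangle of a chosen tetrahedron that is
    not listed in [op] is closed; so an empty list means that the family is closed under
    adjacency. *)
Record search_inv fs k0 cap I cs tr op : Prop := Inv {
  i_uniq : uniq fs; i_V : {subset fs <= V}; i_lab : take 4 fs = [:: u; a; b; c];
  i_tet : forall t, t \in I -> good_tet fs t;
  i_I : uniq I;
  i_cs : forall w, nth 0 cs w = num_tets I w;
  i_tr : good_status I tr;
  i_in : forall t, t \in I -> lookup tr t <> Unknown;
  i_cov : forall t w, t \in I -> w \in t -> covered tr op (remove w t);
  i_op : forall s, s \in op -> below (size fs) s;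
  i_k0 : k0 = 0 \/ (0 < k0 <= size fs /\ complete fs I k0 0);
  i_cap : forall v, v \in V -> #|tets_at X v| <= cap }.

Lemma lab_V fs k0 cap I cs tr op : search_inv fs k0 cap I cs tr op ->
  forall i, i < size fs -> lab fs i \in V.
Proof. by move=> h i ik; apply: (i_V h); rewrite mem_nth. Qed.

Lemma inv_size fs k0 cap I cs tr op : search_inv fs k0 cap I cs tr op -> 4 <= size fs <= 9.
Proof.
move=> h; apply/andP; split.
  by have := congr1 size (i_lab h); rewrite size_take /=; case: (ltnP 4) => [/ltnW|_ ->].
by rewrite -V9 cardE; apply: uniq_leq_size (i_uniq h) _ => y /(i_V h); rewrite mem_enum.
Qed.

Lemma lab0 fs k0 cap I cs tr op : search_inv fs k0 cap I cs tr op ->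
  [/\ lab fs 0 = u, lab fs 1 = a, lab fs 2 = b & lab fs 3 = c].
Proof.
move=> h; have tk i : i < 4 -> lab fs i = nth u [:: u; a; b; c] i.
  by move=> i4; rewrite -(i_lab h) nth_take.
by rewrite !tk.
Qed.

Section Counts.
Variables (fs : seq T) (I : seq (seq nat)).
Hypotheses (uf : uniq fs) (uI : uniq I) (gI : forall t, t \in I -> good_tet fs t).

Lemma img_inj_in : {in I &, injective (img fs)}.
Proof.
move=> s t /gI[ss _ sk _] /gI[st _ tk _]; exact: img_inj.
Qed.

Lemma count_le (p : pred (seq nat)) (P : pred {set T}) :
  (forall t, t \in I -> p t -> P (img fs t)) -> count p I <= #|[set t in X | P t]|.
Proof.
move=> h; rewrite -size_filter -(size_map (img fs)) cardE; apply: uniq_leq_size.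
  rewrite map_inj_in_uniq ?filter_uniq // => s t; rewrite !mem_filter => /andP[_ sI] /andP[_ tI].
  exact: img_inj_in.
move=> t /mapP[s]; rewrite mem_filter => /andP[ps sI] ->.
by rewrite mem_enum inE (gt_X (gI sI)) h.
Qed.

Lemma count_eq (p : pred (seq nat)) (P : pred {set T}) :
  (forall t, t \in I -> p t = P (img fs t)) ->
  (forall t, t \in X -> P t -> exists2 s, s \in I & t = img fs s) ->
  count p I = #|[set t in X | P t]|.
Proof.
move=> h1 h2; apply/eqP; rewrite eqn_leq count_le; last by move=> t /h1 ->.
rewrite -size_filter -(size_map (img fs)) cardE; apply: uniq_leq_size (enum_uniq _) _.
move=> t; rewrite mem_enum inE => /andP[tX Pt]; have [s sI e] := h2 t tX Pt.
by apply/mapP; exists s => //; rewrite mem_filter sI h1 // -e Pt.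
Qed.

Lemma mem_tet t i : t \in I -> i < size fs -> (lab fs i \in img fs t) = (i \in t).
Proof. by move=> /gI[_ _ tk _] ik; apply: mem_img. Qed.

Lemma num_tets_le w : w < size fs -> num_tets I w <= #|tets_at X (lab fs w)|.
Proof.
move=> wk; apply: (@count_le (mem_label w) (fun t => lab fs w \in t)) => t tI.
by rewrite mem_labelE mem_tet.
Qed.

Hypothesis fs9 : size fs <= 9.
Variables (w : nat).
Hypothesis wk : w < size fs.
Hypothesis cw : forall t, t \in X -> lab fs w \in t -> exists2 s, s \in I & t = img fs s.

Lemma num_tetsE : num_tets I w = #|tets_at X (lab fs w)|.
Proof. by apply: count_eq => // t tI; rewrite mem_labelE mem_tet. Qed.

Lemma num_tets2E i : i < size fs -> num_tets2 I w i = #|tets_at2 X (lab fs w) (lab fs i)|.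
Proof.
move=> ik; apply: (@count_eq _ (fun t => (lab fs w \in t) && (lab fs i \in t))) => t tI.
  by rewrite mem_bothE !mem_tet.
by case/andP => h _; apply: cw.
Qed.

Lemma label_degreeE : label_degree I w = #|nbrs X (lab fs w)|.
Proof.
rewrite /label_degree -size_filter.
set l := filter _ _.
have lP i : i \in l = [&& i < size fs, i != w & has (fun t => (w \in t) && (i \in t)) I].
  rewrite mem_filter mem_iota /= add0n lazy_hasE.
  have -> : eqn w i = (i == w) by rewrite eq_sym.
  case: (i == w) => /=; first by rewrite andbF.
  rewrite (eq_has (mem_bothE w i)) -andbC; case: hasP => [[t tI /andP[_ it]]|]; last by rewrite !andbF.
  have ik := allP (gt_below (gI tI)) i it.
  by rewrite /= in ik; rewrite ik (leq_trans ik).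
have lk i : i \in l -> i < size fs by rewrite lP => /andP[].
rewrite -(size_map (nth u fs)) -(card_uniqP _); last first.
  rewrite map_inj_in_uniq ?filter_uniq ?iota_uniq // => i j /lk ik /lk jk /eqP.
  by rewrite nth_uniq // => /eqP.
apply: eq_card => y; rewrite !inE; apply/mapP/andP => [[i]|[yw /existsP[t /andP[tX /andP[wt yt]]]]].
  rewrite lP => /and3P[ik iw /hasP[t tI /andP[wt it]]] ->; split; first by rewrite nth_uniq.
  by apply/existsP; exists (img fs t); rewrite (gt_X (gI tI)) !mem_tet // wt.
have [s sI e] := cw tX wt; move: yt wt; rewrite e => /imgP[i is_ yi]; rewrite mem_tet // => ws.
have ik := allP (gt_below (gI sI)) i is_.
exists i => //; rewrite lP; apply/and3P; split => //.
  by apply: contra yw => /eqP <-; rewrite yi.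
by apply/hasP; exists s => //; rewrite ws.
Qed.
End Counts.

Lemma add_facesP ws t tr op tr' op' I n :
  add_faces ws t tr op = Some (tr', op') -> sorted ltn t -> size t = 4 -> t \in I -> below n t ->
  {subset ws <= t} -> good_status I tr -> (forall s, s \in op -> below n s) ->
  [/\ good_status I tr', (forall s, s \in op' -> below n s),
      (forall s, lookup tr s <> Unknown -> lookup tr' s <> Unknown),
      (forall s, covered tr op s -> covered tr' op' s) &
      (forall w, w \in ws -> covered tr' op' (remove w t))].
Proof.
move=> + st t4 tI nt; elim: ws tr op => [|w ws IH] tr op /=; first by case=> <- <-.
set s := remove w t => h sub gtr nop.
have wt : w \in t by apply: sub; rewrite inE eqxx.
have sub' : {subset ws <= t} by move=> i h'; apply: sub; rewrite inE h' orbT.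
have ss : sorted ltn s by apply: sorted_remove.
have s3 : size s = 3 by rewrite size_remove // t4.
have ws_ : w \notin s by rewrite mem_remove // eqxx.
have it : insert w s = t by apply: insert_remove.
have ns : below n s by apply/allP => i; rewrite mem_remove // => /andP[_ /(allP nt)].
case E: (lookup tr s) h => [|y|y z|] //.
- move=> /IH h; have [] := h sub'.
  + by move=> s'; rewrite lookup_store; case: eqVneq => [<-|_]; [rewrite ss s3 it | apply: gtr].
  + by move=> s'; rewrite mem_lex_insert inE => /orP[/eqP ->|/nop].
  move=> h1 h2 h3 h4 h5; split => //.
  + by move=> s' ns'; apply: h3; rewrite lookup_store; case: eqP.
  + move=> s' cs; apply: h4; move: cs; rewrite /covered mem_lex_insert inE lookup_store.
    by rewrite [s == s']eq_sym; case: eqVneq.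
  + move=> w'; rewrite inE => /orP[/eqP ->|/h5 //]; apply: h4.
    by rewrite /covered mem_lex_insert inE eqxx.
- case: (eqnP) => // yw /IH h; have [] := h sub'.
  + move=> s'; rewrite lookup_store; case: eqVneq => [<-|_]; last exact: gtr.
    have := gtr s; rewrite E => -[_ _ ys yI]; split=> //; first exact/eqP.
    by rewrite it.
  + exact: nop.
  move=> h1 h2 h3 h4 h5; split => //.
  + by move=> s' ns'; apply: h3; rewrite lookup_store; case: eqP.
  + move=> s' cs; apply: h4; move: cs; rewrite /covered lookup_store.
    by case: eqVneq => [<-|_] //; rewrite orbT.
  + move=> w'; rewrite inE => /orP[/eqP ->|/h5 //]; apply: h4.
    by rewrite /covered lookup_store eqxx orbT.
Qed.

Lemma closed_face fs I tr t w : uniq fs -> (forall t, t \in I -> good_tet fs t) ->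
  good_status I tr -> t \in I -> w \in t -> is_closed (lookup tr (remove w t)) ->
  exists2 s, s \in I & (img fs s != img fs t) && (img fs t :\ lab fs w \subset img fs s).
Proof.
move=> uf gI gtr tI wt; have [st t4 tk tX] := gI t tI.
case E: (lookup tr _) => [|?|y z|] // _; have := gtr (remove w t); rewrite E.
move=> [_ _ yz [ys zs yI zI]].
have [v [vw vs vI]] : exists v, [/\ v != w, v \notin remove w t & insert v (remove w t) \in I].
  by have [e|ne] := eqVneq y w; [exists z; split; rewrite // -e eq_sym | exists y].
exists (insert v (remove w t)) => //; rewrite -(img_remove u uf tk st wt) img_insert subsetU1 andbT.
have vk : v < size fs by apply: (allP (gt_below (gI _ vI))); rewrite mem_insert inE eqxx.
apply/eqP => /setP /(_ (lab fs v)); rewrite !inE eqxx /= -[RHS]in_set -/(img fs t).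
by rewrite mem_img // => vt; move: vs; rewrite mem_remove // vw -vt.
Qed.

Section Step.
Variables (fs : seq T) (k0 cap : nat) (I : seq (seq nat)) (cs : seq nat) (tr : trie) (op : seq (seq nat)).
Hypothesis Hinv : search_inv fs k0 cap I cs tr op.

Let uf := i_uniq Hinv.
Let k49 := inv_size Hinv.

Lemma inv_clean : search_inv fs k0 cap I cs tr (drop_closed tr op).
Proof.
case: Hinv => h1 h2 h3 h4 h5 h6 h7 h8 h9 h10 h11 h12; split => //.
  move=> t w tI wt; move: (h9 t w tI wt); rewrite /covered.
  case: (boolP (is_closed _)) => [_|nc]; first by rewrite !orbT.
  by rewrite !orbF => /drop_closed_sup; apply.
by move=> s /drop_closed_sub; apply: h10.
Qed.

(** When all triangles through 0 are closed, the chosen tetrahedra at 0 are closed across the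
    triangles through [u], and strong connectedness of the link of [u] applies. *)
Lemma star_complete : I != [::] ->
  (exists2 t, t \in I & 0 \in t) ->
  (forall s, s \in op -> 0 \in s -> is_closed (lookup tr s)) -> complete fs I (size fs) 0.
Proof.
move=> _ [t0 t0I t00] hop t tX ut.
have [l0 _ _ _] := lab0 Hinv.
have k0p : 0 < size fs by case/andP: k49 => h _; apply: leq_trans h.
have gI := i_tet Hinv.
have mt s : s \in I -> (u \in img fs s) = (0 \in s).
  by move=> sI; have := mem_tet uf gI sI k0p; rewrite l0.
rewrite l0 in ut.
pose Z := [set s in [seq img fs s | s <- I] | u \in s].
suff eZ : Z = tets_at X u.
  have : t \in tets_at X u by rewrite inE tX ut.
  rewrite -eZ inE => /andP[/mapP[s sI ->] _]; exists s => //; split=> //.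
  exact: gt_below (gI _ sI).
apply: (okSC ok).
- by have := lab_V Hinv k0p; rewrite l0.
- by apply/subsetP => s; rewrite !inE => /andP[/mapP[s' s'I ->] ->]; rewrite (gt_X (gI _ s'I)).
- by apply/set0Pn; exists (img fs t0); rewrite inE map_f // mt.
move=> s x; rewrite inE => /andP[/mapP[s' s'I ->] us] /imgP[w ws ->] wu.
have s0 : 0 \in s' by rewrite -mt.
have w0 : w != 0 by apply: contra wu => /eqP ->; rewrite l0 inE.
have cl : is_closed (lookup tr (remove w s')).
  have /orP[h|//] := i_cov Hinv s'I ws; apply: hop h _.
  by rewrite mem_remove ?(gt_sorted (gI _ s'I)) // s0 eq_sym w0.
have [r rI /andP[r1 r2]] := closed_face uf gI (i_tr Hinv) s'I ws cl.
exists (img fs r); last by rewrite r1.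
rewrite inE map_f //=; apply: (subsetP r2); rewrite inE us andbT inE.
by move: wu; rewrite inE eq_sym.
Qed.

Lemma all_complete : op = [::] -> I != [::] -> X = [set s in [seq img fs s | s <- I]].
Proof.
move=> op0 I0; have gI := i_tet Hinv; symmetry; apply: (closed_all ok V9).
- by apply/subsetP => s; rewrite inE => /mapP[s' s'I ->]; exact: gt_X (gI _ s'I).
- case: I I0 => // s I' _; apply/set0Pn; exists (img fs s); rewrite inE map_f //.
  by rewrite inE eqxx.
move=> s x; rewrite inE => /mapP[s' s'I ->] /imgP[w ws ->] _.
have cl : is_closed (lookup tr (remove w s')).
  by have := i_cov Hinv s'I ws; rewrite /covered op0.
have [r rI /andP[r1 r2]] := closed_face uf gI (i_tr Hinv) s'I ws cl.
by exists (img fs r); rewrite ?r1 // inE map_f.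
Qed.

Lemma leaf_refutedP : op = [::] -> I != [::] -> leaf_refuted star I tr (size fs) -> False.
Proof.
move=> op0 I0; have eX := all_complete op0 I0; have gI := i_tet Hinv.
rewrite /leaf_refuted.
have complete_w w : w < size fs -> forall t, t \in X -> lab fs w \in t -> exists2 s, s \in I & t = img fs s.
  by move=> wk t; rewrite eX inE => /mapP[s sI ->] _; exists s.
case: ifP => [/andP[st]|_].
  rewrite lazy_hasE => /hasP[t tI]; rewrite lazy_hasE => /hasP[w wt].
  case E: (lookup tr _) => [|?|y z|] // nb.
  have := i_tr Hinv (remove w t); rewrite E => -[ss s3 yz [ys zs yI zI]].
  have yk : y < size fs by apply: (allP (gt_below (gI _ yI))); rewrite mem_insert inE eqxx.
  have zk : z < size fs by apply: (allP (gt_below (gI _ zI))); rewrite mem_insert inE eqxx.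
  have sk : below (size fs) (remove w t).
    by apply/allP => i i1; apply: (allP (gt_below (gI _ yI))); rewrite mem_insert inE i1 orbT.
  have := star_adj st (s := img fs (remove w t)) (x := lab fs y) (y := lab fs z).
  rewrite !mem_img // ys zs nth_uniq // yz -!img_insert !(gt_X (gI _ _)) //.
  move=> /(_ isT isT isT isT isT); rewrite inE => /andP[_ /existsP[r /andP[rX /andP[r1 r2]]]].
  have [r' r'I e] := complete_w y yk r rX r1.
  case/negP: nb; rewrite lazy_hasE; apply/hasP; exists r' => //; rewrite mem_bothE.
  by rewrite -!(mem_tet uf gI) // -e r1.
have k9 : size fs <= 9 by case/andP: k49.
case: ltnP => [k9' _|k9'].
  have /subsetPn[y yV yn] : ~~ (V \subset fs).
    apply/negP => /subset_leq_card; rewrite V9 (card_uniqP uf) => h.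
    by move: (leq_trans k9' h); rewrite ltnn.
  have [t] := okcov ok yV; rewrite eX inE => /mapP[s sI ->] /imgP[i is_ e].
  case/negP: yn; rewrite e mem_nth //; exact: (allP (gt_below (gI _ sI))).
rewrite lazy_hasE => /hasP[w]; rewrite mem_iota /= add0n => w9.
have wk : w < size fs by apply: leq_trans k9'.
rewrite (num_tetsE uf (i_I Hinv) gI wk (complete_w w wk)).
rewrite (label_degreeE uf gI k9 wk (complete_w w wk)).
by rewrite (okE ok (lab_V Hinv wk)) => /negP; apply; apply/eqnP.
Qed.

Lemma flag_beatenP : complete fs I (size fs) 0 -> flag_beaten I -> False.
Proof.
move=> cpl; have gI := i_tet Hinv; have [l0 l1 l2 l3] := lab0 Hinv.
have [k4 k9] := andP k49.
have cw t : t \in X -> lab fs 0 \in t -> exists2 s, s \in I & t = img fs s.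
  by move=> tX /(cpl t tX)[s sI [-> _]]; exists s.
rewrite /flag_beaten; cbv zeta; set ds := map _ _.
have dE i : i < size fs -> nth 0 ds i = #|tets_at2 X u (lab fs i)|.
  move=> ik; have i9 := leq_trans ik k9.
  rewrite (nth_map 0) ?size_iota // nth_iota // add0n.
  by have := num_tets2E uf (i_I Hinv) gI (leq_trans _ k4) cw ik; rewrite l0; apply.
have [k1 k2 k3] : [/\ 1 < size fs, 2 < size fs & 3 < size fs].
  by split; apply: leq_trans k4.
rewrite lazy_hasE => /hasP[[|[|?] [|x [|y [|z [|? ?]]]]]] // tI.
have /and4P[_ xk yk /andP[zk _]] := gt_below (gI _ tI).
have fm i j k : i < size fs -> j < size fs -> k < size fs -> img fs [:: 0; x; y; z] = img fs [:: 0; i; j; k] ->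
    lexlt (nth 0 ds 1) (nth 0 ds 2) (nth 0 ds 3)
      (nth 0 ds i) (nth 0 ds j) (nth 0 ds k) = false.
  move=> ik jk kk e; rewrite !dE // l1 l2 l3; apply: flagmax.
  suff <- : img fs [:: 0; i; j; k] = [set u; lab fs i; lab fs j; lab fs k] by rewrite -e (gt_X (gI _ tI)).
  by apply/setP => w; rewrite !inE l0 !orbA.
by rewrite !fm //; apply: img_eq_mem => w; rewrite !inE; case: (w == 0); case: (w == x);
  case: (w == y); case: (w == z).
Qed.

Lemma inv_rcons y : y \in V -> y \notin fs -> search_inv (rcons fs y) k0 cap I cs tr op.
Proof.
move=> yV yfs; have [k4 k9] := andP k49.
have wid s : below (size fs) s -> below (size (rcons fs y)) s.
  by move=> h; apply: sub_all h => i /=; rewrite size_rcons => /ltnW.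
case: Hinv => h1 h2 h3 h4 h5 h6 h7 h8 h9 h10 h11 h12; split => //.
- by rewrite rcons_uniq yfs.
- by move=> z; rewrite mem_rcons inE => /orP[/eqP ->|/h2].
- rewrite -h3 -cats1 take_cat; case: ltnP => // h.
  have e : size fs = 4 by apply/eqP; rewrite eqn_leq h k4.
  by rewrite e take0 cats0 take_oversize ?e.
- move=> t tI; have [a1 a2 a3 a4] := h4 t tI; split => //; first exact: wid.
  by rewrite img_rcons.
- by move=> s /h10 /wid.
- case: h11 => [->|[/andP[k01 k02] cpl]]; [by left|right]; split.
    by rewrite k01 size_rcons (leq_trans k02).
  move=> t tX; rewrite nth_rcons (leq_trans _ k4) // => /(cpl t tX)[s sI [e sk]].
  by exists s => //; rewrite img_rcons // (gt_below (h4 _ sI)).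
Qed.

(** This selects the branch to follow: [X] contains a second tetrahedron at the open triangle [t].
    If its apex has no label yet, it is appended to [fs] and thereby receives the label
    [size fs]. *)
Lemma new_vertex t x : t \in op -> lookup tr t = Open x ->
  exists fs' v, [/\ search_inv fs' k0 cap I cs tr op, v < minn (size fs).+1 9,
    (v \notin t) && (v != x), size fs' = (if eqn v (size fs) then (size fs).+1 else size fs) &
    good_tet fs' (insert v t) /\ below (size fs') t].
Proof.
move=> top gt; have := i_tr Hinv t; rewrite gt => -[st t3 xt xI].
have gI := i_tet Hinv.
have tk := i_op Hinv top.
have xk : x < size fs by apply: (allP (gt_below (gI _ xI))); rewrite mem_insert inE eqxx.
have fx : lab fs x \notin img fs t by rewrite mem_img.
have fX : lab fs x |: img fs t \in X by rewrite -img_insert (gt_X (gI _ xI)).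
have [y [yt yx yX]] := okface ok fx fX.
have yV : y \in V by apply: (subsetP (okV ok yX)); rewrite !inE eqxx.
pose fs' := if y \in fs then fs else rcons fs y.
pose v := index y fs.
have inv' : search_inv fs' k0 cap I cs tr op.
  by rewrite /fs'; case: ifPn => // yn; apply: inv_rcons.
have vk : v <= size fs by apply: index_size.
have sz : size fs' = (if eqn v (size fs) then (size fs).+1 else size fs).
  rewrite /fs' -index_mem -/v; have -> : eqn v (size fs) = (v == size fs) by [].
  by rewrite ltn_neqAle vk andbT; case: eqP => //=; rewrite size_rcons.
have vk' : v < size fs'.
  by rewrite sz; case: eqnP => [->//|/eqP h]; rewrite ltn_neqAle h.
have lv : lab fs' v = y.
  rewrite /fs' /v; case: ifPn => yn; first by rewrite nth_index.
  by rewrite nth_rcons memNindex // ltnn eqxx.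
have it : img fs' t = img fs t.
  by rewrite /fs'; case: ifP => // _; rewrite img_rcons.
have tk' : below (size fs') t.
  apply: sub_all tk => i /= /leq_trans; apply; rewrite sz; case: ifP => //.
have uf' := i_uniq inv'.
have vt : v \notin t by rewrite -(mem_img u uf' vk' tk') lv it.
have vx : v != x.
  apply: contra yx => /eqP e; case: (boolP (y \in fs)) => yn.
    by rewrite -e /v nth_index.
  by move: xk; rewrite -e /v memNindex // ltnn.
exists fs', v; split=> //.
- rewrite leq_min ltnS vk /=; have /andP[_ h] := inv_size inv'; exact: leq_trans h.
- by rewrite vt.
split=> //; split.
- exact: sorted_insert.
- by rewrite size_insert t3.
- by apply/allP => i; rewrite mem_insert inE => /orP[/eqP ->//|/(allP tk')].
- by rewrite img_insert lv it.
Qed.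
End Step.

Lemma face_allowsP fs k0 cap I cs tr op t w : search_inv fs k0 cap I cs tr op -> good_tet fs t -> w \in t ->
  face_allows star k0 t tr w.
Proof.
move=> Hinv [st t4 tk tX] wt; have uf := i_uniq Hinv; have gI := i_tet Hinv.
have wk := allP tk _ wt.
have sk : below (size fs) (remove w t) by apply/allP => i; rewrite mem_remove // => /andP[_ /(allP tk)].
have ws : w \notin remove w t by rewrite mem_remove // eqxx.
have wX : lab fs w |: img fs (remove w t) \in X by rewrite -img_insert insert_remove.
rewrite /face_allows; have := i_tr Hinv (remove w t); case E: (lookup tr _) => [|y|y z|] //.
  move=> [_ _ ys yI]; case: (boolP star) => // st'.
  have -> : eqn y 0 = (y == 0) by [].
  case: eqVneq => // y0; have -> : eqn k0 0 = (k0 == 0) by [].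
  case: eqVneq => // k00; have [e|[/andP[k0p k0k] cpl]] := i_k0 Hinv; first by rewrite e in k00.
  have [ew|nw] := eqVneq w 0; first by rewrite ew; case: (k0) k00.
  have k0' : 0 < size fs by apply: leq_trans k0k.
  have yX : lab fs 0 |: img fs (remove w t) \in X by rewrite -img_insert -y0 (gt_X (gI _ yI)).
  have := star_adj st' (s := img fs (remove w t)) (x := lab fs 0) (y := lab fs w).
  rewrite !mem_img // -{1}y0 ys ws nth_uniq // eq_sym nw yX wX => /(_ isT isT isT isT isT).
  rewrite inE => /andP[_ /existsP[r /andP[rX /andP[r1 r2]]]].
  have [r' r'I [e r'k]] := cpl r rX r1.
  apply: (allP r'k); by rewrite -(mem_tet uf gI) // -e.
move=> [_ _ yz [ys zs yI zI]].
have yk : y < size fs by apply: (allP (gt_below (gI _ yI))); rewrite mem_insert inE eqxx.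
have zk : z < size fs by apply: (allP (gt_below (gI _ zI))); rewrite mem_insert inE eqxx.
have -> : eqn w y = (w == y) by []. have -> : eqn w z = (w == z) by [].
case: eqVneq => // wy; case: eqVneq => // wz.
have := okface3 ok (s := img fs (remove w t)) (x := lab fs w) (y := lab fs y) (z := lab fs z).
rewrite !mem_img // ws ys zs wX -!img_insert !(gt_X (gI _ _)) // !nth_uniq // wy wz.
by move=> /(_ isT isT isT isT isT isT isT isT) /eqP; rewrite nth_uniq // (negbTE yz).
Qed.

Lemma nth_foldr_incr cs t w : uniq t ->
  nth 0 (foldr (fun w c => incr_nth c w) cs t) w = (w \in t) + nth 0 cs w.
Proof.
elim: t => //= x t IH /andP[xt /IH h]; rewrite nth_incr_nth inE eq_sym h.
by case: eqVneq => //= ->; rewrite (negbTE xt).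
Qed.

(** The second apex in [X] of the triangle to be closed is among the values tried, and no test
    rejects it because every test is a necessary condition. So the answer [true] would be inherited
    by a larger part of [X], until a leaf or a completed star contradicts it. *)
Lemma search_sound fuel k0 cap sz I cs tr op fs : search_inv fs k0 cap I cs tr op ->
  (exists2 t, t \in I & 0 \in t) -> sz = (size I).+1 ->
  search star max_tets fuel k0 cap0 cap (size fs) sz I cs tr op -> False.
Proof.
elim: fuel k0 cap sz I cs tr op fs => // fuel IH k0 cap sz I cs tr op0 fs Hinv0 I0 szE /=.
have Hinv := inv_clean Hinv0; set op := drop_closed tr op0 in Hinv *.
have In0 : I != [::] by case: I0 => t; case: (I).
have uf := i_uniq Hinv; have gI := i_tet Hinv.
have [l0 _ _ _] := lab0 Hinv; have [k4 k9] := andP (inv_size Hinv).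
have k0lt : 0 < size fs by apply: leq_trans k4.
case: ifP => [|_].
  have -> : eqn k0 0 = (k0 == 0) by []; case: eqVneq => // _; rewrite lazy_allE => /allP hop.
  have cpl : complete fs I (size fs) 0.
    apply: (star_complete Hinv) => // s /hop; rewrite mem_labelE => h s0; move: h; rewrite s0.
    by case: (lookup tr s).
  have cw t : t \in X -> lab fs 0 \in t -> exists2 s, s \in I & t = img fs s.
    by move=> tX /(cpl t tX)[s sI [-> _]]; exists s.
  have cE := num_tetsE uf (i_I Hinv) gI k0lt cw.
  rewrite cE (label_degreeE uf gI k9 k0lt cw) (okE ok (lab_V Hinv k0lt)).
  have -> x : eqn x x by apply/eqnP.
  case: ifP => [h _|_]; first exact: (flag_beatenP Hinv cpl h).
  apply: IH => //; case: Hinv => *; split => //.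
    by right; split => //; rewrite k0lt leqnn.
  move=> v vV; apply: leq_trans (le_cap vV) _; case: (star) => //.
  by rewrite l0.
case eop: op => [|t op']; first exact: leaf_refutedP Hinv eop In0.
have top : t \in op by rewrite eop inE eqxx.
case gt: (lookup tr t) => [|x|y z|] //.
have [fs' [v [Hinv' vlt /andP[vt vx] szfs [gT tk']]]] := new_vertex Hinv top gt.
rewrite lazy_allE => /allP /(_ v); rewrite mem_iota /= add0n => /(_ vlt).
rewrite mem_labelE (negbTE vt); have -> : eqn v x = (v == x) by []; rewrite (negbTE vx).
set t' := insert v t in gT *; have [st' t'4 t'k t'X] := gT.
have uf' := i_uniq Hinv'; have gI' := i_tet Hinv'.
have [l0' _ _ _] := lab0 Hinv'; have [k4' k9'] := andP (inv_size Hinv').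
have k0lt' : 0 < size fs' by apply: leq_trans k4'.

rewrite lazy_allE (_ : all _ t' = true); last by apply/allP => w wt; apply: (face_allowsP Hinv').
case gU: (lookup tr t') => [|?|? ?|] //.
have t'I : t' \notin I by apply/negP => /(i_in Hinv').
have gI2 s : s \in t' :: I -> good_tet fs' s by rewrite inE => /orP[/eqP ->|/gI'].
have uI2 : uniq (t' :: I) by rewrite /= t'I (i_I Hinv').
have vt' : v \in t' by rewrite mem_insert inE eqxx.
case: ifP => [|_].
  have -> : eqn k0 0 = (k0 == 0) by []; case: eqP => // k0n; have -> : eqn 0 v = (v == 0) by rewrite eq_sym.
  (* A tetrahedron at 0 that is still to be added contradicts the completeness of the star of 0. *)
  move=> /eqP v0 _; have [//|[/andP[k0p k0k] cpl]] := i_k0 Hinv'.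
  have [|s sI [e _]] := cpl _ t'X; first by rewrite (mem_tet uf' gI2) ?inE ?eqxx // -v0.
  have [ss _ sk _] := gI' _ sI.
  by case/negP: t'I; rewrite (img_inj uf' t'k sk st' ss e).
rewrite lazy_allE; case: ifP => [_|/negP[]]; last first.
  apply/allP => w wt; have wk := allP t'k _ wt.
  have := num_tets_le uf' uI2 gI2 wk; rewrite /= -(i_cs Hinv') mem_labelE wt add1n => h.
  apply: leq_trans h _; have -> : eqn w 0 = (w == 0) by [].
  case: eqVneq => [->|_]; first by rewrite l0'.
  exact: (i_cap Hinv' (lab_V Hinv' wk)).
case: ifP => [_|/negP[]]; last first.
  rewrite szE; have := @count_le _ _ uf' uI2 gI2 predT predT (fun _ _ _ => isT).
  rewrite count_predT /= => /leq_trans; apply; apply: leq_trans le_total.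
  by apply: subset_leq_card; apply/subsetP => s; rewrite inE => /andP[].
case ea: (add_faces _ _ _ _) => [[tr' op'']|] //.
have gtr2 : good_status (t' :: I) (store tr t' Tet).
  move=> s; rewrite lookup_store; case: eqP => // _; have := i_tr Hinv' s.
  by case: (lookup tr s) => [|y [-> -> -> h]|y z [-> -> -> [-> -> h1 h2]]|] //; split=> //;
     rewrite ?inE ?h ?h1 ?h2 ?orbT.
rewrite -eop in ea; have t'I2 : t' \in t' :: I by rewrite inE eqxx.
have [h1 h2 h3 h4 h5] :=
  add_facesP ea st' t'4 t'I2 t'k (fun _ h => h) gtr2 (i_op Hinv').
have nt' s : s != t' -> lookup (store tr t' Tet) s = lookup tr s.
  by move=> h; rewrite lookup_store eq_sym (negbTE h).
rewrite -szfs; apply: IH => //; last by rewrite szE.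
  case: Hinv' => a1 a2 a3 a4 a5 a6 a7 a8 a9 a10 a11 a12; split => //.
  - move=> w; rewrite nth_foldr_incr ?a6 /= ?mem_labelE //; exact: sorted_ltn_uniq.
  - move=> s; rewrite inE => /orP[/eqP ->|sI]; apply: h3; first by rewrite lookup_store eqxx.
    by rewrite nt'; [apply: a8 | apply: contraNneq t'I => <-].
  - move=> s w; rewrite inE => /orP[/eqP ->|sI] ws; first exact: h5.
    apply: h4; move: (a9 s w sI ws); rewrite /covered nt' //.
    apply/eqP => e; have := size_remove ws; rewrite e t'4 (gt_size (a4 _ sI)); done.
  - case: a11 => [->|[k1 cpl]]; [by left|right]; split=> // r rX /(cpl r rX)[s sI h].
    by exists s => //; rewrite inE sI orbT.
by case: I0 => s sI s0; exists s => //; rewrite inE sI orbT.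
Qed.

Hypotheses (flagX : [set u; a; b; c] \in X) (cap0E : cap0 = if star then 10 else 12).

Lemma search_refutes_sound : search_refutes star max_tets -> False.
Proof.
rewrite /search_refutes -cap0E; case ea: add_faces => [[tr op]|] //.
pose fs := [:: u; a; b; c].
have eimg : img fs [:: 0; 1; 2; 3] = [set u; a; b; c].
  by apply/setP => x; rewrite !inE !orbA.
have ufs : uniq fs.
  have : #|[set x in fs]| = 4.
    rewrite -(ok4 ok flagX); apply: eq_card => x; by rewrite !inE !orbA.
  by move=> h; apply/card_uniqP; rewrite /= -h cardsE.
have gt : good_tet fs [:: 0; 1; 2; 3] by split => //; rewrite eimg.
have I0 t : t \in [:: [:: 0; 1; 2; 3]] -> good_tet fs t by rewrite inE => /eqP ->.
have gtr : good_status [:: [:: 0; 1; 2; 3]] (store empty_trie [:: 0; 1; 2; 3] Tet).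
  move=> s; rewrite lookup_store; case: eqP => // _.
  suff -> : lookup empty_trie s = Unknown by [].
  by elim: s => //= x s IH; rewrite nth_nil.
have noop s : s \in [::] -> below 4 s by [].
have [h1 h2 h3 h4 h5] := @add_facesP _ _ _ _ _ _ [:: [:: 0; 1; 2; 3]] 4 ea
  isT erefl (mem_head _ _) isT (fun _ h => h) gtr noop.
apply: (search_sound (fs := fs)) => //; last by exists [:: 0; 1; 2; 3].
split => //.
- by apply/allP; rewrite /= !(subsetP (okV ok flagX)) // !inE eqxx ?orbT.
- by case=> [|[|[|[|w]]]] //; rewrite nth_default.
- by move=> t; rewrite inE => /eqP ->; apply: h3; rewrite lookup_store eqxx.
- by move=> t w; rewrite inE => /eqP -> /h5.
- by left.
Qed.
End Sound.

(** * Outcome of the searches and the number of edges *)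

Lemma search_refutes_star : search_refutes true 27.
Proof. by vm_compute. Qed.
Lemma search_refutes_small : search_refutes false 16.
Proof. by vm_compute. Qed.

(** The degrees of edges are at most 12, so reading three of them as digits in base 13, with 169 =
    13 * 13, turns the lexicographic order into the order of numbers. A maximal flag is then found
    as the maximum of a numerical function. *)
Lemma lexlt_weight a b c a' b' c' : b <= 12 -> c <= 12 -> b' <= 12 -> c' <= 12 ->
  lexlt a b c a' b' c' -> a * 169 + b * 13 + c < a' * 169 + b' * 13 + c'.
Proof.
rewrite /lexlt; case: ifP => // h1; case: ifP => h2; first by lia.
by case: ifP => // h3; case: ifP => h4; lia.
Qed.

Section Comb2.
Variables (T : finType) (V : {set T}) (X : {set {set T}}).
Hypothesis ok : manifold_tets V X.
Hypothesis V9 : #|V| = 9.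

Lemma nbrs_sub v : nbrs X v \subset V :\ v.
Proof.
apply/subsetP => y; rewrite !inE => /andP[-> /existsP[t /andP[tX /andP[_ yt]]]].
exact: (subsetP (okV ok tX)).
Qed.

Lemma tets_at_le12 v : v \in V -> #|tets_at X v| <= 12.
Proof.
move=> vV; have := okE ok vV; have := subset_leq_card (nbrs_sub v).
have := V9; rewrite (cardsD1 v V) vV; lia.
Qed.

Lemma tets_at_le10 u v : u \in V -> v \in V -> v != u -> v \notin nbrs X u -> #|tets_at X u| <= 10.
Proof.
move=> uV vV vu vn; have := okE ok uV.
have : nbrs X u \subset V :\ u :\ v.
  by rewrite subsetD1 nbrs_sub.
move/subset_leq_card; have := V9; rewrite (cardsD1 u V) uV (cardsD1 v (V :\ u)) !inE vV vu.
lia.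
Qed.

Lemma max_flag u : u \in V -> exists a b c, [set u; a; b; c] \in X /\
  forall x y z, [set u; x; y; z] \in X ->
  lexlt #|tets_at2 X u a| #|tets_at2 X u b| #|tets_at2 X u c|
        #|tets_at2 X u x| #|tets_at2 X u y| #|tets_at2 X u z| = false.
Proof.
move=> uV; have [t tX ut] := okcov ok uV.
pose P (f : T * T * T) := [set u; f.1.1; f.1.2; f.2] \in X.
have [f0 Pf0] : exists f, P f.
  have : #|t :\ u| = 3 by have := ok4 ok tX; rewrite (cardsD1 u) ut; case.
  move=> h; have : size (enum (t :\ u)) = 3 by rewrite -cardE.
  case E: (enum _) => [|x [|y [|z []]]] // _; exists (x, y, z); rewrite /P /=.
  suff -> : [set u; x; y; z] = t by [].
  rewrite -(setD1K ut); apply/setP => w.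
  have := mem_enum (t :\ u) w; rewrite E !inE => <-; by rewrite !orbA.
pose w x := #|tets_at2 X u x|.
have w12 x : w x <= 12.
  apply: leq_trans (tets_at_le12 uV); apply: subset_leq_card.
  by apply/subsetP => s; rewrite !inE => /andP[-> /andP[->]].
case: (arg_maxnP (fun f => w f.1.1 * 169 + w f.1.2 * 13 + w f.2) Pf0) => -[[a b] c] /= Pf mx.
exists a, b, c; split => // x y z xX; apply/negP => /lexlt_weight.
move=> /(_ (w12 _) (w12 _) (w12 _) (w12 _)); rewrite -/(w a) ltnNge => /negP; apply.
exact: (mx (x, y, z)).
Qed.

Lemma sum_tets_at : \sum_(x in V) #|tets_at X x| = 4 * #|X|.
Proof.
rewrite mulnC -sum_nat_const [RHS](eq_bigr (fun t : {set T} => #|t|)); last by move=> t /(ok4 ok).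
transitivity (\sum_(t in X) \sum_(x in V) (x \in t)); last first.
  apply: eq_bigr => t tX; rewrite -sum1_card big_mkcond [RHS]big_mkcond /=.
  apply: eq_bigr => x _; case: (boolP (x \in t)) => [/(subsetP (okV ok tX)) ->|] //.
  by case: ifP.
rewrite exchange_big; apply: eq_bigr => x _.
rewrite -[LHS]sum1_card [LHS](eq_bigl (fun t => (t \in X) && (x \in t))); last by move=> t; rewrite inE.
by rewrite big_mkcondr.
Qed.

Lemma flip_exists u v : u \in V -> v \in V -> v != u -> v \notin nbrs X u ->
  exists (s : {set T}) x y, [/\ x \notin s, y \notin s, x != y &
                 [/\ x |: s \in X, y |: s \in X & y \notin nbrs X x]].
Proof.
move=> uV vV vu vn; pose P (f : {set T} * T * T) :=
  [&& f.1.2 \notin f.1.1, f.2 \notin f.1.1, f.1.2 != f.2, f.1.2 |: f.1.1 \in X,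
   f.2 |: f.1.1 \in X & f.2 \notin nbrs X f.1.2].
case: (boolP [exists f, P f]) => [/existsP[[[s x] y] /and5P[a b c d /andP[e f]]]|].
  by exists s, x, y.
rewrite negb_exists => /forallP nP; exfalso.
have [a [b [c [abc mx]]]] := max_flag uV.
have X27 : #|X| <= 27.
  have : 4 * #|X| <= 12 * 9; last by lia.
  rewrite -sum_tets_at; apply: (@leq_trans (\sum_(x in V) 12)); last by rewrite sum_nat_const V9.
  by apply: leq_sum => x; apply: tets_at_le12.
apply: (search_refutes_sound ok V9 (star := true) _ X27 (tets_at_le10 uV vV vu vn) _ _ mx abc erefl search_refutes_star).
- move=> _ s x y xs ys xy xX yX; have := nP (s, x, y); rewrite /P /= xs ys xy xX yX /=.
  by rewrite negbK.
- exact: tets_at_le12.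
- exact: tets_at_le12.
Qed.

Lemma lower_bound : 17 <= #|X|.
Proof.
rewrite leqNgt; apply/negP => X16.
have /set0Pn[v0 v0V] : V != set0 by rewrite -card_gt0 V9.
case: (arg_maxnP (fun v => #|tets_at X v|) v0V) => u uV mxu.
have [a [b [c [abc mx]]]] := max_flag uV.
apply: (search_refutes_sound ok V9 (star := false) _ _ (tets_at_le12 uV) _ _ mx abc erefl search_refutes_small) => //.
exact: tets_at_le12.
Qed.

(** Euler's formula summed over the nine vertices: twice the sum is 4 * |X| + 36, which is at least
    4 * 17 + 36 = 104. *)
Lemma sum_nbrs : 52 <= \sum_(u in V) #|nbrs X u|.
Proof.
rewrite -leq_double -[leqRHS]muln2 big_distrl /=.
rewrite (eq_bigr (fun u => #|tets_at X u| + 4)); last by move=> u /(okE ok) ->; rewrite muln2.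
rewrite big_split sum_nat_const sum_tets_at V9 /=; have := lower_bound.
by move: #|X| => m; lia.
Qed.
End Comb2.

(** * Barycentric coordinates and subdivisions *)

Local Open Scope ring_scope.

Section Points.
Variable R : realType.

Section OneComplex.
Variable T : finType.
Implicit Types (x d e : {ffun T -> R}) (K : {set {set T}}) (s t : {set T}).

Definition supp x : {set T} := [set v | x v != 0].
Definition prob x := [forall v, 0 <= x v] && (\sum_v x v == 1).
Definition pts K x := prob x && (supp x \in K).

Lemma probP x : reflect ((forall v, 0 <= x v) /\ \sum_v x v = 1) (prob x).
Proof. by apply: (iffP andP) => [[/forallP h /eqP]|[h /eqP]]; split => //; apply/forallP. Qed.

Lemma supp0 x v s : supp x \subset s -> v \notin s -> x v = 0.
Proof. by move=> /subsetP h; apply: contraNeq => xv; apply: h; rewrite inE. Qed.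

Lemma prob_supp x : prob x -> supp x != set0.
Proof.
case/probP => _ s1; apply/negP => /eqP s0.
have : \sum_v x v = 0 by apply: big1 => v _; apply: (@supp0 _ _ set0); rewrite ?s0 ?inE.
by rewrite s1 => /eqP; rewrite oner_eq0.
Qed.

Lemma pts_sub K x s : simplicial_complex K -> s \in K -> prob x -> supp x \subset s -> pts K x.
Proof. by case=> _ h sK px xs; rewrite /pts px (h s) // prob_supp. Qed.

Lemma sum_supp (W : nmodType) x s (f : T -> W) : (forall v, x v = 0 -> f v = 0) -> supp x \subset s ->
  \sum_v f v = \sum_(v in s) f v.
Proof.
move=> f0 xs; rewrite [RHS]big_mkcond; apply: eq_bigr => v _.
by case: ifPn => // vs; apply: f0; apply: supp0 xs vs.
Qed.

Definition ev n (p : T -> 'rV[R]_n) x := \sum_v x v *: p v.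

Lemma hull_prob n (p : T -> 'rV[R]_n) s y : in_hull p s y ->
  exists x, [/\ prob x, supp x \subset s & y = ev p x].
Proof.
case=> c [c0 c1 ->]; exists [ffun v => if v \in s then c v else 0]; split.
- apply/probP; split => [v|]; first by rewrite ffunE; case: ifP => // /c0.
  by under eq_bigr do rewrite ffunE; rewrite -big_mkcond.
- by apply/subsetP => v; rewrite inE ffunE; case: ifP => //; rewrite eqxx.
rewrite /ev [LHS]big_mkcond; apply: eq_bigr => v _; rewrite ffunE.
by case: ifP; rewrite ?scale0r.
Qed.

Lemma ev_hull n (p : T -> 'rV[R]_n) s x : prob x -> supp x \subset s -> in_hull p s (ev p x).
Proof.
case/probP => x0 x1 xs; exists x; split => //.
  by rewrite -x1; symmetry; apply: sum_supp xs.
by apply: sum_supp xs => v ->; rewrite scale0r.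
Qed.

(** The common image has coordinates [z] over the intersection of the two supports; affine
    independence of each face identifies both [x] and [y] with [z]. *)
Lemma real_inj n (p : T -> 'rV[R]_n) K x y : geometric_realization p K ->
  pts K x -> pts K y -> ev p x = ev p y -> x = y.
Proof.
move=> [indep meet] /andP[px xK] /andP[py yK] e.
have hx := ev_hull p px (subxx _); have hy := ev_hull p py (subxx _); rewrite -e in hy.
have /hull_prob[z [pz zs ez]] := (meet _ _ xK yK _).1 (conj hx hy).
have key w : prob w -> supp w \in K -> supp z \subset supp w -> ev p w = ev p z -> w = z.
  move=> pw wK zw ewz; apply/ffunP => v; apply/eqP; rewrite -subr_eq0; apply/eqP.
  have [vw|vw] := boolP (v \in supp w); last by rewrite !(@supp0 _ _ (supp w)) // subr0.
  apply: (indep _ wK (fun v => w v - z v)) => //.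
    rewrite -(@sum_supp _ w) //; last by move=> u wu; rewrite wu (@supp0 z u (supp w)) ?subr0 // inE wu eqxx.
    by rewrite sumrB (probP _ pw).2 (probP _ pz).2 subrr.
  rewrite -(@sum_supp _ w) //; last first.
    by move=> u wu; rewrite wu (@supp0 z u (supp w)) ?subr0 ?scale0r // inE wu eqxx.
  under eq_bigr do rewrite scalerBl.
  by rewrite sumrB -!/(ev p _) ewz subrr.
have [zx zy] : supp z \subset supp x /\ supp z \subset supp y by move: zs; rewrite subsetI => /andP[].
by rewrite (key x px xK zx ez) (key y py yK zy (etrans (esym e) ez)).
Qed.

(** An affine dependency on a face would allow the barycentre of the face to move without moving its
    image. The intersection property is the uniqueness of coordinates. *)
Lemma inj_real n (p : T -> 'rV[R]_n) K : simplicial_complex K ->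
  (forall x y, pts K x -> pts K y -> ev p x = ev p y -> x = y) -> geometric_realization p K.
Proof.
move=> sK inj; split => [s sinK c c0 cp v vs|s t sinK tinK y].
  have s0 : (0 < #|s|)%N by rewrite card_gt0; case: sK => + _; apply: contra => /eqP <-.
  have n0 : 0 < #|s|%:R :> R by rewrite ltr0n.
  pose S := 1 + \sum_(u in s) `|c u|.
  have S0 : 0 < S by apply: ltr_wpDr => //; apply: sumr_ge0.
  (* Since [S] exceeds every [|c u|], adding [e * c u] to the barycentric weight [#|s|%:R^-1] leaves
     it positive. *)
  pose e := (S * #|s|%:R)^-1.
  have e0 : 0 < e by rewrite invr_gt0 mulr_gt0.
  pose d0 := [ffun u => if u \in s then #|s|%:R^-1 else 0 : R].
  pose d := [ffun u => if u \in s then #|s|%:R^-1 + e * c u else 0 : R].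
  have sum0 : \sum_(u in s) #|s|%:R^-1 = 1 :> R.
    by rewrite sumr_const -[LHS]mulr_natr mulVf // gt_eqF.
  have dpos u : u \in s -> 0 < #|s|%:R^-1 + e * c u.
    move=> us; rewrite -ltrBlDl sub0r ltrNl -mulrN.
    rewrite /e invfM mulrAC -[X in _ < X]mul1r ltr_pM2r ?invr_gt0 // mulrC ltr_pdivrMr // mul1r.
    apply: le_lt_trans (ler_norm _) _; rewrite normrN /S (bigD1 u) //=.
    by rewrite addrCA ltrDl ltr_pwDl // sumr_ge0.
  have pd0 : prob d0.
    apply/probP; split => [u|]; first by rewrite ffunE; case: ifP => // _; rewrite invr_ge0 ltW.
    by under eq_bigr do rewrite ffunE; rewrite -big_mkcond.
  have pd : prob d.
    apply/probP; split => [u|]; first by rewrite ffunE; case: ifP => // /dpos /ltW.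
    under eq_bigr do rewrite ffunE; rewrite -big_mkcond big_split /= sum0.
    by rewrite -mulr_sumr c0 mulr0 addr0.
  have sd0 : supp d0 \subset s by apply/subsetP => u; rewrite inE ffunE; case: ifP; rewrite ?eqxx.
  have sd : supp d \subset s by apply/subsetP => u; rewrite inE ffunE; case: ifP; rewrite ?eqxx.
  have := inj _ _ (pts_sub sK sinK pd sd) (pts_sub sK sinK pd0 sd0).
  rewrite /ev (@sum_supp _ d s) //; last by move=> u ->; rewrite scale0r.
  rewrite (@sum_supp _ d0 s) //; last by move=> u ->; rewrite scale0r.
  rewrite (eq_bigr (fun u => d0 u *: p u + e *: (c u *: p u))); last first.
    by move=> u us; rewrite !ffunE us scalerDl scalerA.
  rewrite big_split /= -scaler_sumr cp scaler0 addr0 => /(_ erefl) /ffunP /(_ v).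
  rewrite !ffunE vs => /eqP; rewrite -subr_eq0 addrAC subrr add0r mulf_eq0 (gt_eqF e0) /=.
  by move/eqP.
split=> [[/hull_prob[x [px xs ex]] /hull_prob[x' [px' xt ex']]]|/hull_prob[x [px + ->]]].
  have e := inj _ _ (pts_sub sK sinK px xs) (pts_sub sK tinK px' xt) (etrans (esym ex) ex').
  by rewrite ex; apply: ev_hull => //; rewrite subsetI xs e.
by rewrite subsetI => /andP[xs xt]; split; apply: ev_hull.
Qed.

Lemma carrierP n (p : T -> 'rV[R]_n) K y : simplicial_complex K ->
  carrier p K y <-> exists2 x, pts K x & y = ev p x.
Proof.
move=> sK; split=> [[s sinK /hull_prob[x [px xs ->]]]|[x /andP[px xK] ->]].
  by exists x => //; apply: pts_sub xs.
by exists (supp x) => //; apply: ev_hull.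
Qed.
End OneComplex.

Definition push (U T : finType) (b : U -> {ffun T -> R}) (d : {ffun U -> R}) : {ffun T -> R} :=
  [ffun v => \sum_u d u * b u v].

(* [b] gives the barycentric coordinates in [K] of the vertices of the subdivision [K']; the carrier
   of [K] is modelled by [pts K]. *)
Record asub (U T : finType) (K' : {set {set U}}) (K : {set {set T}}) (b : U -> {ffun T -> R}) : Prop :=
  Asub {
  as_face : forall s, s \in K' -> exists2 t, t \in K & forall u, u \in s -> prob (b u) /\ supp (b u) \subset t;
  as_inj : forall d d', pts K' d -> pts K' d' -> push b d = push b d' -> d = d';
  as_surj : forall x, pts K x -> exists2 d, pts K' d & push b d = x }.

Section Push.
Variables (U T : finType).
Implicit Types (b : U -> {ffun T -> R}) (d : {ffun U -> R}) (s : {set U}) (t : {set T}).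

Lemma push_supp b d s t : supp d \subset s -> (forall u, u \in s -> supp (b u) \subset t) ->
  supp (push b d) \subset t.
Proof.
move=> ds bt; apply/subsetP => v; rewrite inE ffunE; apply: contraR => vt.
apply/eqP; apply: big1 => u _; have [us|us] := boolP (u \in s).
  by rewrite (supp0 (bt u us) vt) mulr0.
by rewrite (supp0 ds us) mul0r.
Qed.

Lemma push_prob b d s : prob d -> supp d \subset s -> (forall u, u \in s -> prob (b u)) -> prob (push b d).
Proof.
move=> /probP[d0 d1] ds pb; apply/probP; split => [v|].
  rewrite ffunE; apply: sumr_ge0 => u _; have [us|us] := boolP (u \in s).
    by rewrite mulr_ge0 //; case/probP: (pb u us).
  by rewrite (supp0 ds us) mul0r.
under eq_bigr do rewrite ffunE; rewrite exchange_big /= -d1; apply: eq_bigr => u _.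
rewrite -mulr_sumr; have [us|us] := boolP (u \in s).
  by case/probP: (pb u us) => _ ->; rewrite mulr1.
by rewrite (supp0 ds us) mul0r.
Qed.

Lemma push_pts K' K b d : simplicial_complex K -> asub K' K b -> pts K' d -> pts K (push b d).
Proof.
move=> sK h /andP[pd dK']; have [t tK bt] := as_face h dK'.
apply: (pts_sub sK tK).
  by apply: push_prob (subxx _) _ => // u /bt[].
by apply: push_supp (subxx _) _ => u /bt[].
Qed.

Lemma ev_push n (p : T -> 'rV[R]_n) b d : ev p (push b d) = ev (fun u => ev p (b u)) d.
Proof.
rewrite /ev; under eq_bigr do rewrite ffunE scaler_suml.
rewrite exchange_big; apply: eq_bigr => u _; rewrite scaler_sumr.
by apply: eq_bigr => v _; rewrite scalerA.
Qed.

Lemma eq_ev n (q q' : U -> 'rV[R]_n) d : {in supp d, q =1 q'} -> ev q d = ev q' d.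
Proof.
move=> h; apply: eq_bigr => u _; have [us|us] := boolP (u \in supp d); first by rewrite h.
by rewrite (supp0 (subxx _) us) !scale0r.
Qed.

(** The vector [b u] consists of the coordinates in [K] of the position [q u]. A face of [K'] lies
    in one simplex of [K], and by uniqueness of coordinates the supports of its [b u] lie in that
    simplex too. *)
Lemma subdivision_asub (K' : {set {set U}}) (K : {set {set T}}) : simplicial_complex K ->
  subdivision R K' K -> exists b, asub K' K b.
Proof.
move=> sK [sK' [n [q [p [rq rp ec hs]]]]].
have /choice[b hb] : forall u, exists x, [set u] \in K' -> pts K x /\ ev p x = q u.
  move=> u; have [uK|uK] := boolP ([set u] \in K'); last by exists [ffun=> 0].
  have : carrier q K' (q u).
    exists [set u] => //; exists (fun=> 1); split => //; first by rewrite big_set1.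
    by rewrite big_set1 scale1r.
  by move/ec/(carrierP _ _ sK) => [x xK e]; exists x.
have vK s u : s \in K' -> u \in s -> [set u] \in K'.
  move=> sinK us; case: sK' => _; apply; first exact: sinK.
    by rewrite sub1set.
  by apply/set0Pn; exists u; rewrite inE.
have face s : s \in K' -> exists2 t, t \in K & forall u, u \in s -> prob (b u) /\ supp (b u) \subset t.
  move=> sinK'; have [t tK st] := hs s sinK'; exists t => // u us.
  have [/andP[pb bK] eb] := hb u (vK s u sinK' us); split => //.
  have : in_hull q s (q u).
    exists (fun w => (w == u)%:R); split => [w _||]; first by case: eqP.
      rewrite (bigD1 u) //= eqxx big1 ?addr0 // => w /andP[_ /negbTE ->] //.
    rewrite (bigD1 u) //= eqxx scale1r big1 ?addr0 // => w /andP[_ /negbTE ->].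
    by rewrite scale0r.
  move/st/hull_prob => [x [px xt ex]].
  have <- : x = b u.
    by apply: (real_inj rp (pts_sub sK tK px xt)); [rewrite /pts pb | rewrite eb].
  exact: xt.
have evq d : pts K' d -> ev p (push b d) = ev q d.
  case/andP => pd dK; rewrite ev_push; apply: eq_ev => u ud.
  by have [_] := hb u (vK _ u dK ud).
have psh d : pts K' d -> pts K (push b d).
  case/andP=> pd dK; have [t tK bt] := face _ dK; apply: (pts_sub sK tK).
    by apply: push_prob (subxx _) _ => // u /bt[].
  by apply: push_supp (subxx _) _ => u /bt[].
exists b; split => //.
  by move=> d d' hd hd' e; apply: (real_inj rq); rewrite // -!evq // e.
move=> x xK; have : carrier p K (ev p x) by apply/carrierP => //; exists x.
move/ec/(carrierP _ _ sK') => [d dK e]; exists d => //.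
by apply: (real_inj rp) => //; [exact: psh | rewrite evq].
Qed.
End Push.

(** With the vertices at the standard basis vectors, a point of the carrier is its own vector of
    barycentric coordinates; so every complex has a realization. *)
Definition stdpt (T : finType) (v : T) : 'rV[R]_#|T| := \row_j (j == enum_rank v)%:R.

Lemma ev_std (T : finType) (x : {ffun T -> R}) v : ev (@stdpt T) x 0 (enum_rank v) = x v.
Proof.
rewrite /ev summxE (bigD1 v) //= !mxE eqxx mulr1 big1 ?addr0 // => w wv.
by rewrite !mxE (inj_eq enum_rank_inj) eq_sym (negbTE wv) mulr0.
Qed.

Lemma std_inj (T : finType) (x y : {ffun T -> R}) : ev (@stdpt T) x = ev (@stdpt T) y -> x = y.
Proof. by move=> e; apply/ffunP => v; rewrite -!ev_std e. Qed.

Lemma asub_subdivision (U T : finType) (K' : {set {set U}}) (K : {set {set T}}) b :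
  simplicial_complex K' -> simplicial_complex K -> asub K' K b -> subdivision R K' K.
Proof.
move=> sK' sK h; split=> //; exists #|T|, (fun u => ev (@stdpt T) (b u)), (@stdpt T); split.
- apply: inj_real => // x y xK yK; rewrite -!ev_push => /std_inj; exact: (as_inj h).
- by apply: inj_real => // x y _ _ /std_inj.
- move=> y; split=> /carrierP -/(_ _)[] // x xK ->; apply/carrierP => //.
    by exists (push b x); rewrite ?ev_push //; apply: push_pts h xK.
  by have [d dK <-] := as_surj h xK; exists d; rewrite // ev_push.
move=> s sK's; have [t tK bt] := as_face h sK's; exists t => // y.
move=> /hull_prob[d [pd ds ->]]; rewrite -ev_push; apply: ev_hull.
  by apply: push_prob pd ds _ => u /bt[].
by apply: push_supp ds _ => u /bt[].
Qed.

Lemma asub_iso (U U' T : finType) (K' : {set {set U}}) (L' : {set {set U'}}) (K : {set {set T}}) b :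
  simplicial_complex K' -> isomorphic K' L' -> asub L' K b -> exists b', asub K' K b'.
Proof.
move=> sK' [f finj eL] h; exists (b \o f).
have vK s u : s \in K' -> u \in s -> u \in vertices K'.
  move=> sinK us; rewrite inE; case: sK' => _; apply; first exact: sinK.
    by rewrite sub1set.
  by apply/set0Pn; exists u; rewrite inE.
(* Weights are pushed forward along [f]; summing over fibres avoids an inverse of [f], which is
   injective on vertices only. *)
pose im (d : {ffun U -> R}) : {ffun U' -> R} := [ffun w => \sum_(u in supp d | f u == w) d u].
have imE d u : supp d \in K' -> u \in vertices K' -> im d (f u) = d u.
  move=> dK uV; rewrite ffunE; have [ud|ud] := boolP (u \in supp d).
    rewrite (bigD1 u) ?ud ?eqxx //= big1 ?addr0 // => w /andP[/andP[wd /eqP fw] wu].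
    by case/eqP: wu; apply: finj => //; exact: vK dK wd.
  rewrite big1 ?(supp0 (subxx _) ud) // => w /andP[wd /eqP fw].
  by case/negP: ud; rewrite -(finj _ _ _ _ fw) //; exact: vK dK wd.
have im0 d w : w \notin f @: supp d -> im d w = 0.
  move=> wn; rewrite ffunE; apply: big1 => u /andP[ud /eqP fu].
  by case/negP: wn; rewrite -fu imset_f.
have supp_im d : supp d \in K' -> supp (im d) = f @: supp d.
  move=> dK; apply/setP => w; apply/idP/idP.
    by rewrite inE; apply: contraNT => /im0 ->.
  by case/imsetP => u ud ->; rewrite inE imE ?(vK _ _ dK) //; move: ud; rewrite inE.
have sum_im (F : U' -> R) d : supp d \in K' -> \sum_w im d w * F w = \sum_u d u * F (f u).
  move=> dK; rewrite (@sum_supp _ _ (im d) (f @: supp d)); last by rewrite supp_im.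
    rewrite big_imset /=; last by move=> u u' ud ud'; apply: finj; exact: vK dK _.
    rewrite [RHS](@sum_supp _ _ d (supp d)) //; last by move=> u ->; rewrite mul0r.
    by apply: eq_bigr => u ud; rewrite imE ?(vK _ _ dK).
  by move=> w ->; rewrite mul0r.
have sum1_im d : supp d \in K' -> \sum_w im d w = \sum_u d u.
  move=> dK; transitivity (\sum_w im d w * 1); first by apply: eq_bigr => w _; rewrite mulr1.
  by rewrite (sum_im (fun=> 1)) //; apply: eq_bigr => w _; rewrite mulr1.
have push_im d : supp d \in K' -> push b (im d) = push (b \o f) d.
  by move=> dK; apply/ffunP => v; rewrite !ffunE sum_im.
have pts_im d : pts K' d -> pts L' (im d).
  case/andP => /probP[d0 d1] dK; apply/andP; split; last by rewrite supp_im // eL imset_f.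
  apply/probP; split => [w|]; first by rewrite ffunE; apply: sumr_ge0.
  by rewrite sum1_im.
split.
- move=> s sinK'; have [|t tK bt] := as_face h (_ : f @: s \in L'); first by rewrite eL imset_f.
  by exists t => // u us; apply: bt; rewrite imset_f.
- move=> d d' hd hd'; have /andP[_ dK] := hd; have /andP[_ dK'] := hd'.
  rewrite -!push_im // => /(as_inj h (pts_im _ hd) (pts_im _ hd')) e.
  apply/ffunP => u; have [uV|uV] := boolP (u \in vertices K'); first by rewrite -!imE // e.
  rewrite !(supp0 (subxx _)) //; apply: contra uV; [exact: vK dK'|exact: vK dK].
move=> x xK; have [d0 /andP[pd0 dL] ex] := as_surj h xK.
move: dL; rewrite eL => /imsetP[s sinK' es].
have sV u : u \in s -> u \in vertices K' by apply: vK.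
pose d : {ffun U -> R} := [ffun u => if u \in s then d0 (f u) else 0].
have ds : supp d = s.
  apply/setP => u; rewrite inE ffunE; case: ifP => [us|]; last by rewrite eqxx.
  have : f u \in supp d0 by rewrite es imset_f.
  by rewrite inE.
have dK : supp d \in K' by rewrite ds.
have ed : im d = d0.
  apply/ffunP => w; have [|wn] := boolP (w \in f @: s).
    by case/imsetP => u us ->; rewrite imE ?sV // ffunE us.
  by rewrite im0 ?ds // (supp0 (subxx _)) // es.
exists d; last by rewrite -push_im // ed.
rewrite /pts dK andbT; apply/probP; case/probP: pd0 => d00 d01; split => [u|].
  by rewrite ffunE; case: ifP.
by rewrite -d01 -ed sum1_im.
Qed.

(** After transport along the isomorphism, the two subdivisions become a single complex [K'] with
    two coordinate maps, one into [K] and one into the standard sphere. All transfers of properties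
    go through such a [K']. *)
Theorem sphere_asub (d : nat) (T : finType) (K : {set {set T}}) :
  let L := standard_sphere [set: 'I_d.+2] in
  simplicial_complex K -> simplicial_complex L ->
  combinatorial_sphere R d K <->
  exists (U : finType) (K' : {set {set U}}) b g,
    [/\ simplicial_complex K', asub K' K b & asub K' L g].
Proof.
move=> L sK sL; split => [[U [U' [K' [L' [s1 s2 iso]]]]]|[U [K' [b [g [sK' h1 h2]]]]]].
  have sK' := s1.1; have [b hb] := subdivision_asub sK s1.
  have [g0 hg0] := subdivision_asub sL s2; have [g hg] := asub_iso sK' iso hg0.
  by exists U, K', b, g.
exists U, U, K', K'; split; [exact: asub_subdivision h1|exact: asub_subdivision h2|].
exists id => //; apply/setP => s; apply/idP/imsetP => [sK's|[s' s'K ->]].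
  by exists s => //; rewrite imset_id.
by rewrite imset_id.
Qed.
End Points.

(** * Euler characteristics of polyhedral sets *)

Section Valuation.
Variable R : realType.

Lemma above_gap (c : R) (l : seq R) : exists2 t, c < t & forall s, s \in l -> c < s -> t < s.
Proof.
elim: l => [|s l [t ct IH]]; first by exists (c + 1); rewrite ?ltrDl.
have [cs|sc] := ltP c s; last first.
  exists t => // s'; rewrite inE => /orP[/eqP ->|]; last exact: IH.
  by rewrite ltNge sc.
exists (Num.min t ((c + s) / 2)).
  by rewrite lt_min ct /=; lra.
move=> s'; rewrite inE => /orP[/eqP -> _|/IH h /h ts]; rewrite gt_min ?ts //.
by apply/orP; right; lra.
Qed.

(* Points contribute [1] and open intervals [-1]; grouping the pieces by their left endpoint [c], the
   jump of the step function from [c] to just after [c] is the contribution of the group. *)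
Lemma euler_line (I : finType) (w : I -> int) (J : I -> R -> Prop) (op : I -> bool) (a : I -> R) :
  (forall i, w i != 0 -> if op i then exists2 b, a i < b & forall t, J i t <-> a i < t < b
                         else forall t, J i t <-> t = a i) ->
  (forall t, \sum_(i | `[< J i t >]) w i = 0) ->
  \sum_i (-1) ^+ op i * w i = 0.
Proof.
move=> hJ hw.
have hb i : exists b, w i != 0 -> op i -> a i < b /\ forall t, J i t <-> a i < t < b.
  have [wi|wi] := boolP (w i != 0); last by exists 0.
  by have := hJ i wi; case: (op i) => [[b ab h]|_]; [exists b | exists 0].
have [b {}hb] := choice hb.
have fib c : \sum_(i | a i == c) (-1) ^+ op i * w i = 0.
  (* No end point of an interval lies above [c] and at or below [t], so [t] serves as a point just
     after [c]. *)
  have [t ct ht] := above_gap c ([seq a i | i <- enum I] ++ [seq b i | i <- enum I]).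
  have hta i : c < a i -> t < a i by apply: ht; rewrite mem_cat map_f // mem_enum.
  have htb i : c < b i -> t < b i by apply: ht; rewrite mem_cat (map_f b) ?orbT // mem_enum.
  transitivity (\sum_(i | `[< J i c >]) w i - \sum_(i | `[< J i t >]) w i); last by rewrite !hw subrr.
  rewrite big_mkcond [X in _ = X - _]big_mkcond [X in _ = _ - X]big_mkcond -sumrB; apply: eq_bigr => i _.
  have [wi|/negPn/eqP ->] := boolP (w i != 0); last by rewrite mulr0; do 3!case: ifP.
  move: (hJ i wi) (hb i wi); case: (op i) => [_ /(_ isT) [ab Ji]|Ji _].
    have -> : `[< J i c >] = (a i < c < b i) by apply/asboolP/idP => /Ji.
    have -> : `[< J i t >] = (a i < t < b i) by apply/asboolP/idP => /Ji.
    rewrite expr1 mulN1r; case: (ltgtP (a i) c) => h /=.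
    - have -> : a i < t by apply: lt_trans ct.
      have -> : (t < b i) = (c < b i).
        by apply/idP/idP => [/(lt_trans ct)|/htb].
      by rewrite subrr.
    - by rewrite (lt_gtF (hta _ h)) subrr.
    - by rewrite h ct htb -?h // sub0r.
  have -> : `[< J i c >] = (c == a i) by apply/asboolP/eqP => /Ji.
  have -> : `[< J i t >] = (t == a i) by apply/asboolP/eqP => /Ji.
  rewrite expr0 mul1r eq_sym; case: (ltgtP c (a i)) => h.
  - by rewrite (lt_eqF (hta _ h)) subrr.
  - by rewrite gt_eqF ?(lt_trans h) // subrr.
  - by rewrite -h gt_eqF // subr0.
transitivity (\sum_(c <- undup [seq a i | i <- enum I]) \sum_(i | a i == c) (-1) ^+ op i * w i).
  rewrite (exchange_big_dep predT) //=; apply: eq_bigr => i _.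
  rewrite -big_filter (_ : filter _ _ = [:: a i]) ?big_seq1 //.
  rewrite (eq_filter (a2 := pred1 (a i))); last by move=> c; rewrite /= eq_sym.
  by rewrite filter_pred1_uniq ?undup_uniq // mem_undup map_f // mem_enum.
by rewrite big1.
Qed.

Section Euler.
Variable E : vectType R.
Implicit Types (C : E -> Prop) (V W U : {vspace E}).
Local Notation func := 'Hom(E, R^o).

Lemma functional U (x : E) : x \notin U ->
  exists h : func, h x = 1 /\ forall y, y \in U -> h y = 0.
Proof.
move=> xU; pose X := cons_tuple x (vbasis U).
have fX : free X by rewrite /= free_cons (span_basis (vbasisP U)) xU (basis_free (vbasisP U)).
exists (linfun (coord X 0 : E -> R^o)); split.
  by rewrite lfunE /= -[x in coord _ _ x]/(X`_(ord0 : 'I_(\dim U).+1)) coord_free.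
move=> y yU; rewrite lfunE /= (coord_vbasis yU) linear_sum big1 //= => i _.
rewrite linearZ /= -[(vbasis U)`_i]/(X`_(lift ord0 i)) coord_free //.
exact: mulr0.
Qed.

Lemma dim_cap_lker (h : func) U : (\dim (U :&: lker h) + ~~ (U <= lker h)%VS)%N = \dim U.
Proof.
rewrite -(limg_ker_dim h U); congr addn.
have := dimvS (subvf (h @: U)%VS); rewrite dimvf /= => le1.
have -> : (U <= lker h)%VS = (\dim (h @: U) == 0)%N by rewrite lkerE dimv_eq0.
by move: (\dim _) le1 => [|[|k]].
Qed.

(** Non-empty bounded convex sets that are open in an affine subspace with direction [V]; their
    Euler characteristic with compact support is [(-1) ^+ \dim V]. Boundedness is expressed by
    functionals because it is used only for images under functionals. *)
Record ropen C V : Prop := Ropen {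
  ro_ne : exists x, C x;
  ro_dir : forall x y, C x -> C y -> y - x \in V;
  ro_open : forall x v, C x -> v \in V -> exists2 e, 0 < e & forall s, `|s| < e -> C (x + s *: v);
  ro_conv : forall x y t, C x -> C y -> 0 <= t <= 1 -> C (x + t *: (y - x));
  ro_bnd : forall h : func, exists B, forall x, C x -> h x <= B }.

Lemma ropen_slice C V (h : func) t : ropen C V -> (exists2 x, C x & h x = t) ->
  ropen (fun x => C x /\ h x = t) (V :&: lker h)%VS.
Proof.
move=> rC [x0 Cx0 hx0]; split.
- by exists x0.
- move=> x y [Cx hx] [Cy hy]; rewrite memv_cap (ro_dir rC) //= memv_ker linearB /= hx hy subrr //.
- move=> x v [Cx hx]; rewrite memv_cap memv_ker => /andP[vV /eqP hv].
  have [e e0 he] := ro_open rC Cx vV; exists e => // s /he Cs; split => //.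
  by rewrite linearD linearZ /= hv hx scaler0 addr0.
- move=> x y s [Cx hx] [Cy hy] s01; split; first exact: (ro_conv rC).
  by rewrite linearD linearZ linearB /= hx hy subrr scaler0 addr0.
by move=> g; have [B hB] := ro_bnd rC g; exists B => x [/hB].
Qed.

Lemma ropen_image C V (h : func) : ropen C V -> ~~ (V <= lker h)%VS ->
  exists a b : R, a < b /\ forall t : R, (exists2 x, C x & h x = t) <-> a < t < b.
Proof.
move=> rC /subvPn[v vV]; rewrite memv_ker => hv.
pose A : classical_sets.set R := fun t => exists2 x, C x & h x = t.
have [x0 Cx0] := ro_ne rC.
have An : classical_sets.nonempty A by exists (h x0), x0.
have hs : classical_sets.has_sup A.
  by split=> //; have [B hB] := ro_bnd rC h; exists B => _ [x Cx <-]; exact: hB.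
have hi : classical_sets.has_inf A.
  split=> //; have [B hB] := ro_bnd rC (- h)%VF; exists (- B) => _ [x Cx <-].
  by rewrite lerNl; have := hB x Cx; rewrite opp_lfunE.
(* Moving a little along [v] in both directions shows that the infimum and the supremum are not
   attained. *)
have stp t : A t -> exists t1 t2, [/\ A t1, A t2, t1 < t & t < t2].
  move=> [x Cx <-]; have [e e0 he] := ro_open rC Cx vV.
  have A1 s : `|s| < e -> A (h x + s * h v).
    by move=> /he Cs; exists (x + s *: v) => //; rewrite linearD linearZ.
  have e2 : `|e / 2| < e by rewrite gtr0_norm; lra.
  have e2' : `|- (e / 2)| < e by rewrite normrN.
  have := A1 _ e2; have := A1 _ e2'.
  have [hp|hn|h0] := ltgtP (h v) 0; last by rewrite h0 eqxx in hv.
    move=> a1 a2; exists (h x + e / 2 * h v), (h x + - (e / 2) * h v); split=> //.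
      by rewrite gtrDl nmulr_llt0 //; lra.
    by rewrite ltrDl nmulr_lgt0 //; lra.
  move=> a1 a2; exists (h x + - (e / 2) * h v), (h x + e / 2 * h v); split=> //.
    by rewrite gtrDl pmulr_llt0 //; lra.
  by rewrite ltrDl pmulr_lgt0 //; lra.
have lo t : A t -> inf A < t.
  by move=> /stp[t1 [_ [At1 _ lt _]]]; apply: le_lt_trans lt; apply: ge_inf => //; case: hi.
have hi' t : A t -> t < sup A.
  by move=> /stp[_ [t2 [_ At2 _ lt]]]; apply: lt_le_trans lt _; apply: sup_upper_bound.
exists (inf A), (sup A); split.
  by case: An => t At; apply: lt_trans (lo t At) (hi' t At).
move=> t; split=> [At|/andP[t1 t2]]; first by rewrite (lo t) // (hi' t).
have [|y Ay yt] := @inf_adherent _ A (t - inf A) _ hi; first by rewrite subr_gt0.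
have [|z Az tz] := @sup_adherent _ A (sup A - t) _ hs; first by rewrite subr_gt0.
rewrite addrCA subrr addr0 in yt; rewrite opprB addrCA subrr addr0 in tz.
case: Ay yt => x Cx <- yt; case: Az tz => x' Cx' <- tz.
have d0 : 0 < h x' - h x by rewrite subr_gt0; apply: lt_trans tz.
exists (x + ((t - h x) / (h x' - h x)) *: (x' - x)).
  apply: (ro_conv rC) => //; apply/andP; split.
    by rewrite divr_ge0 ?subr_ge0 // ltW // -subr_gt0.
  by rewrite ler_pdivrMr // mul1r lerD2r ltW.
by rewrite linearD linearZ linearB /= -[_ *: _]/(_ * _) divfK ?gt_eqF // addrC subrK.
Qed.

(* Additivity of the Euler characteristic with compact support, by slicing with hyperplanes. *)
Lemma euler_additive (I : finType) (m : I -> int) (C : I -> E -> Prop) (V : I -> {vspace E}) :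
  (forall i, m i != 0 -> ropen (C i) (V i)) ->
  (forall x, \sum_(i | `[< C i x >]) m i = 0) ->
  \sum_i (-1) ^+ \dim (V i) * m i = 0.
Proof.
(* The slices lie in parallel affine hyperplanes, so the induction is on the dimension of an affine
   subspace [x0 + W] that contains all the pieces. *)
suff main n : forall (m : I -> int) (C : I -> E -> Prop) (V : I -> {vspace E}) x0 (W : {vspace E}),
    (\dim W <= n)%N ->
    (forall i, m i != 0 -> [/\ ropen (C i) (V i), (V i <= W)%VS & forall x, C i x -> x - x0 \in W]) ->
    (forall x, \sum_(i | `[< C i x >]) m i = 0) -> \sum_i (-1) ^+ \dim (V i) * m i = 0.
  move=> hC hm; apply: (main _ m C V 0 fullv (leqnn _)) => // i /hC rC.
  by split=> // [|x _]; rewrite ?subvf ?memvf.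
elim: n => [|n IH] {}m {}C {}V x0 W dW hC hm.
  move: dW; rewrite leqn0 dimv_eq0 => /eqP W0.
  rewrite -[RHS](hm x0) [RHS]big_mkcond; apply: eq_bigr => i _.
  have [mi|/negPn/eqP ->] := boolP (m i != 0); last by rewrite mulr0; case: ifP.
  have [rC VW CW] := hC i mi; rewrite W0 in VW CW.
  have -> : V i = 0%VS by apply/eqP; rewrite -subv0.
  rewrite dimv0 expr0 mul1r; case: asboolP => // -[].
  by have [x Cx] := ro_ne rC; have := CW x Cx; rewrite memv0 subr_eq0 => /eqP <-.
have [le|gt] := leqP (\dim W) n; first exact: IH le hC hm.
have W0 : W != 0%VS by rewrite -dimv_eq0; case: (\dim W) gt.
pose w := vpick W.
have w0 : w \notin 0%VS by rewrite memv0 vpick0.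
have wW : w \in W by apply: memv_pick.
have [h [hw _]] := functional w0.
have dW' : (\dim (W :&: lker h) <= n)%N.
  have := dim_cap_lker h W; have -> : (W <= lker h)%VS = false.
    by apply/negP => /subvP /(_ w wW); rewrite memv_ker hw oner_eq0.
  by rewrite addn1 => e; rewrite -ltnS e.
pose J i t := exists2 x, C i x & h x = t.
have ha i : exists a, m i != 0 -> if ~~ (V i <= lker h)%VS then exists2 b, a < b & forall t, J i t <-> a < t < b
                         else forall t, J i t <-> t = a.
  have [mi|mi] := boolP (m i != 0); last by exists 0.
  have [rC VW CW] := hC i mi; case: (boolP (V i <= lker h)%VS) => Vh /=; last first.
    by have [a [b [ab hab]]] := ropen_image rC Vh; exists a => _; exists b.
  have [x1 Cx1] := ro_ne rC; exists (h x1) => _ t.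
  split=> [[x Cx <-]|->]; last by exists x1.
  have := subvP Vh _ (ro_dir rC Cx1 Cx); rewrite memv_ker linearB subr_eq0.
  by move/eqP.
have [a {}ha] := choice ha.
pose w' i := (-1) ^+ \dim (V i :&: lker h)%VS * m i.
have := @euler_line I w' J (fun i => ~~ (V i <= lker h)%VS) a.
have w'0 i : w' i != 0 -> m i != 0 by apply: contraNN => /eqP mi; rewrite /w' mi mulr0.
move=> /(_ (fun i wi => ha i (w'0 i wi))) el.
rewrite -[RHS]el.
  apply: eq_bigr => i _; rewrite /w' mulrA -exprD.
  have [mi|/negPn/eqP ->] := boolP (m i != 0); last by rewrite !mulr0.
  by rewrite addnC dim_cap_lker.
(* Pieces that miss the slice [h = t] get the weight 0, since [ropen] requires non-empty sets. As
   [h w = 1], the base point chosen below lies on the slice. *)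
move=> t; pose mt i := if `[< J i t >] then m i else 0.
have := IH mt (fun i x => C i x /\ h x = t) (fun i => V i :&: lker h)%VS
  (x0 + (t - h x0) *: w) (W :&: lker h)%VS dW'.
rewrite [X in _ -> _ -> _ = X]/(0 : int) => IHt.
rewrite -[RHS]IHt.
- rewrite big_mkcond; apply: eq_bigr => i _; rewrite /mt /w'.
  by case: ifP; rewrite ?mulr0.
- move=> i; rewrite /mt; case: asboolP => // Jt mi.
  have [rC VW CW] := hC i mi; split; first exact: ropen_slice.
    by apply: capvS.
  move=> x [Cx hx]; rewrite memv_cap; apply/andP; split.
    by rewrite opprD addrA memvB ?CW // memvZ.
  rewrite memv_ker linearB linearD linearZ /= hw hx -[_ *: _]/(_ * _) mulr1.
  by rewrite [X in _ - X]addrC subrK subrr.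
move=> x; have [hx|hx] := eqVneq (h x : R) t; last first.
  by rewrite big1 // => i /asboolP[_ e]; rewrite e eqxx in hx.
rewrite -[RHS](hm x) big_mkcond [RHS]big_mkcond; apply: eq_bigr => i _; rewrite /mt.
case: asboolP => [[Cx _]|nC].
  by rewrite !asboolT //; exists x.
by case: asboolP => // Cx; case: nC.
Qed.
End Euler.
End Valuation.

(** * Open simplices of a subdivision and invariance of Euler sums *)

Section Local.
Variable R : realType.

Lemma pos_near (l : seq (R * R)) : (forall p, p \in l -> 0 < p.1) ->
  exists2 e, 0 < e & forall s, `|s| < e -> forall p, p \in l -> 0 < p.1 + s * p.2.
Proof.
elim: l => [|[x y] l IH] h; first by exists 1.
have [e e0 he] := IH (fun p pl => h p (mem_behead (s := (x, y) :: l) pl)).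
have x0 : 0 < x := h (x, y) (mem_head _ _).
have y1 : 0 < 1 + `|y| by rewrite ltr_pwDl.
exists (Num.min e (x / (1 + `|y|))); first by rewrite lt_min e0 divr_gt0.
move=> s; rewrite lt_min => /andP[se sx] p; rewrite inE => /orP[/eqP ->|]; last exact: he.
have sy : `|s * y| < x.
  rewrite normrM; rewrite ltr_pdivlMr // in sx; apply: le_lt_trans sx.
  by rewrite ler_wpM2l // lerDr.
by have := ler_norm (- (s * y)); rewrite normrN /=; lra.
Qed.

Definition dirac (T : finType) (v : T) : {ffun T -> R} := [ffun w => (w == v)%:R].
Definition bary (T : finType) (s : {set T}) : {ffun T -> R} := [ffun v => if v \in s then #|s|%:R^-1 else 0].

Lemma prob_dirac (T : finType) (v : T) : prob (dirac v).
Proof.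
apply/probP; split=> [w|]; first by rewrite ffunE; case: eqP.
by rewrite (bigD1 v) //= ffunE eqxx big1 ?addr0 // => w /negbTE wv; rewrite ffunE wv.
Qed.
Lemma supp_dirac (T : finType) (v : T) : supp (dirac v) = [set v].
Proof. by apply/setP => w; rewrite !inE ffunE; case: (w == v); rewrite ?oner_eq0 ?eqxx. Qed.

Lemma supp_bary (T : finType) (s : {set T}) : supp (bary s) = s.
Proof.
apply/setP => v; rewrite inE ffunE; case: ifP => [vs|]; last by rewrite eqxx.
by rewrite invr_eq0 pnatr_eq0 -lt0n card_gt0; apply/set0Pn; exists v.
Qed.
Lemma prob_bary (T : finType) (s : {set T}) : s != set0 -> prob (bary s).
Proof.
move=> s0; apply/probP; split=> [v|]; first by rewrite ffunE; case: ifP; rewrite ?invr_ge0.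
under eq_bigr do rewrite ffunE; rewrite -big_mkcond sumr_const -[LHS]mulr_natr mulVf //.
by rewrite pnatr_eq0 -lt0n card_gt0.
Qed.

Definition mix (T : finType) (t : R) (x y : {ffun T -> R}) : {ffun T -> R} := [ffun v => x v + t * (y v - x v)].

Lemma prob_mix (T : finType) t (x y : {ffun T -> R}) : 0 <= t <= 1 -> prob x -> prob y -> prob (mix t x y).
Proof.
move=> /andP[t0 t1] /probP[x0 x1] /probP[y0 y1]; apply/probP; split=> [v|].
  rewrite ffunE (_ : _ + _ = (1 - t) * x v + t * y v); last by lra.
  by rewrite addr_ge0 ?mulr_ge0 // subr_ge0.
under eq_bigr do rewrite ffunE; rewrite big_split /= -mulr_sumr sumrB x1 y1.
by rewrite subrr mulr0 addr0.
Qed.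

Lemma supp_mix (T : finType) t (x y : {ffun T -> R}) : 0 < t < 1 -> prob x -> prob y ->
  supp (mix t x y) = supp x :|: supp y.
Proof.
move=> /andP[t0 t1] /probP[x0 _] /probP[y0 _]; apply/setP => v; rewrite !inE ffunE.
rewrite (_ : _ + _ = (1 - t) * x v + t * y v); last by lra.
have u0 : 0 < 1 - t by rewrite subr_gt0.
have h1 : 0 <= (1 - t) * x v by rewrite mulr_ge0 // ltW.
have h2 : 0 <= t * y v by rewrite mulr_ge0 // ltW.
by rewrite (paddr_eq0 h1 h2) !mulf_eq0 (gt_eqF u0) (gt_eqF t0) negb_and.
Qed.

Lemma mix_lt0 (t x y : R) : 0 <= t <= 1 -> x < 0 -> y < 0 -> x + t * (y - x) < 0.
Proof.
move=> /andP[t0 t1] x0 y0; have [xy|yx] := lerP x y.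
  have h : t * (y - x) <= y - x by rewrite ler_piMl // subr_ge0.
  by lra.
have h : 0 <= t * (x - y) by rewrite mulr_ge0 // subr_ge0 ltW.
by lra.
Qed.

Definition total (T : finType) (x : {ffun T -> R^o}) : R^o := \sum_v x v.
Fact total_is_linear (T : finType) : linear (@total T).
Proof.
move=> a x y; rewrite /total scaler_sumr -big_split; apply: eq_bigr => v _.
by rewrite !ffunE.
Qed.
HB.instance Definition _ (T : finType) :=
  GRing.isLinear.Build R {ffun T -> R^o} R^o *:%R (@total T) (@total_is_linear T).

Section Fix.
Variables (U T : finType) (K' : {set {set U}}) (K : {set {set T}}) (b : U -> {ffun T -> R}).
Hypotheses (sK' : simplicial_complex K') (sK : simplicial_complex K) (hb : asub K' K b).
Implicit Types (s : {set U}) (d : {ffun U -> R}).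
Local Notation E := ({ffun T -> R^o}).
Local Notation func := 'Hom(E, R^o).

Lemma push_lin (h : func) d : h (push b d : E) = \sum_u d u * h (b u : E) :> R.
Proof.
have -> : push b d = \sum_u (d u : R) *: (b u : E).
  apply/ffunP => v; rewrite ffunE sum_ffunE; apply: eq_bigr => u _.
  by rewrite ffunE.
by rewrite linear_sum; apply: eq_bigr => u _; rewrite linearZ.
Qed.

Lemma push_mix t d d' : push b (mix t d d') = mix t (push b d) (push b d').
Proof.
apply/ffunP => v; rewrite !ffunE -sumrB mulr_sumr -big_split; apply: eq_bigr => u _ /=.
by rewrite !ffunE; lra.
Qed.

Lemma mix_lin (h : func) t (x y : {ffun T -> R}) :
  h (mix t x y : E) = h (x : E) + t * (h (y : E) - h (x : E)) :> R.
Proof.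
have -> : mix t x y = (x : E) + (t : R) *: ((y : E) - (x : E)).
  by apply/ffunP => v; rewrite !ffunE.
by rewrite linearD linearZ linearB.
Qed.

Lemma asub_prob s u : s \in K' -> u \in s -> prob (b u).
Proof. by move=> sinK us; have [t _ h] := as_face hb sinK; case: (h u us). Qed.

(** Affine independence becomes linear independence because all [b u] have coordinate sum 1. This
    allows linear spans to stand in for affine hulls. *)
Lemma asub_indep s (c : U -> R) : s \in K' ->
  (forall v, \sum_(u in s) c u * b u v = 0) -> forall u, u \in s -> c u = 0.
Proof.
move=> sinK h; have [ind _] : geometric_realization (fun u => ev (@stdpt R T) (b u)) K'.
  by apply: inj_real => // x y xK yK; rewrite -!ev_push => /std_inj; exact: (as_inj hb).
apply: (ind s sinK c).
  have : \sum_v \sum_(u in s) c u * b u v = 0 by apply: big1.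
  rewrite exchange_big /= => e; rewrite -[RHS]e; apply: eq_bigr => u us; rewrite -mulr_sumr.
  by have /probP[_ ->] := asub_prob sinK us; rewrite mulr1.
apply/rowP => j; rewrite mxE summxE -[RHS](h (enum_val j)); apply: eq_bigr => u us.
by rewrite mxE -{1}(enum_valK j) ev_std.
Qed.

Definition vspan (s : {set U}) : {vspace E} := (\sum_(u in s) <[b u : E]>)%VS.

Lemma mem_vspan s u : u \in s -> (b u : E) \in vspan s.
Proof. by move=> us; apply: (subvP (sumv_sup u us (subvv _))); apply: memv_line. Qed.

Lemma vspanP s (x : E) : x \in vspan s ->
  exists c : U -> R, x = [ffun v => \sum_(u in s) c u * b u v].
Proof.
case/memv_sumP => y hy ->.
have /choice[c hc] : forall u, exists k : R, u \in s -> y u = k *: (b u : E).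
  move=> u; have [us|us] := boolP (u \in s); last by exists 0.
  by have /vlineP[k ->] := hy u us; exists k.
exists c; apply/ffunP => v; rewrite sum_ffunE ffunE; apply: eq_bigr => u us.
by rewrite hc // ffunE.
Qed.

Lemma vspan_push s d : supp d \subset s -> (push b d : E) \in vspan s.
Proof.
move=> ds; have -> : push b d = \sum_(u in s) (d u : R) *: (b u : E).
  apply/ffunP => v; rewrite ffunE sum_ffunE (@sum_supp _ _ _ d s) //; last by move=> u ->; rewrite mul0r.
  by apply: eq_bigr => u _; rewrite ffunE.
by apply: rpred_sum => u us; apply: rpredZ; apply: mem_vspan.
Qed.

Lemma dim_vspan s : s \in K' -> \dim (vspan s) = #|s|.
Proof.
move=> sinK; have bn u : u \in s -> (b u : E) != 0.
  move=> us; apply/eqP => b0; have /probP[_] := asub_prob sinK us.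
  by rewrite big1 => [/eqP|v _]; rewrite ?b0 ?ffunE // eq_sym oner_eq0.
have dir : directv (\sum_(u in s) <[b u : E]>)%VS.
  apply/directv_sum_independent => y hy y0 u us.
  have /choice[c hc] : forall u, exists k : R, u \in s -> y u = k *: (b u : E).
    move=> w; have [ws|ws] := boolP (w \in s); last by exists 0.
    by have /vlineP[k ->] := hy w ws; exists k.
  rewrite hc // (asub_indep sinK (c := c)) ?scale0r // => v.
  move/ffunP/(_ v): y0; rewrite sum_ffunE ffunE => y0; rewrite -[RHS]y0.
  by apply: eq_bigr => w ws; rewrite hc // ffunE.
rewrite (directvP dir) /= -sum1_card; apply: eq_bigr => u us.
by rewrite dim_vline bn.
Qed.

Lemma coef_functional s u : s \in K' -> u \in s ->
  exists h : func, h (b u : E) = 1 /\ forall w, w \in s -> w != u -> h (b w : E) = 0.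
Proof.
move=> sinK us; have : (b u : E) \notin vspan (s :\ u).
  apply/negP => /vspanP[c ec].
  have := asub_indep sinK (c := fun w => if w == u then -1 else c w) _ us.
  rewrite eqxx => h; suff /eqP : -1 = 0 :> R by rewrite oppr_eq0 oner_eq0.
  apply: h => v; rewrite (bigD1 u) //= eqxx mulN1r {1}ec ffunE addrC.
  apply/eqP; rewrite subr_eq0; apply/eqP; apply: eq_big => [w|w /andP[_ /negbTE ->] //].
  by rewrite !inE andbC.
case/functional => h [h1 h0]; exists h; split=> // w ws wu; apply: h0.
by apply: mem_vspan; rewrite !inE wu.
Qed.

(** Outside the span of [s], minus a functional that vanishes on [s] and is 1 at the point will do.
    Inside the span, it is the functional of a negative coefficient; if no coefficient is negative,
    the point lies in the simplex [s], and uniqueness of coordinates puts the support of [d] into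
    [s]. *)
Lemma separation d s : pts K' d -> s \in K' -> ~~ (supp d \subset s) ->
  exists g : func, g (push b d : E) < 0 /\ forall u, u \in s -> 0 <= (g (b u : E) : R).
Proof.
move=> dK sinK ds; set x := push b d.
have [|xs] := boolP ((x : E) \in vspan s); last first.
  have [h [h1 h0]] := functional xs; exists (- h)%VF; rewrite opp_lfunE h1; split; first by rewrite oppr_lt0 ltr01.
  by move=> u us; rewrite opp_lfunE h0 ?oppr0 // mem_vspan.
move=> /vspanP[c ec].
have c1 : \sum_(u in s) c u = 1.
  have [px _] := andP (push_pts sK hb dK); have /probP[_ x1] := px.
  rewrite -x1 -/x ec; under [RHS]eq_bigr do rewrite ffunE.
  rewrite exchange_big; apply: eq_bigr => u us; rewrite -mulr_sumr.
  by have /probP[_ ->] := asub_prob sinK us; rewrite mulr1.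
have [/existsP[u /andP[us cu]]|] := boolP [exists u, (u \in s) && (c u < 0)].
  have [h [h1 h0]] := coef_functional sinK us; exists h; split; last first.
    by move=> w ws; have [->|wu] := eqVneq w u; rewrite ?h1 ?h0.
  have -> : (x : E) = \sum_(w in s) (c w : R) *: (b w : E).
    by rewrite ec; apply/ffunP => v; rewrite ffunE sum_ffunE; apply: eq_bigr => w _; rewrite ffunE.
  rewrite linear_sum (bigD1 u) //= big1 ?addr0; last first.
    by move=> w /andP[ws wu]; rewrite linearZ /= h0 // scaler0.
  by rewrite linearZ /= h1 -[_ *: _]/(_ * _) mulr1.
rewrite negb_exists => /forallP cp; case/negP: ds.
have c0 u : u \in s -> 0 <= c u by move=> us; have := cp u; rewrite us -leNgt.
pose e : {ffun U -> R} := [ffun u => if u \in s then c u else 0].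
have es : supp e \subset s by apply/subsetP => u; rewrite inE ffunE; case: ifP; rewrite ?eqxx.
have pe : prob e.
  apply/probP; split=> [u|]; first by rewrite ffunE; case: ifP => // /c0.
  by under eq_bigr do rewrite ffunE; rewrite -big_mkcond.
suff -> : d = e by [].
apply: (as_inj hb) => //; first exact: (pts_sub sK' sinK).
rewrite -/x ec; apply/ffunP => v; rewrite !ffunE [RHS](@sum_supp _ _ _ e s) //.
  by apply: eq_bigr => u us; rewrite ffunE us.
by move=> u ->; rewrite mul0r.
Qed.

(* [inQ G] is an open convex cone, and [face s G] its part in the open simplex [s]. *)
Definition inQ (G : seq func) (x : {ffun T -> R}) := forall g, g \in G -> (g (x : E) : R) < 0.

Definition face (s : {set U}) (G : seq func) (x : E) :=
  exists d, [/\ prob d, supp d = s, push b d = x & inQ G x].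

Definition sumf : func := linfun (@total T).

Definition hit (s : {set U}) (G : seq func) := `[< exists x, face s G x >].

Lemma near_inQ (G : seq func) (x y : E) : inQ G x ->
  exists2 e, 0 < e & forall t, `|t| < e -> inQ G (x + t *: y).
Proof.
move=> xQ; have [|e e0 he] := @pos_near [seq (- (g x : R), - (g y : R)) | g : func <- G].
  by move=> p /mapP[g gG ->] /=; rewrite oppr_gt0; apply: xQ.
exists e => // t te g gG; have := he t te _ (map_f _ gG); rewrite /= linearD linearZ /=.
by rewrite mulrN -opprD oppr_gt0.
Qed.

Lemma sumfE (x : E) : sumf x = \sum_v (x v : R).
Proof.
by rewrite /sumf lfunE.
Qed.

(** Points of the simplex have coordinate sum 1, so differences of them have sum 0: this is the
    direction space of its affine hull. *)
Definition dir (s : {set U}) : {vspace E} := (vspan s :&: lker sumf)%VS.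

Lemma dim_dir s : s \in K' -> (\dim (dir s)).+1 = #|s|.
Proof.
move=> sinK; rewrite -(dim_vspan sinK) -(dim_cap_lker sumf (vspan s)) -/(dir s).
suff -> : (vspan s <= lker sumf)%VS = false by rewrite addn1.
have /set0Pn[u us] : s != set0 by case: sK' => + _; apply: contra => /eqP <-.
apply/negP => /subvP /(_ _ (mem_vspan us)); rewrite memv_ker sumfE.
by have /probP[_ ->] := asub_prob sinK us; rewrite oner_eq0.
Qed.

Lemma prob_le1 (I : finType) (d : {ffun I -> R}) i : prob d -> d i <= 1.
Proof.
case/probP => d0 <-; rewrite (bigD1 i) //= lerDl; apply: sumr_ge0 => j _; exact: d0.
Qed.

Lemma ropen_face s G : s \in K' -> hit s G -> ropen (face s G) (dir s).
Proof.
move=> sinK /asboolP hs; split => //.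
- move=> _ _ [d [pd ds <- _]] [d' [pd' ds' <- _]]; rewrite memv_cap; apply/andP; split.
    by rewrite memvB // vspan_push // ?ds ?ds'.
  rewrite memv_ker linearB /= !sumfE.
  have h e : prob e -> supp e = s -> \sum_v push b e v = 1.
    move=> pe es; suff /probP[] : prob (push b e) by [].
    by apply: push_prob pe (subxx _) _ => u; rewrite es; apply: asub_prob.
  by rewrite !h // subrr.
- move=> _ v [d [pd ds <- dQ]]; rewrite memv_cap memv_ker sumfE => /andP[/vspanP[c ec] /eqP c0].
  have {}c0 : \sum_(u in s) c u = 0.
    rewrite -[RHS]c0 ec; under [RHS]eq_bigr do rewrite ffunE.
    rewrite exchange_big; apply: eq_bigr => u us; rewrite -mulr_sumr.
    by have /probP[_ ->] := asub_prob sinK us; rewrite mulr1.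
  have [e1 e10 h1] := near_inQ v dQ.
  have [p0 p1] := probP _ pd.
  have [|e2 e20 h2] := @pos_near [seq (d u, c u) | u <- enum s].
    move=> p /mapP[u]; rewrite mem_enum => us -> /=.
    by rewrite lt_neqAle p0 eq_sym andbT; move: us; rewrite -ds inE.
  exists (Num.min e1 e2); first by rewrite lt_min e10.
  move=> t; rewrite lt_min => /andP[t1 t2].
  pose d' : {ffun U -> R} := [ffun u => if u \in s then d u + t * c u else 0].
  have d'p u : u \in s -> 0 < d u + t * c u.
    by move=> us; apply: (h2 t t2 (d u, c u)); apply: map_f; rewrite mem_enum.
  have ds' : supp d' = s.
    apply/setP => u; rewrite inE ffunE; case: ifP => [us|]; last by rewrite eqxx.
    by rewrite gt_eqF ?d'p.
  have e : push b d' = (push b d : E) + t *: v.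
    apply/ffunP => w; rewrite !ffunE (@sum_supp _ _ _ d' s) ?ds' //; last by move=> u ->; rewrite mul0r.
    rewrite (@sum_supp _ _ _ d s) ?ds //; last by move=> u ->; rewrite mul0r.
    rewrite ec ffunE -[_ *: _]/(_ * _) mulr_sumr -big_split; apply: eq_bigr => u us /=.
    by rewrite ffunE us mulrDl mulrA.
  exists d'; split => //; last exact: h1 t t1.
  apply/probP; split=> [u|]; first by rewrite ffunE; case: ifP => // us; apply: ltW; apply: d'p.
  under eq_bigr do rewrite ffunE.
  rewrite -big_mkcond big_split /= -mulr_sumr c0 mulr0 addr0 -p1.
  by symmetry; apply: (@sum_supp _ _ _ d) => //; rewrite ds.
- move=> _ _ t [d [pd ds <- dQ]] [d' [pd' ds' <- dQ']] t01.
  exists (mix t d d'); split.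
  + exact: prob_mix.
  + have [p0 _] := probP _ pd; have [p0' _] := probP _ pd'.
    apply/setP => u; rewrite inE ffunE; have := p0 u; have := p0' u.
    have [us|us] := boolP (u \in s).
      have : d u != 0 by move: us; rewrite -ds inE.
      have : d' u != 0 by move: us; rewrite -ds' inE.
      move=> n1 n2 g1 g2; rewrite gt_eqF //.
      have {g1 n1}g1 : 0 < d' u by rewrite lt_neqAle eq_sym n1.
      have {g2 n2}g2 : 0 < d u by rewrite lt_neqAle eq_sym n2.
      case/andP: t01 => t0 t1; have [t12|t12] := lerP t (1/2).
        by have := mulr_ge0 t0 (ltW g1); nra.
      by have := mulr_gt0 (_ : 0 < t) g1; nra.
    by rewrite (@supp0 _ _ d u s) ?ds // (@supp0 _ _ d' u s) ?ds' // subrr mulr0 addr0 eqxx.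
  + rewrite push_mix; apply/ffunP => v; rewrite !ffunE //.
  move=> g gG; rewrite linearD linearZ linearB /=.
  exact: mix_lt0 t01 (dQ g gG) (dQ' g gG).
move=> h; exists (\sum_u `|h (b u : E) : R|) => _ [d [pd ds <- _]].
rewrite push_lin; apply: ler_sum => u _; have [p0 _] := probP _ pd.
apply: le_trans (ler_norm _) _; rewrite normrM ler_piMl // ger0_norm //.
exact: prob_le1.
Qed.
End Fix.

Section EulerInv.
Variables (U T : finType) (K' : {set {set U}}) (K : {set {set T}}) (b : U -> {ffun T -> R}).
Hypotheses (sK' : simplicial_complex K') (sK : simplicial_complex K) (hb : asub K' K b).
Local Notation E := ({ffun T -> R^o}).
Local Notation func := 'Hom(E, R^o).

Lemma push_dirac (d : {ffun T -> R}) : push (@dirac T) d = d.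
Proof.
apply/ffunP => v; rewrite ffunE (bigD1 v) //= ffunE eqxx mulr1 big1 ?addr0 // => w wv.
by rewrite ffunE eq_sym (negbTE wv) mulr0.
Qed.

Lemma asub_id : asub K K (@dirac T).
Proof.
split=> [s sinK|d d' _ _|x xK]; rewrite ?push_dirac //; last by exists x; rewrite ?push_dirac.
by exists s => // u us; rewrite prob_dirac supp_dirac sub1set.
Qed.

(** Each point of the carrier inside the cone lies in exactly one open simplex of [K'] and in
    exactly one of [K]. With the weight 1 for the former and -1 for the latter the total weight
    vanishes everywhere, and [euler_additive] applies. *)
Lemma euler_inv (G : seq func) :
  \sum_(s in K' | hit b s G) (-1) ^+ #|s| = \sum_(s in K | hit (@dirac T) s G) (-1) ^+ #|s| :> int.
Proof.
pose C (i : {set U} + {set T}) := match i with inl s => face b s G | inr s => face (@dirac T) s G end.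
pose V (i : {set U} + {set T}) := match i with inl s => dir b s | inr s => dir (@dirac T) s end.
pose m (i : {set U} + {set T}) : int := match i with
  inl s => (if (s \in K') && hit b s G then 1 else 0) | inr s => - (if (s \in K) && hit (@dirac T) s G then 1 else 0) end.
have := @euler_additive R E _ m C V.
have h1 i : m i != 0 -> ropen (C i) (V i).
  case: i => s /=; case: ifP => [/andP[sin hs] _|_]; rewrite ?oppr0 ?eqxx //.
    exact: (ropen_face hb).
  exact: (ropen_face asub_id).
move=> /(_ h1) h; apply/eqP; rewrite -subr_eq0; apply/eqP.
transitivity (- \sum_i (-1) ^+ \dim (V i) * m i); last first.
  rewrite h ?oppr0 // => x; rewrite big_mkcond big_sumType /=.
  have [[xK xQ]|nx] := pselect (pts K x /\ inQ G x); last first.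
    rewrite !big1 ?addr0 // => s _; case: asboolP => // -[d [pd ds ed dQ]]; case: ifP => // /andP[sin _].
      case: nx; split=> //; rewrite -ed push_dirac /pts pd ds sin //.
    case: nx; split=> //; rewrite -ed; apply: (push_pts sK hb); by rewrite /pts pd ds.
  have [d dK ed] := as_surj hb xK; have [pd dsK] := andP dK; have [px xs] := andP xK.
  have fd : face b (supp d) G x by exists d.
  have fx : face (@dirac T) (supp x) G x by exists x; rewrite push_dirac.
  rewrite (bigD1 (supp d)) //= asboolT // dsK (_ : hit _ _ _); last by apply/asboolP; exists x.
  rewrite big1 ?addr0; last first.
    move=> s sd; case: asboolP => // -[d' [pd' ds' ed' _]]; case: ifP => // /andP[sin _].
    case/eqP: sd; rewrite -ds'; congr supp; apply: (as_inj hb) => //; last by rewrite ed.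
    by rewrite /pts pd' ds'.
  rewrite (bigD1 (supp x)) //= asboolT // xs (_ : hit _ _ _); last by apply/asboolP; exists x.
  rewrite big1 ?addr0 ?subrr // => s sx; case: asboolP => // -[d' [pd' ds' ed' _]].
  by case/eqP: sx; rewrite -ds' -ed' push_dirac.
rewrite big_sumType /= opprD; congr (_ + _).
  rewrite -sumrN big_mkcond; apply: eq_bigr => s _.
  case: ifP => [/andP[sin _]|_]; last by rewrite mulr0 oppr0.
  by rewrite mulr1 -(dim_dir sK' hb sin) exprS mulN1r.
congr (- _); rewrite big_mkcond; apply: eq_bigr => s _.
case: ifP => [/andP[sin _]|_]; last by rewrite oppr0 mulr0.
by rewrite mulrN mulr1 -(dim_dir sK asub_id sin) exprS mulN1r.
Qed.

Lemma euler_global : \sum_(s in K') (-1) ^+ #|s| = \sum_(s in K) (-1) ^+ #|s| :> int.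
Proof.
have := euler_inv [::].
have h (W : finType) (L : {set {set W}}) (c : W -> {ffun T -> R}) : simplicial_complex L ->
    \sum_(s in L | hit c s [::]) (-1) ^+ #|s| = \sum_(s in L) (-1) ^+ #|s| :> int.
  move=> [L0 _]; apply: eq_bigl => s; apply: andb_idr => sL.
  have s0 : s != set0 by apply: contra L0 => /eqP <-.
  apply/asboolP; exists (push c (bary s)), (bary s); split=> //; [exact: prob_bary|exact: supp_bary].
by rewrite !h.
Qed.

Section AtPoint.
Variable d : {ffun U -> R}.
Hypothesis dK : pts K' d.
Local Notation x := (push b d).

(* A neighbourhood of [x] that meets only the open simplices with [x] in their closure. *)
Lemma nbhd_exists : exists G : seq func, inQ G x /\
  (forall s, s \in K' -> hit b s G = (supp d \subset s)) /\
  (forall s, s \in K -> hit (@dirac T) s G = (supp x \subset s)).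
Proof.
have xK := push_pts sK hb dK.
have /choice[g hg] : forall s, exists g : func, s \in K' -> ~~ (supp d \subset s) ->
    g (x : E) < 0 /\ forall u, u \in s -> 0 <= (g (b u : E) : R).
  move=> s; have [sin|] := boolP (s \in K'); last by exists 0.
  have [|h] := boolP (supp d \subset s); first by exists 0.
  by have [g hg] := separation sK' sK hb dK sin h; exists g.
have /choice[f hf] : forall s, exists g : func, s \in K -> ~~ (supp x \subset s) ->
    g (x : E) < 0 /\ forall u, u \in s -> 0 <= (g (@dirac T u : E) : R).
  move=> s; have [sin|] := boolP (s \in K); last by exists 0.
  have [|h] := boolP (supp x \subset s); first by exists 0.
  have := separation sK sK asub_id xK sin h; rewrite push_dirac => -[g' hg']; by exists g'.
(* One separating functional for each face of either complex whose closed simplex misses [x]. *)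
pose G := [seq g s | s <- enum [pred s in K' | ~~ (supp d \subset s)]] ++
          [seq f s | s <- enum [pred s in K | ~~ (supp x \subset s)]].
have xQ : inQ G x.
  move=> h; rewrite mem_cat => /orP[] /mapP[s]; rewrite mem_enum inE => /andP[sin ns] ->.
    by case: (hg s sin ns).
  by case: (hf s sin ns).
have gen (W : finType) (L : {set {set W}}) (c : W -> {ffun T -> R}) (e : {ffun W -> R}) s (h : func) :
    simplicial_complex L -> pts L e -> push c e = x -> s \in L ->
    (~~ (supp e \subset s) -> h \in G /\ forall u, u \in s -> 0 <= (h (c u : E) : R)) ->
    hit c s G = (supp e \subset s).
  move=> sL /andP[pe eL] ex sin hh; have s0 : s != set0 by case: sL => + _; apply: contra => /eqP <-.
  have [es|nes] := boolP (supp e \subset s); apply/asboolP; last first.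
    case=> _ [e' [pe' es' <- e'Q]]; have [hG hp] := hh nes.
    have := e'Q h hG; rewrite push_lin ltNge => /negP; apply; apply: sumr_ge0 => u _.
    have [us|us] := boolP (u \in s); last by rewrite (@supp0 _ _ e' u s) ?es' // mul0r.
    by rewrite mulr_ge0 ?hp //; case/probP: pe'.
  have [r r0 hr] := near_inQ ((push c (bary s) : E) - (push c e : E)) (G := G) (x := push c e : E)
    (eq_rect _ (inQ G) xQ _ (esym ex)).
  pose t := Num.min (1/2) (r/2).
  have t0 : 0 < t by rewrite lt_min; apply/andP; split; lra.
  have t1 : t < 1 by rewrite gt_min; apply/orP; left; lra.
  have tr : `|t| < r by rewrite gtr0_norm // gt_min; apply/orP; right; lra.
  exists (push c (mix t e (bary s))), (mix t e (bary s)); split=> //.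
  - by apply: prob_mix; rewrite ?prob_bary // !ltW.
  - by rewrite supp_mix ?t0 ?prob_bary // supp_bary; apply/setUidPr.
  have -> : push c (mix t e (bary s)) = (push c e : E) + t *: ((push c (bary s) : E) - (push c e : E)).
    by rewrite push_mix; apply/ffunP => v; rewrite !ffunE.
  exact: hr.
exists G; split=> //; split=> s sin.
  apply: (gen _ K' b d s (g s)) => // ns; split; last by case: (hg s sin ns).
  by rewrite mem_cat map_f // mem_enum inE sin.
apply: (gen _ K _ x s (f s)) => //; first by rewrite push_dirac.
move=> ns; split; last by case: (hf s sin ns).
by rewrite mem_cat (map_f f) ?orbT // mem_enum inE sin.
Qed.

Lemma euler_local : \sum_(s in K' | supp d \subset s) (-1) ^+ #|s| =
  \sum_(s in K | supp x \subset s) (-1) ^+ #|s| :> int.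
Proof.
have [G [_ [h1 h2]]] := nbhd_exists; have := euler_inv G.
rewrite (eq_bigl (fun s => (s \in K') && (supp d \subset s))); last first.
  by move=> s; case: (boolP (s \in K')) => //= /h1.
move=> ->; apply: eq_bigl => s; by case: (boolP (s \in K)) => //= /h2.
Qed.
End AtPoint.
End EulerInv.
End Local.

(** * Generic points and connectedness of segments *)

Section Generic.
Variable R : realType.

Lemma poly_nonroot (p : {poly R}) : p != 0 -> exists2 t : R, 0 < t & p.[t] != 0.
Proof.
move=> p0; have [/hasP[t tr pt]|/hasPn h] := boolP (has (fun t => p.[t] != 0) [seq (n.+1)%:R : R | n <- iota 0 (size p)]).
  by exists t => //; case/mapP: tr => n _ ->; rewrite ltr0n.
have := max_poly_roots p0 (rs := [seq (n.+1)%:R : R | n <- iota 0 (size p)]).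
rewrite size_map size_iota ltnn => h2; suff: false by []; apply: h2.
  by apply/allP => t /h; rewrite negbK.
by rewrite map_inj_uniq ?iota_uniq // => m n /eqP; rewrite eqr_nat => /eqP [->].
Qed.

(* The point is taken on the moment curve. *)
Lemma generic_point (U : finType) (s : {set U}) (F : seq {ffun U -> R}) : s != set0 ->
  (forall c, c \in F -> exists2 u, u \in s & c u != 0) ->
  exists d : {ffun U -> R}, [/\ prob d, supp d = s & forall c, c \in F -> \sum_u d u * c u != 0].
Proof.
move=> s0 hF; pose p (c : {ffun U -> R}) : {poly R} := \sum_(u in s) c u *: 'X^(enum_rank u).
have pn c : c \in F -> p c != 0.
  move=> /hF[u us cu]; apply: contraNneq cu => pc.
  have : (p c)`_(enum_rank u) = c u.
    rewrite coef_sum (bigD1 u) //= coefZ coefXn eqxx mulr1 big1 ?addr0 // => w /andP[_ wu].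
    rewrite coefZ coefXn (_ : _ == _ = false) ?mulr0 //.
    by apply: contra_neqF wu => /eqP/val_inj/enum_rank_inj.
  by rewrite pc coef0 => <-.
have [|t t0 ht] := @poly_nonroot (\prod_(c <- F) p c).
  by rewrite prodf_seq_neq0; apply/allP => c /pn.
pose S : R := \sum_(u in s) t ^+ enum_rank u.
have S0 : 0 < S.
  have /set0Pn[u us] := s0; rewrite /S (bigD1 u) //= ltr_wpDr ?exprn_gt0 //.
  by apply: sumr_ge0 => w _; rewrite ltW // exprn_gt0.
exists [ffun u => if u \in s then t ^+ enum_rank u / S else 0]; split.
- apply/probP; split=> [u|]; first by rewrite ffunE; case: ifP => // _; rewrite divr_ge0 ?ltW ?exprn_gt0.
  under eq_bigr do rewrite ffunE; rewrite -big_mkcond -mulr_suml mulfV //.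
  by rewrite gt_eqF.
- apply/setP => u; rewrite inE ffunE; case: ifP => [_|]; last by rewrite eqxx.
  by rewrite gt_eqF // divr_gt0 // exprn_gt0.
move=> c cF; have pc : (p c).[t] != 0.
  by move: ht; rewrite horner_prod prodf_seq_neq0 => /allP /(_ c cF).
apply: contra pc => /eqP e; rewrite /p horner_sum.
suff -> : \sum_(u in s) (c u *: 'X^(enum_rank u)).[t] =
  (\sum_u [ffun u => if u \in s then t ^+ enum_rank u / S else 0] u * c u) * S by rewrite e mul0r.
rewrite mulr_suml [LHS]big_mkcond; apply: eq_bigr => u _; rewrite ffunE.
case: ifP; rewrite ?mul0r // hornerZ hornerXn => _.
by rewrite mulrAC divfK ?gt_eqF // mulrC.
Qed.

Lemma segment_connected (P : R -> Prop) :
  (forall t, 0 <= t <= 1 -> P t -> exists2 e, 0 < e & forall t', 0 <= t' <= 1 -> `|t' - t| < e -> P t') ->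
  (forall t, 0 <= t <= 1 -> ~ P t -> exists2 e, 0 < e & forall t', 0 <= t' <= 1 -> `|t' - t| < e -> ~ P t') ->
  P 0 -> P 1.
Proof.
move=> hP hN P0.
pose A : classical_sets.set R := fun t => (0 <= t <= 1) /\ P t.
have A0 : A 0 by split=> //; rewrite lexx ler01.
have sA : classical_sets.has_sup A by split; [exists 0|exists 1 => t [/andP[]]].
have s01 : 0 <= sup A <= 1.
  apply/andP; split; first exact: sup_upper_bound.
  by apply: sup_le_ub; [exists 0|move=> t [/andP[]]].
have Ps : P (sup A).
  have [//|nP] := pselect (P (sup A)); have [e e0 he] := hN _ s01 nP.
  have [t [t01 Pt] et] := sup_adherent e0 sA.
  exfalso; apply: (he t t01) => //; have := sup_upper_bound sA (conj t01 Pt) => ts.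
  by rewrite ler0_norm ?subr_le0 //; lra.
have [e e0 he] := hP _ s01 Ps; have [s1|s1] := eqVneq (sup A) 1; first by rewrite -s1.
have s1' : sup A < 1 by case/andP: s01 => _; rewrite le_eqVlt (negbTE s1).
pose t := Num.min 1 (sup A + e / 2).
have t1 : t <= 1 by rewrite ge_min lexx.
have st : sup A < t by rewrite lt_min s1' /=; lra.
have t2 : t <= sup A + e / 2 by rewrite ge_min lexx orbT.
have t01 : 0 <= t <= 1 by case/andP: s01 => s0 _; rewrite t1 andbT; lra.
have At : A t by split=> //; apply: he => //; rewrite gtr0_norm ?subr_gt0 //; lra.
by have := sup_upper_bound sA At; rewrite leNgt st.
Qed.
End Generic.

(** * Comparison of the faces of a complex and of its subdivision *)

Section Faces.
Variable R : realType.
Section OneSub.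
Variables (U T : finType) (K' : {set {set U}}) (K : {set {set T}}) (b : U -> {ffun T -> R}).
Hypotheses (sK' : simplicial_complex K') (sK : simplicial_complex K) (hb : asub K' K b).
Local Notation E := ({ffun T -> R^o}).
Local Notation func := 'Hom(E, R^o).
Implicit Types (s : {set U}) (t : {set T}).
Let hid := @asub_id R T K.

Lemma face_neq0 (W : finType) (L : {set {set W}}) (s0 : {set W}) : simplicial_complex L -> s0 \in L -> s0 != set0.
Proof. by case=> + _ sL; apply: contra => /eqP <-. Qed.

Definition into s t := forall u, u \in s -> supp (b u) \subset t.

Lemma into_vspan s t : s \in K' -> into s t -> (vspan b s <= vspan (@dirac R T) t)%VS.
Proof.
move=> sin st; apply/subv_sumP => u us; rewrite -memvE -[b u]push_dirac.
by apply: vspan_push; apply: st.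
Qed.

Lemma into_card s t : s \in K' -> t \in K -> into s t -> (#|s| <= #|t|)%N.
Proof.
move=> sin tin st; rewrite -(dim_vspan sK' hb sin) -(dim_vspan sK hid tin).
exact: dimvS (into_vspan sin st).
Qed.

Lemma intoP s : s \in K' -> exists2 t, t \in K & into s t.
Proof. by move=> sin; have [t tK h] := as_face hb sin; exists t => // u /h[]. Qed.

Lemma into_push (d : {ffun U -> R}) t : prob d -> supp d \in K' ->
  supp (push b d) \subset t <-> into (supp d) t.
Proof.
move=> pd dK; split=> [h u ud|h]; last exact: push_supp (subxx _) h.
apply/subsetP => v; apply: contraTT => vt; rewrite inE negbK.
have := supp0 h vt; rewrite ffunE => /eqP; rewrite psumr_eq0; last first.
  move=> w _; have [wd|wd] := boolP (w \in supp d).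
    by rewrite mulr_ge0 //; [case/probP: pd|case/probP: (asub_prob hb dK wd)].
  by rewrite (supp0 (subxx _) wd) mul0r.
move=> /allP /(_ u (mem_index_enum _)); rewrite mulf_eq0 => /orP[|//].
by move: ud; rewrite inE => /negbTE ->.
Qed.

Lemma vspan_sep s (x : E) : x \notin vspan b s -> exists h : func, h x = 1 /\ forall u, u \in s -> h (b u : E) = 0.
Proof.
by move=> /functional[h [h1 h0]]; exists h; split=> // u us; apply: h0; apply: mem_vspan.
Qed.

Lemma vspan_ex t (V : {vspace E}) : t \in K -> (\dim V < #|t|)%N -> exists2 v, v \in t & (dirac R v : E) \notin V.
Proof.
move=> tK; rewrite -(dim_vspan sK hid tK) ltnNge => lt.
have [/existsP[v /andP[]]|] := boolP [exists v, (v \in t) && ((dirac R v : E) \notin V)]; first by exists v.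
rewrite negb_exists => /forallP h; case/negP: lt; apply: dimvS; apply/subv_sumP => v vt.
by have := h v; rewrite vt /= negbK -memvE.
Qed.

(** A generic point of the open simplex [t] avoids the spans of all faces of [K'] with fewer
    vertices than [t], so the face of [K'] around it has at least as many. *)
Lemma face_cover t : t \in K -> exists s, [/\ s \in K', (#|t| <= #|s|)%N &
   exists2 t1, t1 \in K & t \subset t1 /\ into s t1].
Proof.
move=> tK; have /choice[f hf] : forall s, exists f : func, s \in K' -> (#|s| < #|t|)%N ->
    (exists2 v, v \in t & (f (dirac R v : E) : R) != 0) /\ forall u, u \in s -> f (b u : E) = 0.
  move=> s; have [sin|] := boolP (s \in K'); last by exists 0.
  have [lt|] := boolP (#|s| < #|t|)%N; last by exists 0.
  have [|v vt vs] := vspan_ex (V := vspan b s) tK; first by rewrite (dim_vspan sK' hb sin).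
  have [h [h1 h0]] := vspan_sep vs; exists h => _ _; split=> //; exists v => //.
  by rewrite h1 oner_eq0.
pose F := [seq [ffun v => f s (dirac R v : E) : R] | s <- enum [pred s in K' | (#|s| < #|t|)%N]].
have [|x [px xt hx]] := @generic_point R T t F (face_neq0 sK tK).
  move=> c /mapP[s]; rewrite mem_enum inE => /andP[sin lt] ->.
  by have [[v vt fv] _] := hf s sin lt; exists v; rewrite ?ffunE.
have xK : pts K x by rewrite /pts px xt.
have [d dK ex] := as_surj hb xK; have [pd sin] := andP dK.
have ge : (#|t| <= #|supp d|)%N.
  rewrite leqNgt; apply/negP => lt; have [_ f0] := hf _ sin lt.
  have /hx : [ffun v => f (supp d) (dirac R v : E) : R] \in F.
    by apply: map_f; rewrite mem_enum inE sin.
  under eq_bigr do rewrite ffunE; rewrite -push_lin push_dirac -ex push_lin.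
  rewrite big1 ?eqxx // => u _; have [ud|ud] := boolP (u \in supp d); first by rewrite f0 ?mulr0.
  by rewrite (supp0 (subxx _) ud) mul0r.
exists (supp d); split=> //; have [t1 t1K st1] := intoP sin; exists t1 => //; split=> //.
by rewrite -xt -ex; apply/into_push.
Qed.

(** From the position of [w] one moves slightly towards a vertex of a face of [K] with at least two
    elements. The point reached lies in an open simplex of [K'] that has [w] as a vertex and is not
    [w] itself. *)
Lemma nonisolated : (forall t, t \in K -> exists t2, [/\ t2 \in K, t \subset t2 & (1 < #|t2|)%N]) ->
  forall w, [set w] \in K' -> exists s, [/\ s \in K', w \in s & (1 < #|s|)%N].
Proof.
move=> hK w wK; have dK : pts K' (dirac R w) by rewrite /pts prob_dirac supp_dirac.
have xK := push_pts sK hb dK; have [px xs] := andP xK.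
set x := push b (dirac R w) in xK px xs *.
have [t2 [t2K xt2 /card_gt1P[v1 [v2 [v1t v2t v12]]]]] := hK _ xs.
have [v vt vx] : exists2 v, v \in t2 & dirac R v != x.
  have [e|] := eqVneq (dirac R v1) x; last by exists v1.
  exists v2 => //; rewrite -e; apply: contra v12 => /eqP/(congr1 (@supp R T)).
  by rewrite !supp_dirac => /set1_inj ->.
have [G [xQ [h1 h2]]] := nbhd_exists sK' sK hb dK.
have [e e0 he] := near_inQ ((dirac R v : E) - (x : E)) xQ.
pose t := Num.min (1/2) (e/2).
have t0 : 0 < t by rewrite lt_min; apply/andP; split; lra.
have t1 : t < 1 by rewrite gt_min; apply/orP; left; lra.
have te : `|t| < e by rewrite gtr0_norm // gt_min; apply/orP; right; lra.
pose y := mix t x (dirac R v).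
have ey : y = (x : E) + t *: ((dirac R v : E) - (x : E)) by apply/ffunP => i; rewrite !ffunE.
have yK : pts K y.
  apply: (pts_sub sK t2K); first by apply: prob_mix; rewrite ?prob_dirac // !ltW.
  by rewrite supp_mix ?t0 ?prob_dirac // subUset xt2 supp_dirac sub1set.
have [d yd ed] := as_surj hb yK; have [pd dsK] := andP yd.
have : hit b (supp d) G.
  by apply/asboolP; exists y, d; split=> //; rewrite ey; apply: he.
rewrite h1 // supp_dirac sub1set => wd; exists (supp d); split=> //.
rewrite ltnNge; apply/negP => le1.
have sd : supp d = [set w] by apply/eqP; rewrite eq_sym eqEcard sub1set wd cards1.
have dw : d = dirac R w.
  apply/ffunP => i; rewrite ffunE; case: (eqVneq i w) => [->|iw]; last first.
    by rewrite (@supp0 _ _ d i [set w]) ?sd // inE.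
  have /probP[_ <-] := pd; rewrite (bigD1 w) //= big1 ?addr0 // => j jw.
  by rewrite (@supp0 _ _ d j [set w]) ?sd // inE.
have yx : y = x by rewrite -ed dw.
case/eqP: vx; apply/ffunP => i; have /ffunP/(_ i) := yx; rewrite ffunE => /eqP.
by rewrite -subr_eq0 addrAC subrr add0r mulf_eq0 gt_eqF //= subr_eq0 => /eqP.
Qed.

(** Some vertex [w] of [K'] is placed exactly at [v], and a face of [K'] with further vertices at
    [w] lies in a face of [K] that is at least as large and contains [v]. *)
Lemma nonisolated_down : (forall w, [set w] \in K' -> exists s, [/\ s \in K', w \in s & (1 < #|s|)%N]) ->
  forall v, [set v] \in K -> exists t, [/\ t \in K, v \in t & (1 < #|t|)%N].
Proof.
move=> h v vK; have xK : pts K (dirac R v : {ffun T -> R}) by rewrite /pts prob_dirac supp_dirac.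
have [d dK ed] := as_surj hb xK; have [pd dsK] := andP dK.
have /set0Pn[w wd] := prob_supp pd.
have wv : supp (b w) \subset [set v].
  by have := (into_push [set v] pd dsK).1; rewrite ed supp_dirac => /(_ (subxx _)) /(_ w wd).
have wK : [set w] \in K'.
  by case: sK' => _; apply; [exact: dsK|rewrite sub1set|apply/set0Pn; exists w; rewrite inE].
have [s [sin ws s1]] := h w wK; have [t tK st] := intoP sin.
exists t; split=> //; last exact: leq_trans s1 (into_card sin tK st).
have /set0Pn[v' v'w] := prob_supp (asub_prob hb sin ws).
have := subsetP wv v' v'w; rewrite inE => /eqP <-.
exact: (subsetP (st w ws)).
Qed.

Lemma euler_faces (k : int) : (forall t, t \in K -> \sum_(t' in K | t \subset t') (-1) ^+ #|t'| = k) ->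
  forall s, s \in K' -> \sum_(s' in K' | s \subset s') (-1) ^+ #|s'| = k.
Proof.
move=> h s sin; have pd : pts K' (bary R s : {ffun U -> R}).
  by rewrite /pts prob_bary ?supp_bary // (face_neq0 sK').
have := euler_local sK' sK hb pd; rewrite supp_bary => ->; apply: h.
by case/andP: (push_pts sK hb pd).
Qed.

Lemma euler_faces_down (k : int) : (forall s, s \in K' -> \sum_(s' in K' | s \subset s') (-1) ^+ #|s'| = k) ->
  forall t, t \in K -> \sum_(t' in K | t \subset t') (-1) ^+ #|t'| = k.
Proof.
move=> h t tin; have xK : pts K (bary R t : {ffun T -> R}).
  by rewrite /pts prob_bary ?supp_bary // (face_neq0 sK).
have [d dK ed] := as_surj hb xK; have := euler_local sK' sK hb dK; rewrite ed supp_bary => <-; apply: h.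
by case/andP: dK.
Qed.
End OneSub.
End Faces.

(** * Combinatorial 2-spheres *)

Section Cycles.
Variable R : realType.

Definition tris (T : finType) (K : {set {set T}}) := [set s in K | #|s| == 3%N].

Definition edge_closed (T : finType) (K Z : {set {set T}}) :=
  forall s t : {set T}, s \in Z -> t \in tris K -> (1 < #|s :&: t|)%N -> t \in Z.

Definition strongly_connected (T : finType) (K : {set {set T}}) :=
  forall Z : {set {set T}}, Z \subset tris K -> Z != set0 -> edge_closed K Z -> Z = tris K.

Section OneSub.
Variables (U T : finType) (K' : {set {set U}}) (K : {set {set T}}) (b : U -> {ffun T -> R}).
Hypotheses (sK' : simplicial_complex K') (sK : simplicial_complex K) (hb : asub K' K b).
Local Notation E := ({ffun T -> R^o}).
Local Notation func := 'Hom(E, R^o).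

Lemma trisP (W : finType) (L : {set {set W}}) (s : {set W}) : reflect (s \in L /\ #|s| = 3%N) (s \in tris L).
Proof. by rewrite inE; apply: (iffP andP) => -[h /eqP]. Qed.

(* If [Z] is a proper edge-closed family, the union of the triangles in [Z] meets the union of the
   others in vertices only; but any two points of a face are joined by a path that avoids the vertices. *)
Section Colour.
Variable Z : {set {set U}}.
Hypotheses (ZK : Z \subset tris K') (cZ : edge_closed K' Z).
Hypothesis pure : forall s, s \in K' -> exists2 t, t \in tris K' & s \subset t.

Let inA (x : {ffun T -> R}) := exists2 d, pts K' d & push b d = x /\ exists2 z, z \in Z & supp d \subset z.
Let inB (x : {ffun T -> R}) := exists2 d, pts K' d & push b d = x /\ exists2 z, z \in tris K' :\: Z & supp d \subset z.
Let isv (x : {ffun T -> R}) := exists u, [set u] \in K' /\ x = b u.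

Lemma colourAB x : pts K x -> inA x \/ inB x.
Proof.
move=> xK; have [d dK e] := as_surj hb xK; have [pd sd] := andP dK.
have [t tt st] := pure sd; have [tZ|tZ] := boolP (t \in Z).
  by left; exists d => //; split=> //; exists t.
by right; exists d => //; split=> //; exists t => //; rewrite inE tZ.
Qed.

Lemma colour_meet x : inA x -> inB x -> isv x.
Proof.
move=> [d dK [e [z zZ dz]]] [d' dK' [e' [w]]]; rewrite inE => /andP[wZ wt] dw.
have dd : d = d' by apply: (as_inj hb) => //; rewrite e e'.
have [pd sd] := andP dK.
have le : (#|z :&: w| <= 1)%N.
  by rewrite leqNgt; apply: contra wZ => lt; apply: cZ lt.
have sub : supp d \subset z :&: w by rewrite subsetI dz dd.
have /set0Pn[u us] := prob_supp pd.
have su : supp d = [set u].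
  apply/eqP; rewrite eq_sym eqEcard sub1set us cards1.
  exact: leq_trans (subset_leq_card sub) le.
exists u; rewrite -su; split=> //; rewrite -e; apply/ffunP => v.
have du : d u = 1.
  have /probP[_ <-] := pd; rewrite (bigD1 u) //= big1 ?addr0 // => w' wu.
  by rewrite (@supp0 _ _ d w' [set u]) ?su // inE.
rewrite ffunE (bigD1 u) //= du mul1r big1 ?addr0 // => w' wu.
by rewrite (@supp0 _ _ d w' [set u]) ?su ?mul0r // inE.
Qed.

(** Near [x] there are only open simplices with [x] in their closure; hence each of the two unions
    of closed triangles that misses [x] misses a neighbourhood. *)
Lemma colour_open x : pts K x -> ~ inA x \/ ~ inB x ->
  exists2 G : seq func, inQ G x & forall y, pts K y -> inQ G y -> (~ inA x -> ~ inA y) /\ (~ inB x -> ~ inB y).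
Proof.
move=> xK _; have [d dK e] := as_surj hb xK; have [G [xQ [h1 _]]] := nbhd_exists sK' sK hb dK.
rewrite e in xQ; exists G => // y yK yQ.
have key d' (z : {set U}) : pts K' d' -> push b d' = y -> supp d' \subset z -> supp d \subset z.
  move=> dK' e' dz; have [pd' sd'] := andP dK'.
  have : hit b (supp d') G by apply/asboolP; exists y, d'.
  by rewrite h1 // => h; exact: subset_trans h dz.
split=> nx [d' dK' [e' [z zZ dz]]]; apply: nx; exists d => //; split=> //; exists z => //;
  exact: key dz.
Qed.

(** Away from the vertices exactly one of [inA] and [inB] holds, and not belonging to either is an
    open condition. So the colour is locally constant along the segment. *)
Lemma colour_segment x r : pts K x -> pts K r ->
  (forall t, 0 <= t <= 1 -> pts K (mix t x r) /\ ~ isv (mix t x r)) -> inA x <-> inA r.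
Proof.
move=> xK rK seg.
have m0 : mix 0 x r = x by apply/ffunP => v; rewrite ffunE mul0r addr0.
have m1 : mix 1 x r = r by apply/ffunP => v; rewrite ffunE mul1r addrC subrK.
have opn t : 0 <= t <= 1 -> exists2 e, 0 < e & forall t', 0 <= t' <= 1 -> `|t' - t| < e ->
    (inA (mix t x r) <-> inA (mix t' x r)).
  move=> t01; have [yK ny] := seg t t01; set y := mix t x r in yK ny *.
  have AB : ~ inA y \/ ~ inB y.
    by have [hA|] := pselect (inA y); [right=> hB; apply: ny; exact: colour_meet|left].
  have [G yQ hG] := colour_open yK AB.
  have [e e0 he] := near_inQ ((r : E) - (x : E)) yQ.
  exists e => // t' t'01 tt'; have [yK' ny'] := seg t' t'01.
  have ey : mix t' x r = (y : E) + (t' - t) *: ((r : E) - (x : E)).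
    by apply/ffunP => v; rewrite !ffunE -[_ *: _]/(_ * _); lra.
  have [hA hB] : (~ inA y -> ~ inA (mix t' x r)) /\ (~ inB y -> ~ inB (mix t' x r)).
    by apply: hG => //; rewrite ey; apply: he.
  split=> [Ay|Ay']; last by apply: contrapT => /hA.
  have nB : ~ inB y by move=> By; apply: ny; exact: colour_meet.
  by have [//|/(hB nB)] := colourAB yK'.
have conn (P : R -> Prop) : (forall t, 0 <= t <= 1 -> exists2 e, 0 < e & forall t', 0 <= t' <= 1 -> `|t' - t| < e ->
    (P t <-> P t')) -> P 0 -> P 1.
  move=> h; apply: segment_connected => t t01 Pt; have [e e0 he] := h t t01; exists e => // t' t'01 tt'.
    by apply/he.
  by move=> Pt'; apply: Pt; apply/(he t').
have c1 := conn (fun t => inA (mix t x r)) opn.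
have c2 : ~ inA (mix 0 x r) -> ~ inA (mix 1 x r).
  apply: (conn (fun t => ~ inA (mix t x r))) => t t01; have [e e0 he] := opn t t01.
  by exists e => // t' t'01 tt'; rewrite (he t' t'01 tt').
rewrite m0 m1 in c1 c2; split=> // Ar; apply: contrapT => /c2; exact.
Qed.

Lemma vspan_exb s (V : {vspace E}) : s \in K' -> (\dim V < #|s|)%N -> exists2 u, u \in s & (b u : E) \notin V.
Proof.
move=> sin; rewrite -(dim_vspan sK' hb sin) ltnNge => lt.
have [/existsP[u /andP[]]|] := boolP [exists u, (u \in s) && ((b u : E) \notin V)]; first by exists u.
rewrite negb_exists => /forallP h; case/negP: lt; apply: dimvS; apply/subv_sumP => u us.
by have := h u; rewrite us /= negbK -memvE.
Qed.

Lemma supp_mix_sub t (x y : {ffun T -> R}) (s : {set T}) : supp x \subset s -> supp y \subset s ->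
  supp (mix t x y) \subset s.
Proof.
move=> xs ys; apply/subsetP => v; rewrite inE ffunE; apply: contraR => vs.
by rewrite (supp0 xs vs) (supp0 ys vs) subrr mulr0 addr0.
Qed.

(** The span of [r] and one vertex [u] has dimension at most 2, less than that of [z]; so a generic
    point of [z] is off all lines through [r] and a vertex. The segment from it to [r] stays in [t],
    avoids the vertices and carries the colour of [z] to [r]. *)
Lemma colour_triangle z t r : z \in tris K' -> t \in K -> into b z t -> prob r -> supp r \subset t ->
  ~ isv r -> inA r <-> z \in Z.
Proof.
move=> /trisP[zK z3] tK zt pr rt nr.
have rK : pts K r by apply: (pts_sub sK tK).
have /choice[f hf] : forall u, exists f : func, [/\ (exists2 w, w \in z & (f (b w : E) : R) != 0),
     f (r : E) = 0 & f (b u : E) = 0].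
  move=> u; have [|w wz wV] := @vspan_exb z (<[r : E]> + <[b u : E]>)%VS zK.
    rewrite z3 ltnS; apply: leq_trans (dimv_add_leqif _ _) _.
    by rewrite !dim_vline; case: (_ != _); case: (_ != _).
  have [h [h1 h0]] := functional wV; exists h; split; first by exists w => //; rewrite h1 oner_eq0.
    by apply: h0; apply: (subvP (addvSl _ _)); apply: memv_line.
  by apply: h0; apply: (subvP (addvSr _ _)); apply: memv_line.
have [|d [pd dz hd]] := @generic_point R U z [seq [ffun w => f u (b w : E) : R] | u <- enum U] (face_neq0 sK' zK).
  by move=> c /mapP[u _ ->]; have [[w wz fw] _ _] := hf u; exists w; rewrite ?ffunE.
have dK : pts K' d by rewrite /pts pd dz.
have fd u : (f u (push b d : E) : R) != 0.
  have /hd : [ffun w => f u (b w : E) : R] \in [seq [ffun w => f u (b w : E) : R] | u <- enum U].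
    by apply: map_f; rewrite mem_enum.
  by under eq_bigr do rewrite ffunE; rewrite -push_lin.
have at_ : supp (push b d) \subset t by apply: push_supp (subxx _) _; rewrite dz.
have aK := push_pts sK hb dK; have [pa sa] := andP aK.
have seg tau : 0 <= tau <= 1 -> pts K (mix tau (push b d) r) /\ ~ isv (mix tau (push b d) r).
  move=> t01; split; first by apply: (pts_sub sK tK); [exact: prob_mix|exact: supp_mix_sub].
  move=> [u [uK eu]]; have [_ fr fu] := hf u.
  have := mix_lin (f u) tau (push b d) r; rewrite eu fu fr sub0r => /esym/eqP.
  rewrite mulrN -{1}[f u _]mul1r -mulrBl mulf_eq0 (negbTE (fd u)) orbF subr_eq0 => /eqP t1.
  apply: nr; exists u; split=> //; rewrite -eu -t1; apply/ffunP => v; rewrite ffunE mul1r.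
  by rewrite addrC subrK.
rewrite -(colour_segment aK rK seg); split=> [hA|zZ]; last first.
  by exists d => //; split=> //; exists z; rewrite // dz.
apply: contrapT => /negP zZ; have [|_ nv] := seg 0; first by rewrite lexx ler01.
apply: nv; have -> : mix 0 (push b d) r = push b d by apply/ffunP => v; rewrite ffunE mul0r addr0.
by apply: colour_meet => //; exists d => //; split=> //; exists z; rewrite ?dz // inE zZ; apply/trisP.
Qed.

Hypothesis meet : forall t1 t2, t1 \in K -> t2 \in K -> (2 < #|t1|)%N -> (2 < #|t2|)%N -> (1 < #|t1 :&: t2|)%N.

(** Any two triangles of [K'] lie in faces [t1], [t2] of [K] that share an edge. A generic point of
    this edge is not a vertex of [K'] and receives its colour from both triangles. The hypothesis
    [meet] holds in the boundary of a tetrahedron. *)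
Lemma colour_all : Z != set0 -> Z = tris K'.
Proof.
case/set0Pn => z zZ; have zt := subsetP ZK z zZ; have [zK z3] := trisP _ _ zt.
apply/eqP; rewrite eqEsubset ZK; apply/subsetP => w wt; have [wK w3] := trisP _ _ wt.
have [t1 t1K zt1] := intoP hb zK; have [t2 t2K wt2] := intoP hb wK.
have c1 := into_card sK' sK hb zK t1K zt1; have c2 := into_card sK' sK hb wK t2K wt2.
rewrite z3 in c1; rewrite w3 in c2; have lt := meet t1K t2K c1 c2.
set e := t1 :&: t2 in lt; have e0 : e != set0 by rewrite -card_gt0 ltnW.
have eK : e \in K by case: sK => _; apply; [exact: t1K|exact: subsetIl|].
have /choice[f hf] : forall u, exists f : func, (exists2 v, v \in e & (f (dirac R v : E) : R) != 0) /\ f (b u : E) = 0.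
  move=> u; have [|v ve vV] := vspan_ex sK (V := <[b u : E]>%VS) eK.
    by rewrite dim_vline; case: (_ != _) => //; exact: ltnW.
  have [h [h1 h0]] := functional vV; exists h; split; first by exists v => //; rewrite h1 oner_eq0.
  by apply: h0; rewrite memv_line.
have [|r [pr re hr]] := @generic_point R T e [seq [ffun v => f u (dirac R v : E) : R] | u <- enum U] e0.
  by move=> c /mapP[u _ ->]; have [[w' we fw] _] := hf u; exists w'; rewrite ?ffunE.
have nv : ~ isv r.
  move=> [u [uK eu]]; have /hr : [ffun v => f u (dirac R v : E) : R] \in
      [seq [ffun v => f u (dirac R v : E) : R] | u <- enum U].
    by apply: map_f; rewrite mem_enum.
  under eq_bigr do rewrite ffunE; rewrite -push_lin push_dirac eu.
  by have [_ ->] := hf u; rewrite eqxx.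
have h1 := colour_triangle zt t1K zt1 pr (etrans (congr1 (fun s : {set T} => s \subset t1) re) (subsetIl _ _)) nv.
have h2 := colour_triangle wt t2K wt2 pr (etrans (congr1 (fun s : {set T} => s \subset t2) re) (subsetIr _ _)) nv.
by apply/h2/h1.
Qed.
End Colour.

(** The triangles of [K'] contained in members of [Z] form an edge-closed family: if two triangles
    of [K'] share an edge, so do the triangles of [K] around them, because the common edge is placed
    in their intersection. *)
Lemma strong_down : (forall s, s \in K' -> (#|s| <= 3)%N) -> (forall t, t \in K -> (#|t| <= 3)%N) ->
  strongly_connected K' -> strongly_connected K.
Proof.
move=> d3' d3 sc Z ZK Z0 cZ.
pose Z' := [set s in tris K' | [exists t in Z, [forall u in s, supp (b u) \subset t]]].
have Z'P s : reflect (s \in tris K' /\ exists2 t, t \in Z & into b s t) (s \in Z').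
  have -> : (s \in Z') = (s \in tris K') && [exists t in Z, [forall u in s, supp (b u) \subset t]].
    by rewrite [LHS]inE.
  apply: (iffP andP) => [[-> /existsP[t /andP[tZ /forallP h]]]|[-> [t tZ h]]]; split=> //.
    by exists t => // u us; have := h u; rewrite us.
  by apply/existsP; exists t; rewrite tZ; apply/forallP => u; apply/implyP => us; apply: h.
have tri_into s t : s \in tris K' -> t \in K -> into b s t -> t \in tris K.
  move=> /trisP[sin s3] tK st; apply/trisP; split=> //; apply/eqP; rewrite eqn_leq d3 //.
  by have := into_card sK' sK hb sin tK st; rewrite s3.
have cover t : t \in tris K -> exists2 s, s \in tris K' & into b s t.
  move=> /trisP[tK t3]; have [s [sin ge [t1 t1K [tt1 st1]]]] := face_cover sK' sK hb tK.
  have -> : t = t1 by apply/eqP; rewrite eqEcard tt1 t3 d3.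
  by exists s => //; apply/trisP; split=> //; apply/eqP; rewrite eqn_leq d3' // -t3.
have into_meet s s' t t' : s \in K' -> s' \in K' -> t \in K -> t' \in K -> into b s t -> into b s' t' ->
    (#|s :&: s'| <= #|t :&: t'|)%N.
  move=> sin s'in tK t'K st s't'; have [->|n0] := eqVneq (s :&: s') set0; first by rewrite cards0.
  have eK : s :&: s' \in K' by case: sK' => _; apply; [exact: sin|exact: subsetIl|].
  have ei : into b (s :&: s') (t :&: t').
    by move=> u; rewrite inE => /andP[us us']; rewrite subsetI st // s't'.
  apply: (into_card sK' sK hb eK _ ei).
  case: sK => _; apply; [exact: tK|exact: subsetIl|].
  have /set0Pn[u ue] := n0; have /set0Pn[v vu] := prob_supp (asub_prob hb eK ue).
  by apply/set0Pn; exists v; exact: (subsetP (ei u ue)).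
have eZ' : Z' = tris K'.
  apply: sc; first by apply/subsetP => s /Z'P[].
    have /set0Pn[t tZ] := Z0; have [s st sto] := cover t (subsetP ZK t tZ).
    by apply/set0Pn; exists s; apply/Z'P; split=> //; exists t.
  move=> s s' /Z'P[st [t tZ sto]] s't lt; apply/Z'P; split=> //.
  have [sin _] := trisP _ _ st; have [s'in _] := trisP _ _ s't.
  have [t' t'K s't'] := intoP hb s'in; exists t' => //.
  have [tK _] := trisP _ _ (subsetP ZK t tZ).
  apply: (cZ t) => //; first exact: tri_into s't _ s't'.
  exact: leq_trans lt (into_meet s s' t t' sin s'in tK t'K sto s't').
apply/eqP; rewrite eqEsubset ZK; apply/subsetP => t tt; have [s st sto] := cover t tt.
have := st; rewrite -eZ' => /Z'P[_ [t' t'Z sto']].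
have [tK t3] := trisP _ _ tt; have [t'K t'3] := trisP _ _ (subsetP ZK t' t'Z).
have [sin s3] := trisP _ _ st.
have := into_meet s s t t' sin sin tK t'K sto sto'; rewrite setIid s3 => le.
have e1 : t :&: t' = t by apply/eqP; rewrite eqEcard subsetIl t3.
have e2 : t :&: t' = t' by apply/eqP; rewrite eqEcard subsetIr t'3.
by rewrite -e1 e2.
Qed.
End OneSub.

Section Sphere.
Lemma standard_sphere_complex (T : finType) (V : {set T}) : simplicial_complex (standard_sphere V).
Proof.
split; first by rewrite inE eqxx.
move=> s t; rewrite !inE => /andP[_ sV] ts -> /=; exact: sub_proper_trans ts sV.
Qed.

Lemma alternating_sum (T : finType) (s : {set T}) : s != setT ->
  \sum_(t : {set T} | s \subset t) (-1) ^+ #|t| = 0 :> int.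
Proof.
move=> sT; have [x xs] : exists x, x \notin s.
  by apply/existsP; rewrite -negb_forall; apply: contra sT => /forallP h; apply/eqP/setP => x; rewrite inE h.
rewrite (bigID (fun t : {set T} => x \in t)) /=.
rewrite (reindex_onto (fun t : {set T} => x |: t) (fun t => t :\ x)) /=; last first.
  by move=> t /andP[_ xt]; rewrite setD1K.
apply/eqP; rewrite addr_eq0 -sumrN; apply/eqP; apply: eq_big => [t|t /andP[_ /eqP e]]; last first.
  have xt : x \notin t by rewrite -e !inE eqxx.
  by rewrite cardsU1 xt exprS mulN1r.
rewrite setU11 andbT; have [xt|xt] := boolP (x \in t).
  rewrite andbF; apply/negbTE; rewrite negb_and; apply/orP; right.
  by apply: contraL xt => /eqP <-; rewrite !inE eqxx.
rewrite setU1K // eqxx !andbT; apply/subsetP/subsetP => h y ys.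
  by have := h y ys; rewrite !inE; case: eqP => // e; rewrite -e ys in xs.
by rewrite inE h // orbT.
Qed.

(** All that is used about links of vertices. The sum of [(-1) ^+ #|s|] over non-empty faces is
    minus the Euler characteristic, hence -2. *)
Record sphere2 (T : finType) (K : {set {set T}}) : Prop := Sphere2 {
  s2_dim : forall s, s \in K -> (#|s| <= 3)%N;
  s2_vertex : forall v, [set v] \in K -> exists t, [/\ t \in K, v \in t & (1 < #|t|)%N];
  s2_edge : forall e : {set T}, e \in K -> #|e| = 2%N -> #|[set t in tris K | e \subset t]| = 2%N;
  s2_euler : \sum_(s in K) (-1) ^+ #|s| = -2 :> int;
  s2_strong : strongly_connected K }.

(** The edge itself contributes 1 and each triangle through it -1, so the sum -1 means two
    triangles. *)
Lemma edge_count (T : finType) (K : {set {set T}}) (e : {set T}) : (forall s, s \in K -> (#|s| <= 3)%N) ->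
  e \in K -> #|e| = 2%N -> \sum_(t in K | e \subset t) (-1) ^+ #|t| = -1 :> int ->
  #|[set t in tris K | e \subset t]| = 2%N.
Proof.
move=> d3 eK e2.
have c3 t : t \in K -> e \subset t -> t != e -> #|t| = 3%N.
  move=> tK et te; apply/eqP; rewrite eqn_leq d3 //.
  by have := proper_card (_ : e \proper t); rewrite e2; apply; rewrite properEneq et andbT eq_sym.
rewrite (bigD1 e) ?eK ?subxx //= e2 sqrrN expr1n.
rewrite (eq_bigr (fun=> -1)); last first.
  by move=> t /andP[/andP[tK et] te]; rewrite (c3 t tK et te).
rewrite sumr_const mulNrn natz => h.
have -> : #|[set t in tris K | e \subset t]| = #|[pred t in K | (e \subset t) && (t != e)]|.
  apply: eq_card => t; rewrite !inE -!andbA; case: (boolP (t \in K)) => //= tK.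
  have [->|te] := eqVneq t e; first by rewrite e2 andbF.
  rewrite andbT; case: (boolP (e \subset t)) => et; rewrite ?andbT ?andbF //.
  by rewrite c3.
move: h; rewrite (@eq_card _ _ [pred t in K | (e \subset t) && (t != e)]); last first.
  by move=> t; rewrite !inE andbA.
by move: #|_| => n h; lia.
Qed.

Lemma pure_dim2 (T : finType) (K : {set {set T}}) : simplicial_complex K -> (forall s, s \in K -> (#|s| <= 3)%N) ->
  (forall v, [set v] \in K -> exists t, [/\ t \in K, v \in t & (1 < #|t|)%N]) ->
  (forall e : {set T}, e \in K -> #|e| = 2%N -> #|[set t in tris K | e \subset t]| = 2%N) ->
  forall s, s \in K -> exists2 t, t \in tris K & s \subset t.
Proof.
move=> sK d3 hv he s sin.
have big t : t \in K -> (1 < #|t|)%N -> exists2 t', t' \in tris K & t \subset t'.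
  move=> tK; rewrite leq_eqVlt => /orP[/eqP t2|t3]; last first.
    by exists t => //; apply/trisP; split=> //; apply/eqP; rewrite eqn_leq d3.
  have /set0Pn[t'] : [set t' in tris K | t \subset t'] != set0 by rewrite -card_gt0 he.
  by rewrite inE => /andP[h1 h2]; exists t'.
have [|le] := ltnP 1 #|s|; first exact: big.
have /cards1P[v ev] : #|s| == 1%N by rewrite eqn_leq le card_gt0 (face_neq0 sK).
have [|t [tK vt t1]] := hv v; first by rewrite -ev.
have [t' tt' tt] := big t tK t1; exists t' => //; rewrite ev sub1set.
exact: (subsetP tt).
Qed.

(** Each property is lifted from the boundary of a tetrahedron to the common subdivision and then
    carried down to [K]. *)
Theorem sphere2P (T : finType) (K : {set {set T}}) : simplicial_complex K ->
  combinatorial_sphere R 2 K -> sphere2 K.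
Proof.
move=> sK /(sphere_asub R sK (standard_sphere_complex _)) [U [K' [b [g [sK' hb hg]]]]].
set L := standard_sphere _ in hg; have sL : simplicial_complex L := standard_sphere_complex _.
have inL t : (t \in L) = (t != set0) && (t != setT) by rewrite inE properT.
have dL t : t \in L -> (#|t| <= 3)%N.
  by rewrite inE => /andP[_ /proper_card]; rewrite cardsT card_ord.
(* Over all supersets of [t] the alternating sum vanishes, but the whole 4-set, which contributes 1,
   is not a face. *)
have eL t : t \in L -> \sum_(t' in L | t \subset t') (-1) ^+ #|t'| = -1 :> int.
  rewrite inL => /andP[t0 tT]; have := alternating_sum tT.
  rewrite (bigD1 setT) ?subsetT //= cardsT card_ord => h.
  rewrite (eq_bigl (fun t' : {set 'I_4} => (t \subset t') && (t' != setT))).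
    by apply: (addrI 1); rewrite [LHS]h.
  move=> t'; rewrite inL; case: (boolP (t \subset t')) => [tt'|]; rewrite ?andbF // andbT.
  by case: eqVneq tt' => //= ->; rewrite subset0 (negbTE t0).
(* Here the empty set, with another contribution 1, is excluded as well. *)
have gL : \sum_(t in L) (-1) ^+ #|t| = -2 :> int.
  have := @alternating_sum _ (set0 : {set 'I_4}); rewrite (bigD1 setT) ?subsetT //= cardsT card_ord.
  rewrite (bigD1 set0) ?subsetT //=; last first.
    by rewrite sub0set eq_sym -card_gt0 cardsT card_ord.
  have n0 : set0 != setT :> {set 'I_4} by rewrite eq_sym -card_gt0 cardsT card_ord.
  move=> /(_ n0); rewrite cards0 => h.
  rewrite (eq_bigl (fun t : {set 'I_4} => (set0 \subset t) && (t != setT) && (t != set0))).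
    by apply: (addrI 1); apply: (addrI 1); rewrite [LHS]h.
  by move=> t; rewrite inL sub0set andbC.
have vL t : t \in L -> exists t2, [/\ t2 \in L, t \subset t2 & (1 < #|t2|)%N].
  move=> tL; have [|le] := ltnP 1 #|t|; first by exists t.
  have /cards1P[v ev] : #|t| == 1%N by rewrite eqn_leq le card_gt0 (face_neq0 sL).
  have /subsetPn[w _ wt] : ~~ ([set: 'I_4] \subset t).
    by apply/negP => /subset_leq_card; rewrite cardsT card_ord => h; have := leq_trans h le.
  exists (w |: t); split; rewrite ?subsetU1 ?cardsU1 ?wt ?ev ?cards1 // inL; apply/andP; split.
    by apply/set0Pn; exists w; rewrite !inE eqxx.
  apply/eqP => e; have : #|w |: [set v]| = 4%N by rewrite e cardsT card_ord.
  by rewrite cards2; case: (_ != _).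
have d' s : s \in K' -> (#|s| <= 3)%N.
  by move=> sin; have [t tL st] := intoP hg sin; apply: leq_trans (dL t tL); apply: (into_card sK' sL hg).
have v' := nonisolated sK' sL hg vL.
have e' := euler_faces sK' sL hg eL.
have ed' e : e \in K' -> #|e| = 2%N -> #|[set t in tris K' | e \subset t]| = 2%N.
  by move=> eK e2; apply: edge_count => //; apply: e'.
have pure' := pure_dim2 sK' d' v' ed'.
have sc' : strongly_connected K'.
  move=> Z ZK Z0 cZ; apply: (colour_all sK' sL hg ZK cZ) => //.
  move=> t1 t2 t1L t2L c1 c2; have := cardsUI t1 t2.
  have : (#|t1 :|: t2| <= 4)%N by have := max_card [in t1 :|: t2]; rewrite card_ord.
  by lia.
have d s : s \in K -> (#|s| <= 3)%N.
  by move=> sin; have [s' [s'K le _]] := face_cover sK' sK hb sin; apply: leq_trans le (d' s' s'K).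
split=> //.
- exact: nonisolated_down sK' sK hb v'.
- move=> e eK e2; apply: edge_count => //; exact: (euler_faces_down sK' sK hb e').
- by rewrite -(euler_global sK' sK hb) (euler_global sK' sL hg).
exact: strong_down sK' sK hb d' d sc'.
Qed.
End Sphere.
End Cycles.

(** * Bistellar moves of combinatorial spheres *)

Section Moves.
Variable R : realType.

Lemma push_push (W U T : finType) (c : W -> {ffun U -> R}) (b : U -> {ffun T -> R}) d :
  push b (push c d) = push (fun w => push b (c w)) d.
Proof.
apply/ffunP => v; rewrite !ffunE; under eq_bigr do rewrite ffunE mulr_suml.
rewrite exchange_big; apply: eq_bigr => w _; rewrite ffunE mulr_sumr.
by apply: eq_bigr => u _; rewrite mulrA.
Qed.

Lemma asub_comp (W U T : finType) (K2 : {set {set W}}) (K1 : {set {set U}}) (K : {set {set T}}) c b :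
  simplicial_complex K1 -> asub K2 K1 c -> asub K1 K b -> asub K2 K (fun w => push b (c w) : {ffun T -> R}).
Proof.
move=> sK1 h2 h1; split.
- move=> s sin; have [t tK1 ct] := as_face h2 sin; have [r rK br] := as_face h1 tK1.
  exists r => // w ws; have [pc sc] := ct w ws; split.
    by apply: push_prob pc sc _ => u /br[].
  by apply: push_supp sc _ => u /br[].
- move=> d d' dK dK'; rewrite -!push_push => e; apply: (as_inj h2) => //.
  by apply: (as_inj h1) => //; exact: (push_pts sK1 h2).
by move=> x xK; have [e eK <-] := as_surj h1 xK; have [d dK <-] := as_surj h2 eK; exists d; rewrite // -push_push.
Qed.

Definition sided (U T : finType) (b : U -> {ffun T -> R}) (H : T -> R) (s : {set U}) :=
  (forall u, u \in s -> 0 <= \sum_v b u v * H v) \/ (forall u, u \in s -> \sum_v b u v * H v <= 0).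

Lemma sided_refine (W U T : finType) (K2 : {set {set W}}) (K1 : {set {set U}}) c (b : U -> {ffun T -> R}) H :
  asub K2 K1 c -> (forall s, s \in K1 -> sided b H s) -> forall s, s \in K2 -> sided (fun w => push b (c w)) H s.
Proof.
move=> h2 h s sin; have [t tK1 ct] := as_face h2 sin.
have e w : \sum_v push b (c w) v * H v = \sum_u c w u * \sum_v b u v * H v.
  under eq_bigr do rewrite ffunE mulr_suml.
  rewrite exchange_big; apply: eq_bigr => u _; rewrite mulr_sumr.
  by apply: eq_bigr => v _; rewrite mulrA.
case: (h t tK1) => hs; [left|right] => w ws; have [/probP[c0 _] sc] := ct w ws; rewrite e.
  apply: sumr_ge0 => u _; have [ut|ut] := boolP (u \in t); first by rewrite mulr_ge0 // hs.
  by rewrite (supp0 sc ut) mul0r.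
apply: sumr_le0 => u _; have [ut|ut] := boolP (u \in t); last by rewrite (supp0 sc ut) mul0r.
by rewrite mulr_ge0_le0 // hs.
Qed.

Section EdgeStar.
Variables (U : finType) (K : {set {set U}}) (a c : U) (la lc : R).
Hypotheses (sK : simplicial_complex K) (ac : a != c).
Hypotheses (la0 : 0 < la) (lc0 : 0 < lc) (lac : la + lc = 1).

Definition old (s : {set option U}) : {set U} := [set u | Some u \in s].
(** The stellar subdivision at the edge [ac], with [None] as the new vertex: a face that contains
    [None] is the join of it with a set that together with [a] and [c] spans a face of [K], and no
    face contains both [a] and [c]. *)
Definition edge_star : {set {set option U}} :=
  [set s | [&& s != set0, ~~ ([set a; c] \subset old s) &
            (if None \in s then old s :|: [set a; c] \in K else old s \in K)]].
Definition star_pt (w : option U) : {ffun U -> R} :=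
  if w is Some u then dirac R u else [ffun v => la * dirac R a v + lc * dirac R c v].

Lemma edge_star_complex : simplicial_complex edge_star.
Proof.
split; first by rewrite inE eqxx.
move=> s t; rewrite !inE => /and3P[s0 nac sin] ts t0.
have ots : old t \subset old s by apply/subsetP => u; rewrite !inE => /(subsetP ts).
rewrite t0 (contra _ nac) /=; last by move/subset_trans; apply.
case: ifP => Nt.
  rewrite (subsetP ts _ Nt) in sin; case: sK => _; apply; [exact: sin|exact: setSU|].
  by apply/set0Pn; exists a; rewrite !inE eqxx orbT.
have ot0 : old t != set0.
  have /set0Pn[[u|] ut] := t0; last by rewrite ut in Nt.
  by apply/set0Pn; exists u; rewrite inE.
case: ifP sin => _ sin; case: sK => _; apply; [exact: sin|exact: subset_trans ots (subsetUl _ _)| |exact: sin| |] => //.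
Qed.

Lemma edge_star_asub : asub edge_star K star_pt.
Proof.
have ca : c != a by rewrite eq_sym.
have pN : prob (star_pt None).
  apply/probP; split=> [v|].
    by rewrite !ffunE addr_ge0 // mulr_ge0 ?ler0n // ltW.
  under eq_bigr do rewrite ffunE; rewrite big_split /= -!mulr_sumr.
  by have /probP[_ ->] := prob_dirac R a; have /probP[_ ->] := prob_dirac R c; rewrite !mulr1.
have pushE d v : push star_pt d v = d (Some v) + (d None) * (la * (v == a)%:R + lc * (v == c)%:R).
  rewrite ffunE (bigD1 None) //= addrC; congr (_ + _); last by rewrite !ffunE.
  rewrite (bigD1 (Some v)) //= ffunE eqxx mulr1 big1 ?addr0 // => -[u|//] /andP[_ uv].
  by rewrite ffunE eq_sym (_ : (u == v) = false) ?mulr0 //; apply: contraNF uv => /eqP ->.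
have old_supp (d : {ffun option U -> R}) u : (u \in old (supp d)) = (d (Some u) != 0) by rewrite !inE.
(* The weight of the new vertex is the largest multiple of its position that can be subtracted from
   [x], because afterwards one of the coordinates at [a] and [c] has to vanish. *)
pose q (x : {ffun U -> R}) := Num.min (x a / la) (x c / lc).
have qE d : pts edge_star d -> d None = q (push star_pt d).
  case/andP => /probP[d0 _]; rewrite inE => /and3P[_ + _].
  rewrite /q !pushE !eqxx (negbTE ac) (negbTE ca) !mulr0 !mulr1 addr0 add0r.
  rewrite !mulrDl !mulfK ?gt_eqF // subUset !sub1set !old_supp negb_and !negbK.
  case/orP => /eqP ->; rewrite mul0r add0r.
    by rewrite min_l // lerDr divr_ge0 // ltW.
  by rewrite min_r // lerDr divr_ge0 // ltW.
split.
- move=> s; rewrite inE => /and3P[s0 _]; case: ifP => Ns sin.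
    exists (old s :|: [set a; c]) => // -[u|] us /=.
      by rewrite prob_dirac supp_dirac sub1set !inE us.
    split=> //; apply/subsetP => v; rewrite !inE !ffunE.
    case: (v == a); rewrite ?orbT //; case: (v == c); rewrite ?orbT //.
    by rewrite !mulr0 addr0 eqxx.
  exists (old s) => // -[u|] us /=; last by rewrite us in Ns.
  by rewrite prob_dirac supp_dirac sub1set !inE us.
- move=> d d' dK dK' e; apply/ffunP => -[u|]; last by rewrite !qE // e.
  have /ffunP/(_ u) := e; rewrite !pushE !qE // e; exact: addIr.
move=> x /andP[/probP[x0 x1] xK].
have q0 : 0 <= q x by rewrite /q le_min !divr_ge0 // ltW.
have qa : la * q x <= x a by rewrite mulrC -ler_pdivlMr // /q ge_min lexx.
have qc : lc * q x <= x c by rewrite mulrC -ler_pdivlMr // /q ge_min lexx orbT.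
pose d : {ffun option U -> R} := [ffun w => if w is Some u then
   x u - q x * (la * (u == a)%:R + lc * (u == c)%:R) else q x].
have ed : push star_pt d = x by apply/ffunP => v; rewrite pushE !ffunE subrK.
have pd : prob d.
  apply/probP; split=> [[u|]|]; rewrite ?ffunE //.
    have [->|ua] := eqVneq u a; first by rewrite (negbTE ac) mulr0 addr0 mulr1 subr_ge0 mulrC.
    have [->|uc] := eqVneq u c; first by rewrite mulr0 add0r mulr1 subr_ge0 mulrC.
    by rewrite !mulr0 addr0 mulr0 subr0.
  rewrite -x1 -[in RHS]ed; under [RHS]eq_bigr do rewrite pushE.
  rewrite big_split /= -mulr_sumr big_split /= -!mulr_sumr.
  have s1 w : \sum_v (v == w)%:R = 1 :> R.
    by rewrite (bigD1 w) //= eqxx big1 ?addr0 // => v /negbTE ->.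
  rewrite !s1 !mulr1 lac mulr1 (bigD1 None) //= addrC; congr (_ + _).
  rewrite (reindex_omap Some id) //=; last by case.
  by apply: eq_bigl => u; rewrite eqxx.
exists d => //; rewrite /pts pd /=.
have sub : old (supp d) \subset supp x.
  apply/subsetP => u; rewrite old_supp ffunE inE; apply: contra => /eqP xu.
  have := x0 u; rewrite xu sub0r oppr_eq0.
  have [ua _|ua] := eqVneq u a; first by rewrite /q -ua xu mul0r min_l ?mul0r //
    -(_ : 0 / la = 0) ?mul0r // ?divr_ge0 ?x0 // ltW.
  have [uc _|uc] := eqVneq u c; last by rewrite !mulr0 addr0 mulr0.
  by rewrite /q -uc xu mul0r min_r ?mul0r // divr_ge0 ?x0 // ltW.
rewrite inE prob_supp //=; apply/andP; split.
  rewrite subUset !sub1set !old_supp !ffunE !eqxx (negbTE ac) (negbTE ca) !mulr0 !mulr1 addr0 add0r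
    negb_and !negbK !subr_eq0.
  rewrite /q; case: (lerP (x a / la) (x c / lc)) => _; apply/orP; [left|right].
    by rewrite divfK // gt_eqF.
  by rewrite divfK // gt_eqF.
case: ifP => [|Nd].
  rewrite inE ffunE => qn.
  have qp : 0 < q x by rewrite lt_neqAle eq_sym qn.
  have acx : [set a; c] \subset supp x.
    rewrite subUset !sub1set !inE !gt_eqF //; first exact: lt_le_trans (mulr_gt0 lc0 qp) qc.
    exact: lt_le_trans (mulr_gt0 la0 qp) qa.
  case: sK => _; apply; [exact: xK|by rewrite subUset sub|].
  by apply/set0Pn; exists a; rewrite !inE eqxx orbT.
case: sK => _; apply; [exact: xK|exact: sub|].
have /set0Pn[[u|]] := prob_supp pd; last by rewrite Nd.
by move=> ud; apply/set0Pn; exists u; rewrite inE.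
Qed.
End EdgeStar.

Definition crossing (U : finType) (K : {set {set U}}) (H : U -> R) :=
  [set e in K | [exists a, exists c, [&& e == [set a; c], H a < 0 & 0 < H c]]].

(* Induction on the number of edges that cross the hyperplane: starring such an edge at the
   intersection point removes it and creates no new one. *)
Lemma cut (U : finType) (K : {set {set U}}) (H : U -> R) : simplicial_complex K ->
  exists (W : finType) (K2 : {set {set W}}) (c : W -> {ffun U -> R}),
    [/\ simplicial_complex K2, asub K2 K c & forall s, s \in K2 -> sided c H s].
Proof.
have [n] := ubnP #|crossing K H|; elim: n U K H => // n IH U K H; rewrite ltnS => le sK.
have [c0|/set0Pn[e]] := eqVneq (crossing K H) set0.
  exists U, K, (@dirac R U); split=> //; first exact: asub_id.
  have hd u : \sum_v dirac R u v * H v = H u.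
    rewrite (bigD1 u) //= ffunE eqxx mul1r big1 ?addr0 // => v /negbTE vu.
    by rewrite ffunE vu mul0r.
  move=> s sin; have [/existsP[a /andP[as_ Ha]]|] := boolP [exists a, (a \in s) && (H a < 0)]; last first.
    rewrite negb_exists => /forallP h; left => u us; rewrite hd.
    by have := h u; rewrite us -leNgt.
  right => u us; rewrite hd leNgt; apply/negP => Hu.
  have : [set a; u] \in crossing K H.
    rewrite inE; apply/andP; split; last by apply/existsP; exists a; apply/existsP; exists u; rewrite eqxx Ha.
    case: sK => _; apply; [exact: sin|by rewrite subUset !sub1set as_|].
    by apply/set0Pn; exists a; rewrite !inE eqxx.
  by rewrite c0 inE.
rewrite inE => /andP[eK /existsP[a /existsP[c /and3P[/eqP ee Ha Hc]]]].
have ac : a != c by apply: contraTneq Ha => ->; rewrite -leNgt ltW.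
have D0 : 0 < H c - H a by lra.
(* These weights place the new vertex at the zero of [H] on the edge. *)
pose la := H c / (H c - H a); pose lc := - H a / (H c - H a).
have la0 : 0 < la by rewrite divr_gt0.
have lc0 : 0 < lc by rewrite divr_gt0 // oppr_gt0.
have lac : la + lc = 1 by rewrite -mulrDl divff // gt_eqF.
rewrite ee in eK.
have hs := edge_star_asub sK ac la0 lc0 lac; have sS := edge_star_complex a c sK.
set S := edge_star K a c in hs sS; set p := star_pt a c la lc in hs.
pose H' w := \sum_v p w v * H v.
have HS u : H' (Some u) = H u.
  rewrite /H' (bigD1 u) //= ffunE eqxx mul1r big1 ?addr0 // => v /negbTE vu.
  by rewrite ffunE vu mul0r.
have HN : H' None = 0.
  rewrite /H' (bigD1 a) //= (bigD1 c) 1?eq_sym //= !ffunE !eqxx (negbTE ac) eq_sym (negbTE ac).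
  rewrite big1 ?addr0; last by move=> v /andP[/negbTE va /negbTE vc]; rewrite !ffunE va vc !mulr0 addr0 mul0r.
  rewrite !mulr0 !mulr1 addr0 add0r /la /lc mulrAC [X in _ + X]mulrAC -mulrDl.
  by rewrite mulNr [H c * H a]mulrC subrr mul0r.
have [|W [K2 [f [sK2 hf sd]]]] := IH _ S H' _ sS.
  apply: leq_trans le.
  have sub : @old U @: crossing S H' \subset crossing K H :\ [set a; c].
    apply/subsetP => _ /imsetP[s sX ->]; move: sX; rewrite inE => /andP[sS' /existsP[w /existsP[w' /and3P[/eqP es]]]].
    case: w es => [u|]; last by rewrite HN ltxx.
    case: w' => [u'|]; last by rewrite HN ltxx.
    rewrite !HS => es Hu Hu'; have eo : old s = [set u; u'] by apply/setP => v; rewrite es !inE.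
    move: sS'; rewrite /S inE => /and3P[_ nac]; rewrite {1}es !inE /= => oK.
    rewrite oK /= andbC; apply/andP; split.
      by apply/existsP; exists u; apply/existsP; exists u'; rewrite eo eqxx Hu.
    by apply: contra nac => /eqP ->.
  have inj : {in crossing S H' &, injective (@old U)}.
    have noN s : s \in crossing S H' -> None \notin s.
      rewrite inE => /andP[_ /existsP[w /existsP[w' /and3P[/eqP -> ]]]].
      by case: w => [u|]; case: w' => [u'|]; rewrite ?HN ?ltxx // !inE.
    move=> s t /noN ns /noN nt /setP e'; apply/setP => -[v|]; last by rewrite (negbTE ns) (negbTE nt).
    by have := e' v; rewrite !inE.
  rewrite -(card_in_imset inj); apply: leq_ltn_trans (subset_leq_card sub) _.
  have eX : [set a; c] \in crossing K H.
    by rewrite inE eK; apply/existsP; exists a; apply/existsP; exists c; rewrite eqxx Ha.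
  by rewrite [X in (_ < X)%N](cardsD1 [set a; c]) eX.
exists W, K2, (fun w => push p (f w)); split=> //; first exact: asub_comp hf hs.
move=> s sin; have eH w : \sum_v push p (f w) v * H v = \sum_u f w u * H' u.
  under eq_bigr do rewrite ffunE mulr_suml.
  rewrite exchange_big; apply: eq_bigr => u _; rewrite mulr_sumr.
  by apply: eq_bigr => v _; rewrite mulrA.
by case: (sd s sin) => h; [left|right] => u us; rewrite eH h.
Qed.

(** The hyperplanes are treated one at a time; by [sided_refine] later subdivisions keep the sides
    obtained earlier. *)
Lemma cut_all (U T : finType) (K' : {set {set U}}) (b : U -> {ffun T -> R}) (Hs : seq {ffun T -> R}) :
  simplicial_complex K' ->
  exists (W : finType) (K2 : {set {set W}}) (c : W -> {ffun U -> R}),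
    [/\ simplicial_complex K2, asub K2 K' c &
        forall s H, s \in K2 -> H \in Hs -> sided (fun w => push b (c w)) H s].
Proof.
move=> sK'; elim: Hs => [|H Hs [W [K2 [c [sK2 h2 sd]]]]].
  by exists U, K', (@dirac R U); split=> //; exact: asub_id.
have [W' [K3 [c' [sK3 h3 sd']]]] := cut (fun w => \sum_v push b (c w) v * H v) sK2.
exists W', K3, (fun w => push c (c' w)); split=> //; first exact: asub_comp h3 h2.
have ep w : push b (push c (c' w)) = push (fun w => push b (c w)) (c' w) by rewrite push_push.
move=> s H0 sin; rewrite inE => /orP[/eqP ->|H0s].
  have e w : \sum_v push b (push c (c' w)) v * H v = \sum_u c' w u * \sum_v push b (c u) v * H v.
    rewrite ep; under eq_bigr do rewrite ffunE mulr_suml.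
    rewrite exchange_big; apply: eq_bigr => u _; rewrite mulr_sumr.
    by apply: eq_bigr => v _; rewrite mulrA.
  by case: (sd' s sin) => h; [left|right] => u us; rewrite e h.
have := sided_refine h3 (fun s sin => sd s H0 sin H0s) sin.
by case=> h; [left|right] => u us; rewrite ep h.
Qed.
End Moves.

(* [K2] is obtained from [K] by replacing [al * boundary be] by [boundary al * be];
   for [#|be| = 1] this is the starring of the facet [al]. *)
Record bistellar (T : finType) (K K2 : {set {set T}}) (al be : {set T}) : Prop := Bistellar {
  bi_K : simplicial_complex K; bi_K2 : simplicial_complex K2;
  bi_dis : [disjoint al & be]; bi_a : al != set0; bi_b : be != set0;
  bi_al : forall s : {set T}, s \in K -> al \subset s -> s \subset al :|: be;
  bi_be : forall s : {set T}, s \in K2 -> be \subset s -> s \subset al :|: be;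
  bi_nbe : be \notin K; bi_nal : al \notin K2;
  bi_old : forall s : {set T}, ~~ (al \subset s) -> ~~ (be \subset s) -> (s \in K) = (s \in K2);
  bi_new : forall t : {set T}, t \proper al -> be :|: t \in K2;
  bi_gone : forall t : {set T}, t \proper be -> al :|: t \in K }.

Lemma bistellar_sym (T : finType) (K K2 : {set {set T}}) al be :
  bistellar K K2 al be -> bistellar K2 K be al.
Proof.
case=> h1 h2 h3 h4 h5 h6 h7 h8 h9 h10 h11 h12; split=> //.
- by rewrite disjoint_sym.
- by move=> s; rewrite setUC; apply: h7.
- by move=> s; rewrite setUC; apply: h6.
- by move=> s n1 n2; rewrite h10.
Qed.

(** * The piecewise linear homeomorphism of a bistellar move *)

Section Shift.
Variable R : realType.
Lemma pushE (U T : finType) (b : U -> {ffun T -> R}) d v : push b d v = \sum_u d u * b u v.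
Proof. by rewrite ffunE. Qed.

Section Def.
Variables (T : finType) (al be : {set T}) (a0 : T).
Implicit Types x : {ffun T -> R}.
(* The homeomorphism removes the largest multiple of the barycentre of [al] and replaces it by the
   same mass at the barycentre of [be]. *)
Definition low x : R := x [arg min_(v < a0 in al) x v]%O.
Definition shift x : {ffun T -> R} :=
  [ffun v => x v - low x * (v \in al)%:R + low x * (#|al|%:R / #|be|%:R) * (v \in be)%:R].
Lemma shiftE x v : shift x v =
  x v - low x * (v \in al)%:R + low x * (#|al|%:R / #|be|%:R) * (v \in be)%:R.
Proof. by rewrite ffunE. Qed.

Hypotheses (a0al : a0 \in al) (dis : [disjoint al & be]) (be0 : be != set0).

Lemma low_ex x : exists2 v0, v0 \in al & low x = x v0 /\ forall v, v \in al -> low x <= x v.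
Proof. by rewrite /low; case: Order.TotalTheory.arg_minP => // v0 v0al h; exists v0. Qed.

Lemma lowE x v0 : v0 \in al -> (forall v, v \in al -> x v0 <= x v) -> low x = x v0.
Proof.
move=> v0al h; have [v val [e h']] := low_ex x; apply: le_anti; rewrite h' //= e.
exact: h.
Qed.

Lemma low_ge0 x : prob x -> 0 <= low x.
Proof. by case/probP=> x0 _; have [v _ [-> _]] := low_ex x. Qed.

Lemma in_be v : v \in be -> (v \in al) = false.
Proof. by move=> vb; rewrite (disjointFl dis). Qed.

Lemma card_be0 : 0 < #|be|%:R :> R.
Proof. by rewrite ltr0n card_gt0. Qed.

Lemma shift_prob x : prob x -> prob (shift x).
Proof.
move=> px; have [x0 x1] := probP _ px; have m0 := low_ge0 px; have [v0 _ [_ mle]] := low_ex x.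
apply/probP; split=> [v|].
  rewrite ffunE; apply: addr_ge0; last by rewrite !mulr_ge0 ?invr_ge0 ?ler0n.
  by case: (boolP (v \in al)) => val; rewrite ?mulr1 ?mulr0 ?subr0 // subr_ge0 mle.
under eq_bigr do rewrite ffunE.
have c (A : {set T}) : \sum_v (v \in A)%:R = #|A|%:R :> R.
  by rewrite -sum1_card natr_sum [RHS]big_mkcond; apply: eq_bigr => v _; case: ifP.
rewrite !big_split /= sumrN -!mulr_sumr !c x1.
by rewrite -[low x * _ * _]mulrA divfK ?subrK // gt_eqF // card_be0.
Qed.

Lemma shift_id x : low x = 0 -> shift x = x.
Proof. by move=> m0; apply/ffunP => v; rewrite ffunE m0 !mul0r subr0 addr0. Qed.
End Def.

Section Homeo.
Variables (T : finType) (K K2 : {set {set T}}) (al be : {set T}) (a0 b0 : T).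
Hypotheses (hbi : bistellar K K2 al be) (a0al : a0 \in al) (b0be : b0 \in be).
Let sK := bi_K hbi. Let sK2 := bi_K2 hbi. Let dis := bi_dis hbi.
Let be0 := bi_b hbi.

Lemma be_out s : s \in K -> ~~ (be \subset s).
Proof.
by move=> sin; apply: contra (bi_nbe hbi) => h; case: sK => _; apply; [exact: sin|exact: h|].
Qed.

(** If the least [al]-coordinate is positive, the face of [x] contains [al] and lies in [al :|: be].
    The shift kills exactly those coordinates in [al] that attain the minimum and makes all those in
    [be] positive, which gives a new face. *)
Lemma shift_pts x : pts K x -> pts K2 (shift al be a0 x).
Proof.
case/andP=> px xK; apply/andP; split; first exact: shift_prob.
have [x0 _] := probP _ px; have m0 := low_ge0 a0al px; have [v0 v0al [em mle]] := low_ex a0al x.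
have [e0|mn] := eqVneq (low al a0 x) 0.
  rewrite shift_id // -(bi_old hbi) ?be_out //; apply/subsetPn; exists v0 => //.
  by rewrite inE -em e0 eqxx.
have mp : 0 < low al a0 x by rewrite lt_neqAle eq_sym mn.
have alx : al \subset supp x.
  by apply/subsetP => v val; rewrite inE gt_eqF // (lt_le_trans mp) // mle.
have xsub := bi_al hbi xK alx.
set t := [set v in al | x v != low al a0 x].
have tal : t \proper al.
  rewrite properE; apply/andP; split; first by apply/subsetP => v; rewrite inE => /andP[].
  by apply/subsetPn; exists v0 => //; rewrite inE em eqxx andbF.
suff -> : supp (shift al be a0 x) = be :|: t by apply: (bi_new hbi).
apply/setP => v; rewrite !inE ffunE; have [vb|vb] := boolP (v \in be).
  rewrite (in_be dis vb) mulr0 subr0 mulr1 gt_eqF // ltr_wpDl // mulr_gt0 // divr_gt0 ?card_be0 //.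
  exact: (bi_a hbi).
rewrite mulr0 addr0; have [val|val] := boolP (v \in al); first by rewrite mulr1 subr_eq0.
rewrite mulr0 subr0 (@supp0 _ _ x v (al :|: be)) ?eqxx //.
by rewrite inE negb_or val.
Qed.

(** As [be] is not a face, some [be]-coordinate of [x] is 0. So the least [be]-coordinate after the
    shift is precisely the amount that was added. *)
Lemma shiftK x : pts K x -> shift be al b0 (shift al be a0 x) = x.
Proof.
case/andP=> px xK; have [x0 _] := probP _ px; have m0 := low_ge0 a0al px.
have /subsetPn[b bbe bx] := be_out xK.
have xb : x b = 0 by apply: supp0 bx.
set m := low al a0 x in m0; set y := shift al be a0 x.
have ybe v : v \in be -> y v = x v + m * (#|al|%:R / #|be|%:R).
  by move=> vb; rewrite ffunE (in_be dis vb) vb mulr0 subr0 mulr1.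
have my : low be b0 y = m * (#|al|%:R / #|be|%:R).
  have yb : y b = m * (#|al|%:R / #|be|%:R) by rewrite ybe // xb add0r.
  by rewrite (lowE b0be bbe) yb // => v vb; rewrite ybe // lerDr.
have an : #|al|%:R != 0 :> R by rewrite pnatr_eq0 cards_eq0 (bi_a hbi).
have bn : #|be|%:R != 0 :> R by rewrite pnatr_eq0 cards_eq0.
apply/ffunP => v; rewrite ffunE my /y ffunE -/m.
by field; rewrite an bn.
Qed.
End Homeo.

(* [shift] is linear where the least [al]-coordinate is attained at a fixed vertex, hence on every
   simplex after cutting along the hyperplanes [x v = x w] for [v], [w] in [al]. *)
Theorem bistellar_sphere (T : finType) (K K2 : {set {set T}}) (al be : {set T}) d :
  bistellar K K2 al be -> combinatorial_sphere R d K -> combinatorial_sphere R d K2.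
Proof.
move=> hbi /(sphere_asub R (bi_K hbi) (standard_sphere_complex _)) [U0 [K0 [b0 [g0 [sK0 hb0 hg0]]]]].
apply/(sphere_asub R (bi_K2 hbi) (standard_sphere_complex _)).
have sK := bi_K hbi; have sK2 := bi_K2 hbi; have dis := bi_dis hbi.
have /set0Pn[ax axal] := bi_a hbi; have /set0Pn[bx bxbe] := bi_b hbi.
pose Hs : seq {ffun T -> R} := [seq [ffun v => (v == p.1)%:R - (v == p.2)%:R] | p <- enum (setX al al)].
have [U [K' [c [sK' hc sd]]]] := cut_all b0 Hs sK0.
have hb := asub_comp sK0 hc hb0; have hg := asub_comp sK0 hc hg0.
set b := (fun w => push b0 (c w)) in hb sd.
exists U, K', (fun u => shift al be ax (b u)), (fun u => push g0 (c u)); split=> //.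
have hv s v w : s \in K' -> v \in al -> w \in al ->
    (forall u, u \in s -> b u w <= b u v) \/ (forall u, u \in s -> b u v <= b u w).
  move=> sin val wal; have := sd s [ffun i => (i == v)%:R - (i == w)%:R] sin.
  have e u : \sum_i b u i * [ffun i => (i == v)%:R - (i == w)%:R : R] i = b u v - b u w.
    under eq_bigr do rewrite ffunE mulrBr.
    rewrite sumrB (bigD1 v) //= (bigD1 w (P := predT)) //= !eqxx !mulr1.
    by rewrite !big1 ?addr0 // => i /negbTE ->; rewrite mulr0.
  case; first by apply/mapP; exists (v, w); rewrite ?mem_enum ?inE ?val.
    by move=> h; left => u /h; rewrite e subr_ge0.
  by move=> h; right => u /h; rewrite e subr_le0.
have low_s s : s \in K' -> exists2 v0, v0 \in al & forall u v, u \in s -> v \in al -> b u v0 <= b u v.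
  (* Any two coordinates in [al] compare in the same way at all vertices of [s]; hence a coordinate
     whose sum over [s] is least is least at every vertex. *)
  move=> sin; case: (Order.TotalTheory.arg_minP (fun v => \sum_(u in s) b u v) axal) => v0 v0al hm.
  exists v0 => // u v us val; have [h|h] := hv s v v0 sin val v0al; first exact: h.
  have e : \sum_(w in s) (b w v0 - b w v) = 0.
    apply: le_anti; rewrite sumr_ge0 ?andbT; last by move=> w ws; rewrite subr_ge0 h.
    by rewrite sumrB subr_le0 hm.
  move/eqP: e; rewrite psumr_eq0; last by move=> w ws; rewrite subr_ge0 h.
  by move/allP/(_ u (mem_index_enum _)); rewrite us subr_eq0 => /eqP ->.
have lin s d' : s \in K' -> prob d' -> supp d' \subset s ->
    shift al be ax (push b d') = push (fun u => shift al be ax (b u)) d'.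
  move=> sin pd ds; have [v0 v0al h0] := low_s s sin.
  have lb u : u \in s -> low al ax (b u) = b u v0.
    by move=> us; apply: (lowE axal v0al) => v val; apply: h0.
  have d0 u : 0 <= d' u by case/probP: pd.
  have lp : low al ax (push b d') = \sum_u d' u * b u v0.
    rewrite (lowE axal v0al) ?pushE // => v val; rewrite !pushE; apply: ler_sum => u _.
    have [us|us] := boolP (u \in s); last by rewrite (supp0 ds us) !mul0r.
    by rewrite ler_wpM2l // h0.
  apply/ffunP => v; rewrite shiftE lp !pushE !mulr_suml -sumrB -big_split; apply: eq_bigr => u _ /=.
  have [us|us] := boolP (u \in s); last by rewrite (supp0 ds us) !mul0r subrr addr0.
  by rewrite shiftE lb //; ring.
split.
- move=> s sin; have [t tK st] := as_face hb sin; have [v0 v0al h0] := low_s s sin.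
  have lb u : u \in s -> low al ax (b u) = b u v0.
    by move=> us; apply: (lowE axal v0al) => v val; apply: h0.
  have [alt|/subsetPn[v val vt]] := boolP (al \subset t).
    exists (be :|: (al :\ v0)); first by apply: (bi_new hbi); apply: properD1.
    move=> u us; have [pb sb] := st u us; split; first by apply: shift_prob => //; exact: bi_b hbi.
    apply/subsetP => v; rewrite inE shiftE lb //; apply: contraR; rewrite !inE !negb_or negb_and negbK.
    case/andP => vb; rewrite (negbTE vb) mulr0 addr0; case/orP => [/eqP ->|val].
      by rewrite v0al mulr1 subrr.
    rewrite (negbTE val) mulr0 subr0; apply/eqP; apply: supp0 sb _.
    by apply: contra vb => vt; have := subsetP (bi_al hbi tK alt) v vt; rewrite inE (negbTE val).
  exists t; first by rewrite -(bi_old hbi) ?(be_out hbi tK) //; apply/subsetPn; exists v.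
  move=> u us; have [pb sb] := st u us; rewrite shift_id //.
  apply: le_anti; rewrite (low_ge0 axal pb) andbT; have [v1 _ [_ hle]] := low_ex axal (b u).
  by rewrite -(supp0 sb vt) hle.
- move=> d1 d2 dK1 dK2; have [p1 s1] := andP dK1; have [p2 s2] := andP dK2.
  rewrite -(lin _ _ s1 p1 (subxx _)) -(lin _ _ s2 p2 (subxx _)) => e.
  apply: (as_inj hb) => //; have q1 := push_pts sK hb dK1; have q2 := push_pts sK hb dK2.
  by rewrite -(shiftK hbi axal bxbe q1) e (shiftK hbi axal bxbe q2).
move=> y yK2; have hbi' := bistellar_sym hbi.
have xK := shift_pts hbi' bxbe yK2; have [d' dK' ed] := as_surj hb xK.
exists d' => //; have [p1 s1] := andP dK'.
by rewrite -(lin _ _ s1 p1 (subxx _)) ed (shiftK hbi' bxbe axal yK2).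
Qed.
End Shift.

Local Close Scope ring_scope.

(** * Tetrahedra and flips of nine-vertex manifolds *)

Section Links.
Variable T : finType.
Implicit Types (M N : {set {set T}}) (s t : {set T}).

Lemma mem_link M v t : simplicial_complex M ->
  (t \in link M [set v]) = [&& t != set0, v \notin t & v |: t \in M].
Proof.
case=> M0 cM; rewrite inE disjoints1; apply/and3P/and3P => -[h1 h2 h3]; split=> //.
  by apply: contra M0 => /eqP <-.
exact: cM h3 (subsetU1 _ _) h1.
Qed.

Lemma link_complex M v : simplicial_complex M -> simplicial_complex (link M [set v]).
Proof.
move=> sM; split; first by rewrite mem_link // eqxx.
move=> s t; rewrite !mem_link // => /and3P[s0 vs sin] ts t0; rewrite t0 /=; apply/andP; split.
  by apply: contra vs; apply: (subsetP ts).
case: sM => _; apply; [exact: sin|exact: setUS|].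
by apply/set0Pn; exists v; rewrite !inE eqxx.
Qed.

Lemma bistellar_link M N al be w : bistellar M N al be -> w \in al -> al :\ w != set0 ->
  bistellar (link M [set w]) (link N [set w]) (al :\ w) be.
Proof.
move=> h wal al0; have sM := bi_K h; have sN := bi_K2 h; have dis := bi_dis h.
have wbe : w \notin be by rewrite (disjointFr dis).
have subal t : (al \subset w |: t) = (al :\ w \subset t) by rewrite subDset.
have subbe t : (be \subset w |: t) = (be \subset t).
  rewrite -subDset (_ : be :\: _ = be) //.
  by apply/setDidPl; rewrite disjoint_sym disjoints1.
have be_al t : w \notin t -> w |: t \subset al :|: be -> t \subset al :\ w :|: be.
  move=> wt /subsetP sub; apply/subsetP => y yt; have := sub y (setU1r _ yt).
  by rewrite !inE; case: eqP => // e; rewrite -e yt in wt.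
split; try exact: link_complex.
- by apply: disjointWl dis; apply: subsetDl.
- exact: al0.
- exact: bi_b h.
- move=> t; rewrite mem_link // => /and3P[_ wt tM]; rewrite -subal => /(bi_al h tM).
  exact: be_al.
- move=> t; rewrite mem_link // => /and3P[_ wt tN]; rewrite -subbe => /(bi_be h tN).
  exact: be_al.
- apply: contra (bi_nbe h); rewrite mem_link // => /and3P[b0 _ bM].
  by case: sM => _; apply; [exact: bM|exact: subsetU1|].
- by apply: contra (bi_nal h); rewrite mem_link // setD1K // => /and3P[].
- move=> t nal nbe; rewrite !mem_link //; congr [&& _, _ & _].
  by apply: (bi_old h); rewrite ?subal ?subbe.
- move=> t tal; rewrite mem_link //; apply/and3P; split.
  + by have /set0Pn[y yb] := bi_b h; apply/set0Pn; exists y; rewrite inE yb.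
  + rewrite inE negb_or wbe /=; apply/negP => wt.
    by have := subsetP (proper_sub tal) w wt; rewrite !inE eqxx.
  rewrite setUCA; apply: (bi_new h); rewrite properE subUset sub1set wal /=; apply/andP; split.
    exact: subset_trans (proper_sub tal) (subsetDl _ _).
  by rewrite subal; case/andP: tal.
move=> t tbe; rewrite mem_link //; apply/and3P; split.
+ by have /set0Pn[y yb] := al0; apply/set0Pn; exists y; rewrite inE yb.
+ rewrite !inE eqxx /=; apply: contra wbe; exact: (subsetP (proper_sub tbe)).
by rewrite setUA setD1K // (bi_gone h).
Qed.

Lemma link_same M N al be w : bistellar M N al be -> w \notin al :|: be -> link M [set w] = link N [set w].
Proof.
move=> h wn; have sM := bi_K h; have sN := bi_K2 h.
have noM (s : {set T}) : w |: s \in M -> ~~ (al \subset w |: s) && ~~ (be \subset w |: s).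
  move=> sin; apply/andP; split; apply/negP => sub.
    by case/negP: wn; apply: (subsetP (bi_al h sin sub)); rewrite !inE eqxx.
  case/negP: (bi_nbe h); case: sM => _; apply; [exact: sin|exact: sub|exact: bi_b h].
have noN (s : {set T}) : w |: s \in N -> ~~ (al \subset w |: s) && ~~ (be \subset w |: s).
  move=> sin; apply/andP; split; apply/negP => sub.
    case/negP: (bi_nal h); case: sN => _; apply; [exact: sin|exact: sub|exact: bi_a h].
  by case/negP: wn; apply: (subsetP (bi_be h sin sub)); rewrite !inE eqxx.
apply/setP => t; rewrite !mem_link //; congr [&& _, _ & _].
by apply/idP/idP => tin; [have /andP[h1 h2] := noM _ tin; rewrite -(bi_old h)
                         |have /andP[h1 h2] := noN _ tin; rewrite (bi_old h)].
Qed.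

Section Manifold.
Variables (R : realType) (M : {set {set T}}).
Hypotheses (sM : simplicial_complex M) (hL : forall v, v \in vertices M -> sphere2 (link M [set v])).
Definition tets3 (K : {set {set T}}) := [set s in K | #|s| == 4].
Local Notation V := (vertices M).
Local Notation X := (tets3 M).

Lemma face_vertex s v : s \in M -> v \in s -> v \in V.
Proof.
move=> sin vs; rewrite inE; case: sM => _; apply; [exact: sin|by rewrite sub1set|].
by apply/set0Pn; exists v; rewrite inE.
Qed.

Lemma face_sub s t : s \in M -> t \subset s -> t != set0 -> t \in M.
Proof. by case: sM => _; apply. Qed.

Lemma face_nonempty s : s \in M -> exists v, v \in s.
Proof. by move=> sin; apply/set0Pn; case: sM => + _; apply: contra => /eqP <-. Qed.

Lemma link_pure v t : v \in V -> t \in link M [set v] -> exists2 t', t' \in tris (link M [set v]) & t \subset t'.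
Proof.
move=> vV; have [h1 h2 h3 _ _] := hL vV; exact: pure_dim2 (link_complex v sM) h1 h2 h3 t.
Qed.

Lemma tri_tet v t : (t \in tris (link M [set v])) = (v \notin t) && (v |: t \in X).
Proof.
rewrite inE mem_link //; have [vt|vt] := boolP (v \in t); first by rewrite andbF.
rewrite inE cardsU1 vt /= add1n eqSS; have [t3|_] := eqVneq #|t| 3; last by rewrite !andbF.
by rewrite -card_gt0 t3 /= !andbT.
Qed.

Lemma dim_le4 s : s \in M -> #|s| <= 4.
Proof.
move=> sin; have [v vs] := face_nonempty sin; rewrite (cardsD1 v) vs ltnS.
have [->|n0] := eqVneq (s :\ v) set0; first by rewrite cards0.
apply: (s2_dim (hL (face_vertex sin vs))); rewrite mem_link // n0 !inE eqxx /= setD1K //.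
Qed.

Lemma pure_tet s : s \in M -> exists2 t, t \in X & s \subset t.
Proof.
move=> sin; have [v vs] := face_nonempty sin; have vV := face_vertex sin vs.
have [t' tl st] : exists2 t', t' \in link M [set v] & s :\ v \subset t'.
  have [->|n0] := eqVneq (s :\ v) set0; last first.
    by exists (s :\ v); rewrite // mem_link // n0 !inE eqxx /= setD1K.
  have : link M [set v] != set0.
    by apply: contraPneq (s2_euler (hL vV)) => ->; rewrite big_set0.
  by case/set0Pn => t' h; exists t' => //; apply: sub0set.
have [t] := link_pure vV tl; rewrite tri_tet => /andP[vt tX] tt.
exists (v |: t) => //; rewrite -(setD1K vs) setUS //; exact: subset_trans tt.
Qed.

Lemma tetP t : reflect (t \in M /\ #|t| = 4) (t \in X).
Proof. by rewrite inE; apply: (iffP andP) => -[h /eqP]. Qed.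

Lemma apexes s v : v \in s -> s \in M -> #|s| = 3 ->
  #|[set t in tris (link M [set v]) | s :\ v \subset t]| = 2.
Proof.
move=> vs sin s3; have vV := face_vertex sin vs.
have e2 : #|s :\ v| = 2 by have := s3; rewrite (cardsD1 v) vs => -[].
apply: (s2_edge (hL vV)) => //; rewrite mem_link // !inE eqxx setD1K // sin andbT /=.
by rewrite -card_gt0 e2.
Qed.

Lemma apex_tri s v x : v \in s -> x \notin s -> x |: s \in X ->
  x |: (s :\ v) \in [set t in tris (link M [set v]) | s :\ v \subset t].
Proof.
move=> vs xs xX; rewrite in_set subsetU1 andbT tri_tet setUCA setD1K // xX andbT in_setU1 in_setD1 eqxx orbF.
by apply: contra xs => /eqP <-.
Qed.

Lemma apex_inj s x y : x \notin s -> y \notin s -> x |: s = y |: s -> x = y.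
Proof.
move=> xs ys /setP/(_ x); rewrite !inE eqxx /= => /esym/orP[/eqP //|h].
by rewrite h in xs.
Qed.

Lemma card_base s x : x \notin s -> x |: s \in X -> #|s| = 3 /\ s \in M.
Proof.
move=> xs /tetP[xM]; rewrite cardsU1 xs add1n => -[s3]; split=> //.
by apply: face_sub xM (subsetU1 _ _) _; rewrite -card_gt0 s3.
Qed.

Lemma apex_ex s x : x \notin s -> x |: s \in X -> exists y, [/\ y \notin s, y != x & y |: s \in X].
Proof.
move=> xs xX; have [s3 sin] := card_base xs xX; have [v vs] := face_nonempty sin.
have := apexes vs sin s3; rewrite (cardsD1 (x |: (s :\ v))) apex_tri // => -[] /eqP/cards1P[t et].
have : t \in [set t in tris (link M [set v]) | s :\ v \subset t] :\ (x |: s :\ v) by rewrite et inE.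
rewrite in_setD1 in_set => /and3P[tx /trisP[tl t3] st].
have : #|t :\: (s :\ v)| = 1.
  by rewrite cardsD (setIidPr st) t3; have := s3; rewrite (cardsD1 v) vs add1n => -[->].
move=> /eqP/cards1P[y ey]; have : y \in t :\: (s :\ v) by rewrite ey inE.
rewrite inE => /andP[ysv yt]; have tE : t = y |: s :\ v.
  by rewrite -(setID t (s :\ v)) (setIidPr st) ey setUC.
have := tl; rewrite mem_link // => /and3P[_ vt vtM].
have ys : y \notin s.
  by move: ysv; rewrite !inE negb_and negbK => /orP[/eqP e|//]; rewrite -e yt in vt.
exists y; split=> //; first by apply: contra tx => /eqP <-; apply/eqP.
have e : v |: t = y |: s by rewrite tE setUCA setD1K.
by apply/tetP; rewrite -e; split=> //; rewrite e cardsU1 ys s3.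
Qed.

Lemma apex_le2 s x y z : x \notin s -> y \notin s -> z \notin s ->
  x |: s \in X -> y |: s \in X -> z |: s \in X -> x != y -> x != z -> y = z.
Proof.
move=> xs ys zs xX yX zX xy xz; have [s3 sin] := card_base xs xX; have [v vs] := face_nonempty sin.
have inj a b : a \notin s -> b \notin s -> a |: s :\ v = b |: s :\ v -> a = b.
  move=> as_ bs e; apply: (apex_inj as_ bs); rewrite -(setD1K vs) setUCA e setUCA //.
have := apexes vs sin s3; rewrite (cardsD1 (x |: (s :\ v))) apex_tri // => -[] /eqP/cards1P[t et].
have inr a : a \notin s -> a |: s \in X -> x != a -> a |: s :\ v = t.
  move=> as_ aX xa; apply/set1P; rewrite -et in_setD1 apex_tri // andbT.
  by apply: contra xa => /eqP /inj -> .
by apply: inj => //; rewrite !inr.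
Qed.

Lemma nbrsP u y : u \in V -> (y \in nbrs X u) = ([set y] \in link M [set u]).
Proof.
move=> uV; rewrite mem_link // !inE; apply/andP/and3P => [[yu /existsP[t /and3P[tX ut yt]]]|[_ uy uyM]].
  split; [by apply/set0Pn; exists y; rewrite inE|by rewrite eq_sym|].
  have [tM _] := tetP _ tX; apply: face_sub tM _ _; first by rewrite subUset !sub1set ut yt.
  by apply/set0Pn; exists u; rewrite !inE eqxx.
split; first by rewrite eq_sym.
have [t tX ut] := pure_tet uyM; apply/existsP; exists t; rewrite tX.
by rewrite !(subsetP ut) // !inE eqxx ?orbT.
Qed.

Lemma tets_at_tris u : u \in V -> #|tets_at X u| = #|tris (link M [set u])|.
Proof.
move=> uV; have -> : tris (link M [set u]) = [set t :\ u | t in tets_at X u].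
  apply/setP => t; rewrite tri_tet; apply/andP/imsetP => [[ut tX]|[t' + ->]].
    by exists (u |: t); rewrite ?setU1K // inE tX setU11.
  by rewrite in_set => /andP[tX ut]; rewrite setD1K // in_setD1 eqxx.
rewrite card_in_imset // => t t'; rewrite !inE => /andP[_ ut] /andP[_ ut'] e.
by rewrite -(setD1K ut) e setD1K.
Qed.

(** In the link, f0 - f1 + f2 = 2 and, by counting incident edges and triangles, 3 * f2 = 2 * f1;
    hence f2 = 2 * f0 - 4. *)
Lemma euler_link u : u \in V -> #|tets_at X u| + 4 = #|nbrs X u|.*2.
Proof.
move=> uV; set K := link M [set u]; have [d3 _ he hx _] := hL uV; rewrite -/K in d3 he hx.
rewrite tets_at_tris // -/K.
have sK : simplicial_complex K := link_complex u sM.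
pose E := [set s in K | #|s| == 2].
have vE : #|nbrs X u| = #|[set s in K | #|s| == 1]|.
  have -> : [set s in K | #|s| == 1] = [set [set y] | y in nbrs X u].
    apply/setP => s; rewrite in_set; apply/andP/imsetP => [[sK' /cards1P[y e]]|[y yn ->]].
      by exists y; rewrite // nbrsP // -e.
    by rewrite nbrsP // in yn; rewrite cards1; split.
  by rewrite card_imset //; apply: set1_inj.
have dc : 3 * #|tris K| = 2 * #|E|.
  have -> : 2 * #|E| = \sum_(e in E) #|[set t in tris K | e \subset t]|.
    rewrite mulnC -sum_nat_const; apply: eq_bigr => e; rewrite inE => /andP[eK /eqP e2].
    by rewrite he.
  have -> : 3 * #|tris K| = \sum_(t in tris K) #|[set e in E | e \subset t]|.
    rewrite mulnC -sum_nat_const; apply: eq_bigr => t /trisP[tK t3].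
    have -> : [set e in E | e \subset t] = [set e : {set T} | (e \subset t) && (#|e| == 2)].
      apply/setP => e; rewrite [RHS]in_set in_set [e \in E]in_set; case: (boolP (e \subset t)); rewrite ?andbF //= => et.
      case: (boolP (#|e| == 2)); rewrite ?andbF ?andbT //= => /eqP e2.
      by apply: sK.2 tK et _; rewrite -card_gt0 e2.
    by rewrite cards_draws t3.
  transitivity (\sum_(t in tris K) \sum_(e in E) (e \subset t : nat)).
    by apply: eq_bigr => t _; rewrite -sum1dep_card big_mkcondr; apply: eq_bigr => e _; case: ifP.
  rewrite exchange_big; apply: eq_bigr => e _.
  by rewrite -sum1dep_card big_mkcondr; apply: eq_bigr => t _; case: ifP.
have sp : (\sum_(s in K) (-1) ^+ #|s| = - (#|[set s in K | #|s| == 1]|)%:Z + (#|E|)%:Z - (#|tris K|)%:Z)%R.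
  have cst (k : nat) : (\sum_(s in K | #|s| == k) (-1) ^+ #|s| = (-1) ^+ k * (#|[set s in K | #|s| == k]|)%:Z :> int)%R.
    rewrite (eq_bigr (fun=> (-1) ^+ k)%R); last by move=> s /andP[_ /eqP ->].
    by rewrite sumr_const -[LHS]mulr_natr natz cardsE.
  rewrite (bigID (fun s : {set T} => #|s| == 1)) /= cst; rewrite expr1 mulN1r -addrA; congr (_ + _)%R.
  rewrite (bigID (fun s : {set T} => #|s| == 2)) /=; congr (_ + _)%R.
    rewrite -[RHS]mul1r -(sqrr_sign int 1) -exprM mul1n -/(_ ^+ 2)%R -cst; apply: eq_bigl => s.
    by case: eqP => [->|]; rewrite ?andbF ?andbT.
  have m3 : ((-1) ^+ 3 = -1 :> int)%R by []; rewrite -[RHS]mulN1r -[X in _ = (X * _)%R]m3 -cst; apply: eq_bigl => s.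
  case: (boolP (s \in K)) => //= sin; have := d3 s sin.
  have : 0 < #|s| by rewrite card_gt0 (face_neq0 sK).
  by case: #|s| => [|[|[|[|k]]]].
rewrite hx in sp; rewrite vE; move: sp dc.
move: #|E| #|tris K| #|[set s in K | #|s| == 1]| => a b c; lia.
Qed.

Lemma manifold_ok : manifold_tets V X.
Proof.
split.
- by move=> t /tetP[].
- by move=> t /tetP[tM _]; apply/subsetP => v; apply: face_vertex.
- by move=> v; rewrite inE => /pure_tet[t tX]; rewrite sub1set; exists t.
- exact: apex_ex.
- exact: apex_le2.
- move=> u Z uV ZX /set0Pn[t0 t0Z] cZ; have [_ _ _ _ sc] := hL uV.
  have Zu t : t \in Z -> t \in X /\ u \in t by move/(subsetP ZX); rewrite inE => /andP[].
  pose Z' := [set t :\ u | t in Z].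
  have eZ' : Z' = tris (link M [set u]).
    apply: sc.
    + apply/subsetP => _ /imsetP[t tZ ->]; have [tX ut] := Zu t tZ.
      by rewrite tri_tet in_setD1 eqxx setD1K.
    + by apply/set0Pn; exists (t0 :\ u); apply: imset_f.
    move=> _ t' /imsetP[s sZ ->] t't lt; have [sX us] := Zu s sZ.
    move: (t't); rewrite tri_tet => /andP[ut' t'X].
    have s'3 : #|s :\ u| = 3 by have [_] := tetP _ sX; rewrite (cardsD1 u) us => -[].
    have t'3 : #|t'| = 3 by have [_] := tetP _ t'X; rewrite cardsU1 ut' => -[].
    have [<-|ne] := eqVneq (s :\ u) t'; first exact: imset_f.
    have i2 : #|(s :\ u) :&: t'| = 2.
      apply/eqP; rewrite eqn_leq lt andbT -ltnS -[X in _ < X]s'3; apply: proper_card.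
      rewrite properEneq subsetIl andbT; apply: contra ne => /eqP e.
      by rewrite eqEcard s'3 t'3 leqnn andbT -e subsetIr.
    have /eqP/cards1P[x ex] : #|(s :\ u) :\: t'| = 1 by rewrite cardsD i2 s'3.
    have /eqP/cards1P[w ew] : #|t' :\: (s :\ u)| = 1 by rewrite cardsD setIC i2 t'3.
    have : x \in (s :\ u) :\: t' by rewrite ex inE.
    rewrite !inE => /and3P[xt' xu xs].
    have : w \in t' :\: (s :\ u) by rewrite ew inE.
    rewrite !inE negb_and negbK => /andP[wsu wt'].
    have wu : w != u by apply: contra ut' => /eqP <-.
    rewrite (negbTE wu) /= in wsu.
    (* The member [s2] of [Z] across [s :\ x] and the tetrahedron [u |: t'] both contain this
       triangle and differ from [s]; since it has only two apexes, they coincide. *)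
    have [s2 s2Z /andP[ns2 sub]] := cZ s x sZ xs xu.
    have [s2X us2] := Zu s2 s2Z.
    have bs : #|s :\ x| = 3 by have [_] := tetP _ sX; rewrite (cardsD1 x) xs => -[].
    have /eqP/cards1P[y ey] : #|s2 :\: (s :\ x)| = 1.
      by rewrite cardsD (setIidPr sub) bs; have [_ ->] := tetP _ s2X.
    have s2E : s2 = y |: (s :\ x) by rewrite -(setID s2 (s :\ x)) (setIidPr sub) ey setUC.
    have ysx : y \notin s :\ x.
      suff : y \in s2 :\: (s :\ x) by rewrite in_setD => /andP[].
      by rewrite ey inE.
    have wE : u |: t' = w |: (s :\ x).
      have tE : t' = w |: ((s :\ u) :&: t') by rewrite -[LHS](setID t' (s :\ u)) ew setUC setIC.
      have iE : (s :\ u) :&: t' = (s :\ u) :\ x.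
        by rewrite -[in RHS](setID (s :\ u) t') ex setUC setU1K // !inE negb_and xt' orbT.
      rewrite tE iE setUCA; congr (_ |: _); apply/setP => i; rewrite !inE.
      by case: (eqVneq i u) => [->|] //=; rewrite us andbT eq_sym.
    have wsx : w \notin s :\ x by rewrite !inE negb_and wsu orbT.
    have xsx : x \notin s :\ x by rewrite !inE eqxx.
    have yw : y = w.
      apply: (@apex_le2 (s :\ x) x) => //; rewrite ?setD1K // -?s2E -?wE //.
        by apply: contra ns2 => /eqP e; rewrite s2E -e setD1K.
      by apply: contra wsu => /eqP <-.
    have <- : s2 :\ u = t' by rewrite s2E yw -wE setU1K.
    exact: imset_f.
  apply/eqP; rewrite eqEsubset ZX; apply/subsetP => t; rewrite inE => /andP[tX ut].
  have : t :\ u \in Z' by rewrite eZ' tri_tet in_setD1 eqxx setD1K.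
  case/imsetP => s sZ e; have [_ us] := Zu s sZ.
  by rewrite -(setD1K ut) e setD1K.
exact: euler_link.
Qed.
End Manifold.
End Links.

(** * Flips, their facets and the missing edges *)

Section Flip.
Variable T : finType.
Implicit Types (M N : {set {set T}}) (s t al be : {set T}).

Definition flip M al be :=
  [set t | (t \in M) && ~~ (al \subset t) || (be \subset t) && (t :\: be \proper al)].

Lemma flip_bistellar M al be : simplicial_complex M -> [disjoint al & be] -> al != set0 -> be != set0 ->
  (forall s, s \in M -> al \subset s -> s \subset al :|: be) -> be \notin M ->
  (forall t, t \proper be -> al :|: t \in M) -> bistellar M (flip M al be) al be.
Proof.
move=> sM dis a0 b0 hal nbe gone.
have albe t : al \subset t -> al \subset t :\: be.
  by rewrite subsetD => ->.
split=> //.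
- split; first by rewrite in_set !subset0 (negbTE b0) /= orbF (negbTE sM.1).
  move=> t u; rewrite !in_set => /orP[/andP[tM nal] ut u0|/andP[bt tal] ut u0].
    by rewrite (sM.2 _ _ tM ut u0) (contra (fun h => subset_trans h ut) nal).
  have ual : u :\: be \proper al by apply: sub_proper_trans tal; apply: setSD.
  case: (boolP (be \subset u)) => bu; first by rewrite ual orbT.
  rewrite orbF; apply/andP; split; last first.
    by apply/negP => /albe h; case/andP: ual => _; rewrite h.
  have h : al :|: (be :&: u) \in M.
    apply: gone; rewrite properEneq subsetIl andbT.
    by apply: contra bu => /eqP <-; apply: subsetIr.
  apply: sM.2 h _ u0; rewrite -{1}(setID u be) setUC setIC; apply: setSU.
  exact: proper_sub.
- move=> t; rewrite in_set => /orP[/andP[tM _] bt|/andP[_ tal] bt].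
    by case/negP: nbe; apply: sM.2 tM bt b0.
  rewrite -(setID t be) setUC; apply: setUSS; [exact: proper_sub|exact: subsetIr].
- rewrite in_set subxx andbF /=; apply/negP => /andP[ba _]; case/negP: b0.
  by rewrite -subset0 -(disjoint_setI0 dis) subsetI ba subxx.
- by move=> s nal nbs; rewrite in_set nal (negbTE nbs) orbF andbT.
move=> t tal; rewrite in_set subsetUl /= orbC; apply/orP; left.
by apply: sub_proper_trans tal; rewrite setDUl setDv set0U subsetDl.
Qed.

Lemma card_gt1_nsub1 al (v : T) : 1 < #|al| -> ~~ (al \subset [set v]).
Proof. by move=> a1; apply/negP => /subset_leq_card; rewrite cards1 leqNgt a1. Qed.

Section Bistellar.
Variables (M N : {set {set T}}) (al be : {set T}).
Hypothesis h : bistellar M N al be.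
Let sM := bi_K h.
Let sN := bi_K2 h.

Lemma bistellar_out t : t \in M -> ~~ (be \subset t).
Proof. by move=> tM; apply: contra (bi_nbe h) => bt; apply: sM.2 tM bt (bi_b h). Qed.
Lemma bistellar_out2 t : t \in N -> ~~ (al \subset t).
Proof. by move=> tN; apply: contra (bi_nal h) => bt; apply: sN.2 tN bt (bi_a h). Qed.

Lemma bistellar_al : al \in M.
Proof. by rewrite -[al]setU0 (bi_gone h) // proper0 (bi_b h). Qed.

Lemma bistellar_vertices : 1 < #|al| -> 1 < #|be| -> vertices N = vertices M.
Proof.
by move=> a1 b1; apply/setP => v; rewrite !in_set (bi_old h) // card_gt1_nsub1.
Qed.

(** The link of a vertex of [al] or [be] changes by a bistellar move and all other links stay the
    same. The conditions on the sizes preserve the vertex set and keep both sides of the induced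
    moves non-empty. *)
Lemma bistellar_manifold (R : realType) d : 1 < #|al| -> 1 < #|be| ->
  combinatorial_manifold R d.+1 M -> combinatorial_manifold R d.+1 N.
Proof.
move=> a1 b1 [_ hL]; split=> // v; rewrite bistellar_vertices // => /hL.
have nz t : 1 < #|t| -> v \in t -> t :\ v != set0.
  by move=> t1 vt; rewrite -card_gt0 -ltnS; have := t1; rewrite (cardsD1 v) vt.
have [val|val] := boolP (v \in al).
  exact: (bistellar_sphere (bistellar_link h val (nz _ a1 val))).
have [vbe|vbe] := boolP (v \in be).
  exact: (bistellar_sphere (bistellar_sym (bistellar_link (bistellar_sym h) vbe (nz _ b1 vbe)))).
by rewrite (link_same h) // in_setU negb_or val.
Qed.
End Bistellar.

Lemma facetP M t : reflect (t \in M /\ forall u, u \in M -> t \subset u -> t = u) (t \in facets M).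
Proof.
rewrite in_set; apply: (iffP andP) => -[tM hm]; split=> //.
  by move=> u uM tu; have /forallP/(_ u) := hm; rewrite uM tu => /eqP.
by apply/forallP => u; apply/implyP => uM; apply/implyP => tu; rewrite (hm u uM tu).
Qed.

(** A face of [N] that contains both [t] and [be] would put [t] into the face [al :|: (be :&: t)] of
    [M], and by maximality [t] would contain [al]. *)
Lemma bistellar_facet M N al be t : bistellar M N al be -> t \in facets M -> ~~ (al \subset t) -> t \in facets N.
Proof.
move=> h /facetP[tM mx] nal; have nbe := bistellar_out h tM.
apply/facetP; split; first by rewrite -(bi_old h).
move=> u uN tu; have nalu := bistellar_out2 h uN.
have [bu|bu] := boolP (be \subset u); last by apply: mx; rewrite ?(bi_old h).
case/negP: nal; have tE : t \subset al :|: (be :&: t).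
  have := subset_trans tu (bi_be h uN bu); rewrite -!subDset => sub.
  by rewrite subsetI sub subsetDl.
rewrite (mx _ _ tE) ?subsetUl //; apply: (bi_gone h); rewrite properEneq subsetIl andbT.
by apply: contra nbe => /eqP <-; apply: subsetIr.
Qed.

Lemma bistellar_facets M N al be : bistellar M N al be ->
  facets M = [set s in facets N | ~~ (be \subset s)] :|: [set al :|: (be :\ v) | v in be].
Proof.
move=> h; have sM := bi_K h; apply/setP => t; rewrite in_setU in_set.
apply/idP/orP => [tF|[/andP[tF nbe]|/imsetP[v vbe ->]]].
- have [tM mx] := facetP _ _ tF.
  have [alt|nal] := boolP (al \subset t); last first.
    by left; rewrite (bistellar_facet h tF nal) (bistellar_out h tM).
  right; have /subsetPn[v vb vt] := bistellar_out h tM.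
  apply/imsetP; exists v => //; apply: mx; first by rewrite (bi_gone h) // properD1.
  by rewrite -subDset subsetD1 in_setD (negbTE vt) andbF andbT subDset (bi_al h).
- exact: (bistellar_facet (bistellar_sym h)).
apply/facetP; split; first by rewrite (bi_gone h) // properD1.
move=> u uM sub; apply/eqP; rewrite eqEsubset sub /=.
have alu : al \subset u := subset_trans (subsetUl _ _) sub.
have vu : v \notin u.
  apply: contra (bistellar_out h uM) => vu; rewrite -(setD1K vbe) subUset sub1set vu.
  exact: subset_trans (subsetUr _ _) sub.
by rewrite -subDset subsetD1 in_setD (negbTE vu) andbF andbT subDset (bi_al h).
Qed.

(** The move goes from [N] back to [M]: it removes the edge [be], whose link in [N] is the boundary
    of the triangle [al]. *)
Lemma bistellar_bistellar_move M N al be : bistellar M N al be -> #|al| = 3 -> #|be| = 2 ->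
  (forall t, t \in M -> #|t| <= 4) -> bistellar_move 3 2 N M.
Proof.
move=> h a3 b2 hM; have sN := bi_K2 h.
have beN : be \in N by exact: bistellar_al (bistellar_sym h).
have cU : #|al :|: be| = 5 by rewrite cardsU (disjoint_setI0 (bi_dis h)) cards0 a3 b2.
split=> //; last 2 first.
- exact: bi_K h.
- exists be, al; split; [by rewrite b2|by rewrite a3 (bi_nal h)| |exact: bistellar_facets].
  apply/setP => t; rewrite !in_set; apply/idP/andP => [/and3P[tN dt bt]|[t0 tal]].
    split; first by apply: contraTneq tN => ->; apply: sN.1.
    have := bi_be h bt (subsetUl _ _); rewrite subUset => /andP[_ sub].
    have {}sub : t \subset al.
      have <- : t :\: be = t by apply/setDidPl; rewrite disjoint_sym.
      by rewrite subDset setUC.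
    by rewrite properEneq sub andbT; apply: contraNneq (bi_nal h) => <-.
  have bt := bi_new h tal; apply/and3P; split=> //; first exact: sN.2 bt (subsetUr _ _) t0.
  by rewrite disjoint_sym; apply: disjointWl (bi_dis h); apply: proper_sub.
rewrite /has_dimension; apply/eqP; rewrite eqn_leq; apply/andP; split.
  apply/bigmax_leqP => t tN; have nal := bistellar_out2 h tN.
  have [bt|nbe] := boolP (be \subset t); last by apply: hM; rewrite (bi_old h).
  rewrite -ltnS -cU; apply: proper_card; rewrite properE (bi_be h) //= subUset.
  by rewrite (negbTE nal).
have /set0Pn[v val] := bi_a h.
have tN : be :|: al :\ v \in N by apply: (bi_new h); apply: properD1.
apply: leq_trans (leq_bigmax_cond _ tN).
rewrite cardsU (_ : be :&: _ = set0) ?cards0 ?subn0.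
  by have := a3; rewrite (cardsD1 v) val b2 add1n => -[->].
by apply/eqP; rewrite setI_eq0 disjoint_sym; apply: disjointWl (bi_dis h); apply: subsetDl.
Qed.

(** Ordered pairs are counted, so a missing edge contributes 2 and each flip lowers the number by
    2. *)
Definition missing M := [set p : T * T | [&& p.1 \in vertices M, p.2 \in vertices M,
  p.1 != p.2 & [set p.1; p.2] \notin M]].

Lemma missing0 M : missing M = set0 -> neighbourly M.
Proof.
move=> m0 u v uV vV uv; apply/negPn/negP => e.
by have := in_set0 (u, v); rewrite -m0 in_set /= uV vV uv e.
Qed.

Lemma bistellar_missing M N al (x y : T) : bistellar M N al [set x; y] -> 2 < #|al| -> x != y ->
  x \in vertices M -> y \in vertices M -> #|missing N|.+2 = #|missing M|.
Proof.
move=> h a3 xy xV yV; have b2 : #|[set x; y]| = 2 by rewrite cards2 xy.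
have beN := bistellar_al (bistellar_sym h).
have eN p q : p != q -> ([set p; q] \notin N) = [&& (p, q) != (y, x), (p, q) != (x, y) & [set p; q] \notin M].
  move=> pq; have [sub|nsub] := boolP ([set x; y] \subset [set p; q]).
    have e : [set x; y] = [set p; q] by apply/eqP; rewrite eqEcard sub !cards2 xy pq.
    rewrite -e beN /=; symmetry; apply/negP => /and3P[n1 n2 _].
    have : (x \in [set p; q]) && (y \in [set p; q]) by rewrite -e !inE !eqxx orbT.
    rewrite !inE => /andP[/orP[/eqP ex|/eqP ex] /orP[/eqP ey|/eqP ey]].
    - by rewrite ex ey eqxx in xy.
    - by rewrite ex ey eqxx in n2.
    - by rewrite ex ey eqxx in n1.
    - by rewrite ex ey eqxx in xy.
  have nal : ~~ (al \subset [set p; q]).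
    by apply/negP => /subset_leq_card; rewrite cards2 pq leqNgt a3.
  rewrite (bi_old h nal nsub).
  have ne p' q' : [set p'; q'] = [set x; y] -> (p, q) != (p', q').
    by move=> e; apply: contraNneq nsub => -[-> ->]; rewrite e.
  by rewrite !ne // setUC.
have yx : y != x by rewrite eq_sym.
have inM : (x, y) \in missing M by rewrite in_set /= xV yV xy (bi_nbe h).
have inM' : (y, x) \in missing M :\ (x, y).
  by rewrite in_setD1 in_set /= xV yV yx setUC (bi_nbe h) xpair_eqE (negbTE yx).
rewrite (cardsD1 (x, y) (missing M)) inM (cardsD1 (y, x) (_ :\ _)) inM' !add1n; congr (_.+2); apply: eq_card => -[p q].
rewrite !in_setD1 /missing (bistellar_vertices h) ?b2 //; last exact: ltnW.
rewrite [LHS]in_set [(p, q) \in [set _ | _]]in_set /=.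
have [->|pq] := eqVneq p q; first by rewrite !andbF.
rewrite eN //=; case: (p \in _); case: (q \in _); rewrite ?andbF //=.
Qed.
End Flip.

Section Nine.
Variables (R : realType) (T : finType).
Implicit Types (M N : {set {set T}}) (s t al be : {set T}).

Lemma manifold_link M : combinatorial_manifold R 3 M ->
  forall v, v \in vertices M -> sphere2 (link M [set v]).
Proof. by case=> sM hL v vV; apply: (sphere2P (R := R)); [apply: link_complex|apply: hL]. Qed.

(** There are 9 * 8 = 72 ordered pairs of different vertices, and each is either an edge or
    missing. *)
Lemma missing_nbrs M : simplicial_complex M ->
  (forall v, v \in vertices M -> sphere2 (link M [set v])) -> #|vertices M| = 9 ->
  #|missing M| + \sum_(u in vertices M) #|nbrs (tets3 M) u| = 72.
Proof.
move=> sM hL V9; pose m u := [set v in vertices M | (u != v) && ([set u; v] \notin M)].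
have -> : #|missing M| = \sum_(u in vertices M) #|m u|.
  rewrite /missing -sum1dep_card -(pair_big_dep (fun u => u \in vertices M)
    (fun u v => [&& v \in vertices M, u != v & [set u; v] \notin M]) (fun _ _ => 1)) /=.
  by apply: eq_bigr => u _; rewrite sum1dep_card.
rewrite -big_split /= (_ : 72 = \sum_(u in vertices M) 8); last by rewrite sum_nat_const V9.
apply: eq_bigr => u uV; have := V9; rewrite (cardsD1 u) uV add1n => -[<-].
rewrite addnC -[RHS](cardsID (nbrs (tets3 M) u)); congr (_ + _).
  by rewrite (setIidPr (nbrs_sub (manifold_ok sM hL) u)).
apply: eq_card => v; rewrite in_setD (nbrsP sM hL) // mem_link // !in_set1 !in_set /=.
have -> : [set v] != set0 by apply/set0Pn; exists v; rewrite inE.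
by rewrite in_set1 [v == u]eq_sym; case: (u != v); rewrite ?andbF //= andbC.
Qed.

Lemma flip_missing M : combinatorial_manifold R 3 M -> #|vertices M| = 9 -> missing M != set0 ->
  exists N, [/\ combinatorial_manifold R 3 N, vertices N = vertices M,
    #|missing N|.+2 = #|missing M| & bistellar_move 3 2 N M].
Proof.
move=> cM V9 /set0Pn[[u v]]; rewrite in_set /= => /and4P[uV vV uv nuv].
have sM := cM.1; have hL := manifold_link cM; have ok := manifold_ok sM hL.
have nE p q : p \in vertices M -> p != q -> (q \in nbrs (tets3 M) p) = ([set p; q] \in M).
  move=> pV pq; rewrite (nbrsP sM hL) // mem_link // in_set1 pq /=.
  by rewrite (_ : [set q] != set0) //; apply/set0Pn; exists q; rewrite inE.
have vu : v != u by rewrite eq_sym.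
have vn : v \notin nbrs (tets3 M) u by rewrite nE.
have [s [x [y [xs ys xy [xX yX]]]]] := flip_exists ok V9 uV vV vu vn.
have [s3 sin] := card_base sM xs xX.
have inV z : z |: s \in tets3 M -> z \in vertices M.
  by case/tetP => + _; move/(face_vertex sM); apply; rewrite setU11.
have xV := inV x xX; have yV := inV y yX; rewrite nE // => nxy.
have b2 : #|[set x; y]| = 2 by rewrite cards2 xy.
have h : bistellar M (flip M s [set x; y]) s [set x; y].
  apply: flip_bistellar => //.
  - by rewrite disjoint_sym disjoints_subset subUset !sub1set !in_setC xs ys.
  - by rewrite -card_gt0 s3.
  - by rewrite -card_gt0 b2.
  (* A face through [s] has at most one further vertex, which is then one of the two apexes. *)
  - move=> t tM st; have t4 := dim_le4 sM hL tM.
    have [e|ne] := eqVneq (t :\: s) set0.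
      by rewrite -(setID t s) e setU0 subIset // subsetUl orbT.
    have /cards1P[z ez] : #|t :\: s| == 1.
      by rewrite eqn_leq card_gt0 ne andbT cardsD (setIidPr st) s3 leq_subLR.
    have tE : t = z |: s by rewrite -(setID t s) (setIidPr st) ez setUC.
    have zs : z \notin s.
      have : z \in t :\: s by rewrite ez inE.
      by rewrite in_setD => /andP[].
    have zX : z |: s \in tets3 M by apply/tetP; rewrite -tE; split=> //; rewrite tE cardsU1 zs s3.
    rewrite tE setUC setUS // sub1set !inE; have [//|zx] := eqVneq z x.
    by rewrite (apex_le2 sM hL xs ys zs xX yX zX xy) ?eqxx // eq_sym.
  move=> t tb.
  have [->|] := eqVneq t set0; first by rewrite setU0.
  case/set0Pn => z zt; have tE : t = [set z].
    apply/eqP; rewrite eq_sym eqEcard sub1set zt cards1 /= -ltnS -b2; exact: proper_card.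
  have := subsetP (proper_sub tb) z zt; rewrite tE !inE setUC => /orP[] /eqP ->.
    by case/tetP: xX.
  by case/tetP: yX.
have s1 : 1 < #|s| by rewrite s3.
have b1 : 1 < #|[set x; y]| by rewrite b2.
exists (flip M s [set x; y]); split.
- exact: (@bistellar_manifold _ _ _ _ _ h R 2).
- exact: bistellar_vertices h s1 b1.
- by apply: bistellar_missing h _ xy xV yV; rewrite s3.
by apply: bistellar_bistellar_move h s3 b2 _ => t tM; apply: dim_le4 tM.
Qed.

Lemma neighbourly_reachable k M : combinatorial_manifold R 3 M -> #|vertices M| = 9 ->
  #|missing M| <= k.*2 ->
  exists (N : {set {set T}}) (l : nat) (Ns : nat -> {set {set T}}),
    [/\ combinatorial_manifold R 3 N /\ #|vertices N| = 9,
        neighbourly N,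
        l <= k,
        Ns 0 = N /\ Ns l = M &
        (forall j, j <= l -> simplicial_complex (Ns j)) /\
        (forall j, 1 <= j <= l -> bistellar_move 3 2 (Ns j.-1) (Ns j))].
Proof.
elim: k M => [|k IH] M cM V9 mk; have [m0|mN] := eqVneq (missing M) set0.
1,3: exists M, 0, (fun=> M); split=> //; [exact: missing0|];
     by split=> [j _|[|j]]; rewrite ?ltn0 ?andbF //; case: cM.
  by move: mk; rewrite leqn0 cards_eq0 (negbTE mN).
have [N [cN VN mE mv]] := flip_missing cM V9 mN.
have [| |N0 [l [Ns [h1 h2 h3 [h4 h5] [h6 h7]]]]] := IH N cN; first by rewrite VN.
  by move: mk; rewrite -mE.
(* The sequence for [N] starts at its neighbourly end, so [M] is appended as the last term. *)
exists N0, l.+1, (fun j => if j <= l then Ns j else M); split=> //=.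
  by rewrite ltnn h4.
split=> [j _|j /andP[j0 jl]]; first by case: ifP => [/h6|_] //; exact: cM.1.
case: (leqP j l) => [jl'|lj]; first by rewrite (leq_trans (leq_pred _) jl'); apply: h7; rewrite j0.
have -> : j = l.+1 by apply/eqP; rewrite eqn_leq jl.
by rewrite /= leqnn h5.
Qed.
End Nine.

Theorem theorem1 (R : realType) (T : finType) (M : {set {set T}})
    (hM : combinatorial_manifold R 3 M) (hM9 : #|vertices M| = 9) :
  exists (N : {set {set T}}) (l : nat) (Ns : nat -> {set {set T}}),
    [/\ combinatorial_manifold R 3 N /\ #|vertices N| = 9,
        neighbourly N,
        l <= 10,
        Ns 0 = N /\ Ns l = M &
        (forall j, j <= l -> simplicial_complex (Ns j)) /\
        (forall j, 1 <= j <= l -> bistellar_move 3 2 (Ns j.-1) (Ns j))].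
Proof.
apply: neighbourly_reachable => //.
have sM := hM.1; have hL := manifold_link hM.
(* At most 72 - 52 = 20 ordered pairs are missing, that is, ten edges. *)
have := missing_nbrs sM hL hM9; have := sum_nbrs (manifold_ok sM hL) hM9.
by move: #|missing M| (\sum_(u in _) _) => a b; lia.
Qed.
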